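(* Let $\varepsilon>0$ and let $T=[0,T_0]$ (with $T_0>0$) or $T=[0,\infty)$. Then: (a) (Existence) For any given $u_0\in\mathcal V_{[0,1]}$ there exists a solution $(u,\beta)$ to the double-obstacle Allen--Cahn equation (ACE) with fidelity forcing on $T$ with $u(0)=u_0$. (b) (Comparison principle) If $(u,\beta),(v,\gamma)\in\mathcal V_{[0,1],t\in T}\times\mathcal V_{t\in T}$ with $u,v\in H^1_{loc}(T;\mathcal V)\cap C^0(T;\mathcal V)$ satisfy $$\varepsilon \frac{du}{dt}(t)+\varepsilon Au(t)-\varepsilon f+\tfrac12\mathbf 1-u(t)\ \ge\ \beta(t),\qquad \beta(t)\in\mathcal B(u(t)),$$ and $$\varepsilon \frac{dv}{dt}(t)+\varepsilon Av(t)-\varepsilon f+\tfrac12\mathbf 1-v(t)\ \le\ \gamma(t),\qquad \gamma(t)\in\mathcal B(v(t)),$$ vertexwise at a.e. $t\in T$, and $v(0)\le u(0)$ vertexwise, then $v(t)\le u(t)$ vertexwise for all $t\in T$. (c) (Uniqueness) If $(u,\beta)$ and $(v,\gamma)$ are solutions to the double-obstacle ACE with fidelity forcing on $T$ with $u(0)=v(0)$, then $u(t)=v(t)$ for all $t\in T$ and $\beta(t)=\gamma(t)$ at a.e. $t\in T$. (d) (Gradient flow) If $u$ is a solution to the double-obstacle ACE with fidelity forcing on $T$, then $t\mapsto \mathrm{GL}_{\varepsilon,\mu,\tilde f}(u(t))$ monotonically decreases (i.e. is non-increasing). (e) (Weak form) A function $u\in\mathcal V_{[0,1],t\in T}\cap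 H^1_{loc}(T;\mathcal V)\cap C^0(T;\mathcal V)$ (with associated $\beta(t)=\varepsilon\frac{du}{dt}(t)+\varepsilon Au(t)-\varepsilon f+\frac12\mathbf 1-u(t)$ for a.e. $t$) is a solution to the double-obstacle ACE with fidelity forcing on $T$ if and only if for almost every $t\in T$ and all $\eta\in\mathcal V_{[0,1]}$ $$\left\langle \varepsilon\frac{du}{dt}(t)+\varepsilon Au(t)-\varepsilon f+\tfrac12\mathbf 1-u(t),\ \eta-u(t)\right\rangle_{\mathcal V}\ge 0.$$ (f) (Explicit form) Suppose $\varepsilon^{-1}\notin\sigma(A)$ and let $B:=A-\varepsilon^{-1}I$. Then $(u,\beta)\in\mathcal V_{[0,1],t\in T}\times\mathcal V_{t\in T}$ is a solution to the double-obstacle ACE with fidelity forcing on $T$ if and only if for a.e. $t\in T$, $\beta(t)\in\mathcal B(u(t))$ and $\beta(t)\in\mathcal V_{[-1/2,1/2]}$, and for all $t\in T$ $$u(t)=e^{-tB}u(0)+B^{-1}\left(I-e^{-tB}\right)\left(f-\frac1{2\varepsilon}\mathbf 1\right)+\frac1\varepsilon\int_0^t e^{-(t-s)B}\beta(s)\,ds .$$ (g) (Lipschitz regularity) If $u$ is a solution to the double-obstacle ACE with fidelity forcing on $T$ and $\varepsilon^{-1}\notin\sigma(A)$, then $u\in C^{0,1}(T;\mathcal V)$, i.e. $u$ is Lipschitz continuous on $T$. (h) (Well-posedness) Let $u_0,v_0\in\mathcal V_{[0,1]}$, let $u,v$ be the solutions to the double-obstacle ACE with fidelity forcing on $T$ with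 $u(0)=u_0$ and $v(0)=v_0$, and suppose $\varepsilon^{-1}\notin\sigma(A)$. Then, with $\xi_1:=\min\sigma(A)$, for all $t\in T$ $$\|u(t)-v(t)\|_{\mathcal V}\le e^{-\xi_1t}e^{t/\varepsilon}\|u_0-v_0\|_{\mathcal V}.$$
   Context: Graph setting. $G=(V,E)$ is a finite, simple, undirected, weighted, connected graph without self-loops, with weights $\omega_{ij}\ge0$, $\omega_{ij}=\omega_{ji}$, $\omega_{ii}=0$, and $\omega_{ij}>0$ iff $ij\in E$; it has at least two vertices, so all degrees $d_i:=\sum_{j\in V}\omega_{ij}$ are positive. Fix $r\in[0,1]$. $\mathcal V:=\{u:V\to\mathbb R\}$; for $X\subseteq\mathbb R$, $\mathcal V_X:=\{u:V\to X\}$. For an interval $T$, $\mathcal V_{t\in T}:=\{u:T\to\mathcal V\}$ and $\mathcal V_{X,t\in T}:=\{u:T\to\mathcal V_X\}$. Inner product $\langle u,v\rangle_{\mathcal V}:=\sum_{i\in V}u_iv_id_i^r$ with norm $\|\cdot\|_{\mathcal V}$. $\|\nabla u\|_{\mathcal E}^2:=\frac12\sum_{i,j\in V}\omega_{ij}(u_j-u_i)^2$. Graph Laplacian: $(\Delta u)_i:=d_i^{-r}\sum_{j\in V}\omega_{ij}(u_i-u_j)$. $\mathbf 1$ and $\mathbf 0$ are the constant functions $1$ and $0$ on $V$, $I$ is the identity; $\sigma(F)$ is the set of eigenvalues of a linear operator $F:\mathcal V\to\mathcal V$. Fidelity. Fixed throughout: $\mu\in\mathcal V_{[0,\infty)}\setminus\{\mathbf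 0\}$ and $\tilde f\in\mathcal V_{[0,1]}$. $M:=\operatorname{diag}(\mu)$, $A:=\Delta+M$, $f:=M\tilde f$. Sobolev spaces. $H^1((a,b);\mathcal V)$ is the set of $u\in L^2((a,b);\mathcal V)$ with weak derivative $du/dt\in L^2((a,b);\mathcal V)$ (equivalently each $u_i\in H^1((a,b);\mathbb R)$); $H^1_{loc}(T;\mathcal V):=\{u\in\mathcal V_{t\in T}: u\in H^1((a,b);\mathcal V)\ \forall a,b\in T\}$. Subdifferential set. For $u\in\mathcal V$, $\mathcal B(u)=\emptyset$ if $u\notin\mathcal V_{[0,1]}$; for $u\in\mathcal V_{[0,1]}$, $\mathcal B(u)$ is the set of $\beta\in\mathcal V$ such that for each $i\in V$: $\beta_i\in[0,\infty)$ if $u_i=0$, $\beta_i=0$ if $0<u_i<1$, and $\beta_i\in(-\infty,0]$ if $u_i=1$. Double-obstacle ACE with fidelity forcing. A pair $(u,\beta)\in\mathcal V_{[0,1],t\in T}\times\mathcal V_{t\in T}$ is a solution on the interval $T$ when $u\in H^1_{loc}(T;\mathcal V)\cap C^0(T;\mathcal V)$ and for almost every $t\in T$ $$\varepsilon\frac{du}{dt}(t)+\varepsilon Au(t)-\varepsilon f+\tfrac12\mathbf 1-u(t)=\beta(t),\qquad\beta(t)\in\mathcal B(u(t)).$$ One also calls $u$ alone a solution, $\beta$ being determined a.e. by $u$. Ginzburg--Landau energy. $\mathrm{GL}_{\varepsilon,\mu,\tilde f}(u):=\frac12\|\nabla u\|_{\mathcal E}^2+\frac1\varepsilon\langle W\circ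 u,\mathbf 1\rangle_{\mathcal V}+\frac12\langle u-\tilde f,M(u-\tilde f)\rangle_{\mathcal V}$, where $W(x)=\frac12x(1-x)$ for $0\le x\le1$ and $W(x)=\infty$ otherwise. *)

(* Defs.v *)
From HB Require Import structures.
From mathcomp Require Import all_boot all_order all_algebra.
From mathcomp Require Import all_classical all_reals all_analysis.

Set Implicit Arguments.
Unset Strict Implicit.
Unset Printing Implicit Defensive.

Import Order.TTheory GRing.Theory Num.Theory.
Import numFieldNormedType.Exports.

Local Open Scope classical_set_scope.
Local Open Scope ring_scope.

Record weighted_graph (R : realType) (V : finType) := WeightedGraph {
  edge : rel V;
  weight : V -> V -> R;
  weight_ge0 : forall i j, 0 <= weight i j;
  weight_sym : forall i j, weight i j = weight j i;
  weight_diag : forall i, weight i i = 0;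
  weight_edge : forall i j, (0 < weight i j) = edge i j;
  edge_connected : forall i j, connect edge i j }.

Definition deg (R : realType) (V : finType) (G : weighted_graph R V) (i : V)
  : R := \sum_j weight G i j.

Definition inner (R : realType) (V : finType) (G : weighted_graph R V) (r : R)
  (u v : V -> R) : R := \sum_i u i * v i * deg G i `^ r.

Definition normV (R : realType) (V : finType) (G : weighted_graph R V) (r : R)
  (u : V -> R) : R := Num.sqrt (inner G r u u).

Definition grad_sqnorm (R : realType) (V : finType) (G : weighted_graph R V)
  (u : V -> R) : R :=
  2^-1 * \sum_i \sum_j weight G i j * (u j - u i) ^+ 2.

Definition laplacian (R : realType) (V : finType) (G : weighted_graph R V)
  (r : R) (u : V -> R) : V -> R :=
  fun i => deg G i `^ (- r) * \sum_j weight G i j * (u i - u j).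

Definition fidelity (R : realType) (V : finType) (mu : V -> R) (u : V -> R)
  : V -> R := fun i => mu i * u i.

Definition opA (R : realType) (V : finType) (G : weighted_graph R V) (r : R)
  (mu u : V -> R) : V -> R :=
  laplacian G r u \+ fidelity mu u.

Definition opB (R : realType) (V : finType) (G : weighted_graph R V) (r eps : R)
  (mu u : V -> R) : V -> R :=
  fun i => opA G r mu u i - eps^-1 * u i.

Definition spectrum (R : realType) (V : finType) (F : (V -> R) -> (V -> R))
  : set R :=
  [set l | exists u : V -> R, u <> (fun=> 0) /\ F u = (fun i => l * u i)].

(* exp(c F) u = \sum_k c^k F^k u / k!, for a linear operator F; the limit is
   taken vertexwise *)
Definition exp_op (R : realType) (V : finType) (F : (V -> R) -> (V -> R))
  (c : R) (u : V -> R) : V -> R :=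
  fun i => limn (series (fun k => c ^+ k / k`!%:R * iter k F u i)).

(* the inverse of F when F is bijective *)
Definition inv_op (R : realType) (V : finType) (F : (V -> R) -> (V -> R))
  : (V -> R) -> (V -> R) := 'pinv_(fun=> (fun=> 0)) [set: V -> R] F.

Definition in01 (R : realType) (V : finType) (u : V -> R) : Prop :=
  forall i, 0 <= u i <= 1.

(* Lebesgue measurability is stated as almost everywhere equality with a Borel
   function, since lebesgue_measure lives on the Borel sigma-algebra. Changing a
   function on a null set does not affect its integral \int[lebesgue_measure],
   even if the result is no longer Borel measurable. *)
Definition L1 (R : realType) (D : set R) (f : R -> R) : Prop :=
  exists2 g : R -> R,
    (@lebesgue_measure R).-integrable D (EFin \o g) &
    ae_eq (@lebesgue_measure R) D f g.

Definition L2 (R : realType) (D : set R) (f : R -> R) : Prop :=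
  exists2 g : R -> R,
    measurable_fun D g /\
    (@lebesgue_measure R).-integrable D (fun t => (g t ^+ 2)%:E) &
    ae_eq (@lebesgue_measure R) D f g.

Definition test_function (R : realType) (a b : R) (phi : R -> R) : Prop :=
  (forall k x, derivable (derive1n k phi) x 1) /\
  compact (closure [set x | phi x != 0]) /\
  closure [set x | phi x != 0] `<=` `]a, b[.

Definition weak_derivative (R : realType) (a b : R) (f g : R -> R) : Prop :=
  forall phi, test_function a b phi ->
    \int[@lebesgue_measure R]_(t in `]a, b[) (f t * derive1 phi t) =
    - \int[@lebesgue_measure R]_(t in `]a, b[) (g t * phi t).

(* u lies in H^1((a,b);V) with du/dt = w *)
Definition H1_with (R : realType) (V : finType) (a b : R) (u w : R -> V -> R)
  : Prop :=
  forall i, [/\ L2 `]a, b[ (u ^~ i), L2 `]a, b[ (w ^~ i) &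
                weak_derivative a b (u ^~ i) (w ^~ i)].

Definition H1 (R : realType) (V : finType) (a b : R) (u : R -> V -> R) : Prop :=
  exists w, H1_with a b u w.

Definition H1loc (R : realType) (V : finType) (T : set R) (u : R -> V -> R)
  : Prop := forall a b, T a -> T b -> H1 a b u.

(* w is (a representative of) du/dt on T, for u in H^1_loc(T;V) *)
Definition is_ddt (R : realType) (V : finType) (T : set R) (u w : R -> V -> R)
  : Prop := forall a b, T a -> T b -> H1_with a b u w.

Definition C0 (R : realType) (V : finType) (T : set R) (u : R -> V -> R)
  : Prop := forall i, {within T, continuous (u ^~ i)}.

(* Functions of time are total; only their values on T are relevant. *)
Definition regular01 (R : realType) (V : finType) (T : set R) (u : R -> V -> R)
  : Prop := [/\ forall t, T t -> in01 (u t), H1loc T u & C0 T u].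

Definition subdiff (R : realType) (V : finType) (u : V -> R) : set (V -> R) :=
  [set beta | in01 u /\
    forall i, [/\ u i = 0 -> 0 <= beta i,
                  0 < u i < 1 -> beta i = 0 &
                  u i = 1 -> beta i <= 0]].

(* eps du/dt + eps A u - eps f + 1/2 - u, with w for du/dt and f = M tf *)
Definition ace (R : realType) (V : finType) (G : weighted_graph R V)
  (r eps : R) (mu tf : V -> R) (w u : V -> R) : V -> R :=
  fun i => eps * w i + eps * opA G r mu u i - eps * fidelity mu tf i
           + 2^-1 - u i.

Definition solution (R : realType) (V : finType) (G : weighted_graph R V)
  (r eps : R) (mu tf : V -> R) (T : set R) (u beta : R -> V -> R) : Prop :=
  regular01 T u /\
  exists2 w, is_ddt T u w &
    {ae @lebesgue_measure R, forall t, T t ->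
      ace G r eps mu tf (w t) (u t) = beta t /\ subdiff (u t) (beta t)}.

Definition solution_u (R : realType) (V : finType) (G : weighted_graph R V)
  (r eps : R) (mu tf : V -> R) (T : set R) (u : R -> V -> R) : Prop :=
  exists beta, solution G r eps mu tf T u beta.

Definition doubleobstacle (R : realType) (x : R) : \bar R :=
  if 0 <= x <= 1 then (2^-1 * x * (1 - x))%:E else +oo%E.

Definition GL (R : realType) (V : finType) (G : weighted_graph R V)
  (r eps : R) (mu tf : V -> R) (u : V -> R) : \bar R :=
  ((2^-1 * grad_sqnorm G u)%:E
   + eps^-1%:E * (\sum_i doubleobstacle (u i) * (deg G i `^ r)%:E)
   + (2^-1 * inner G r (u \- tf) (fidelity mu (u \- tf)))%:E)%E.

Definition duhamel_integrand (R : realType) (V : finType)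
  (B : (V -> R) -> (V -> R)) (beta : R -> V -> R) (t s : R) : V -> R :=
  exp_op B (- (t - s)) (beta s).

Definition duhamel (R : realType) (V : finType) (G : weighted_graph R V)
  (r eps : R) (mu tf : V -> R) (u0 : V -> R) (beta : R -> V -> R) (t : R)
  : V -> R :=
  let B := opB G r eps mu in
  let c : V -> R := fun i => fidelity mu tf i - (2 * eps)^-1 in
  fun i => exp_op B (- t) u0 i
           + inv_op B (c \- exp_op B (- t) c) i
           + eps^-1 * \int[@lebesgue_measure R]_(s in `[0, t])
                        duhamel_integrand B beta t s i.

(* Main.v *)
(* A solution is obtained as the limit of projected Euler steps
   u |-> clip (u + h g(u)), where g(u) = f - 1/(2 eps) - B u and clip is the
   projection onto [0, 1]; the limit moves with velocity g_i(u) where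
   0 < u_i < 1 and with velocity 0 where u_i is 0 or 1. Functions in H^1 of an
   interval are the integrals of their weak derivatives, which reduces comparison
   and well-posedness to Gronwall's inequality for the weighted square sums of
   max(v - u, 0) and of u - v: the subdifferential is monotone, and A is
   nonnegative (up to truncation) or bounded below by its least eigenvalue, the
   minimum of the Rayleigh quotient. At almost every time at which u_i is 0 or 1
   it is extremal, so du_i/dt is either 0 or g_i(u); this bounds du/dt and beta
   and gives dGL/dt <= 0. The explicit form is the variation of constants formula
   for du/dt = -B u + f - 1/(2 eps) + beta / eps. *)

Require Import Defs.
From HB Require Import structures.
From mathcomp Require Import all_boot all_order all_algebra.
From mathcomp Require Import all_classical all_reals all_analysis.
From mathcomp Require Import measurable_realfun.
From mathcomp Require Import ring lra.

Set Implicit Arguments.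
Unset Strict Implicit.
Unset Printing Implicit Defensive.

Import Order.TTheory GRing.Theory Num.Theory.
Import numFieldNormedType.Exports.

Local Open Scope classical_set_scope.
Local Open Scope ring_scope.

(** * Integrals of almost everywhere equal functions *)

(** The limit velocity is a discontinuous function of the state at the obstacles, so a fixed-point
    argument for Lipschitz fields does not apply. The Euler scheme passes on a single estimate,
    [u t = clip01 (u s + (t - s) * g (u s))] up to [L * C * (t - s) ^+ 2], which holds for the
    polygons because clipped motions at a frozen velocity compose. The velocity is then found
    through functions whose derivative vanishes at 0 and 1: along them the clipping is invisible to
    first order, and they approximate the identity. Elsewhere all calculus is done with absolutely
    continuous functions in integral form. Their chain rule is proved for functions with Lipschitz
    derivative; squares and squared positive parts are of this kind, which is why the Gronwall
    arguments use them and why products are obtained by polarisation. Weak derivatives see only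
    smooth compactly supported functions, so explicit smooth steps are built to recover the integral
    form. Neither [beta] nor the chosen [du/dt] has to be Borel; integrands are therefore exchanged
    for Borel representatives throughout. *)

Section ae_integral.
Context d (T : measurableType d) (R : realType) (mu : {measure set T -> \bar R}).
Import HBNNSimple.

Lemma ge0_integral_aeW (f g : T -> \bar R) :
  (forall x, 0 <= f x)%E -> (forall x, 0 <= g x)%E ->
  ae_eq mu setT f g -> (\int[mu]_x f x <= \int[mu]_x g x)%E.
Proof.
move=> f0 g0 [N [mN N0 fgN]]; have mNC := measurableC mN.
rewrite !ge0_integralTE//; apply: ge_ereal_sup => _ [h/= hf <-].
(* Zero on the null set [N], so that [h'] stays below [g] everywhere while its integral is that of
   [h]. *)
pose h' := proj_nnsfun h mNC.
have h'E x : h' x = if x \in ~` N then h x else 0.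
  by rewrite /h' -(mrestrict h mNC) patchE.
apply: le_ereal_sup_tmp; exists (sintegral mu h').
  exists h' => [x|//]; rewrite h'E; case: ifPn => [|_]; last exact: g0.
  rewrite inE => xN; rewrite (le_trans (hf x))// le_eqVlt; apply/orP; left.
  by apply/eqP; apply: contrapT => fgx; apply/xN/fgN => /= /(_ I).
rewrite -!integralT_nnsfun le_eqVlt; apply/orP; left; apply/eqP.
apply: ge0_ae_eq_integral => //.
- by apply/measurable_EFinP; exact: measurable_funP.
- by apply/measurable_EFinP; exact: measurable_funP.
- by move=> x _; rewrite lee_fin.
- by move=> x _; rewrite lee_fin.
exists N; split=> // x /= /not_implyP[_] hx; apply: contrapT => xN; apply: hx.
by have /= -> := h'E x; rewrite mem_set.
Qed.

(* Neither function has to be measurable: the integral is a supremum over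
   simple functions, and these may be set to 0 on a null set. *)
Lemma Rintegral_ae (D : set T) (f g : T -> R) :
  ae_eq mu D f g -> \int[mu]_(x in D) f x = \int[mu]_(x in D) g x.
Proof.
move=> fg; rewrite /Rintegral; congr fine.
rewrite integral_mkcond [RHS]integral_mkcond.
set F := (fun x => (f x)%:E) \_ D; set G := (fun x => (g x)%:E) \_ D.
have FG : ae_eq mu setT F G.
  apply: filterS fg => x fgx _; rewrite /F /G !patchE; case: ifPn => //.
  by rewrite inE => /fgx ->.
have [FGp FGn] := (ae_eq_funeposneg mu setT F G).1 FG.
rewrite [LHS]integralE [RHS]integralE; congr (_ - _)%E; apply/eqP; rewrite eq_le.
  by rewrite !ge0_integral_aeW//; exact: ae_eq_sym.
by rewrite !ge0_integral_aeW//; exact: ae_eq_sym.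
Qed.

End ae_integral.

Section lebesgue_ae.
Context (R : realType).
Notation mu := (@lebesgue_measure R).
Implicit Types (P Q S : R -> Prop).

Lemma lebesgue_aeW P : (forall t, P t) -> {ae mu, forall t, P t}.
Proof. by move=> ?; exact: aeW. Qed.

Lemma lebesgue_aeS P Q : (forall t, P t -> Q t) ->
  {ae mu, forall t, P t} -> {ae mu, forall t, Q t}.
Proof. by move=> PQ; apply: filterS; first exact: (ae_filter_ringOfSetsType mu). Qed.

Lemma lebesgue_aeS2 P Q S : (forall t, P t -> Q t -> S t) ->
  {ae mu, forall t, P t} -> {ae mu, forall t, Q t} -> {ae mu, forall t, S t}.
Proof. by move=> PQ; apply: filterS2; first exact: (ae_filter_ringOfSetsType mu). Qed.

Lemma lebesgue_aeI P Q : {ae mu, forall t, P t} -> {ae mu, forall t, Q t} ->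
  {ae mu, forall t, P t /\ Q t}.
Proof. exact: lebesgue_aeS2. Qed.

Lemma lebesgue_ae_nat (P : nat -> R -> Prop) :
  (forall n, {ae mu, forall t, P n t}) -> {ae mu, forall t, forall n, P n t}.
Proof. exact: ae_foralln. Qed.

Lemma lebesgue_ae_fin (I : finType) (P : I -> R -> Prop) :
  (forall i, {ae mu, forall t, P i t}) -> {ae mu, forall t, forall i, P i t}.
Proof.
move=> Pi; have : {ae mu, forall t, forall n : nat,
    if insub n is Some k then P (enum_val (k : 'I_#|I|)) t else True}.
  apply: lebesgue_ae_nat => n; case: insub => [k|]; first exact: Pi.
  exact: lebesgue_aeW.
apply: lebesgue_aeS => t Pt i; have := Pt (enum_rank i).
by rewrite valK enum_rankK.
Qed.

Lemma lebesgue_ae_neq (c : R) : {ae mu, forall t, t != c}.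
Proof.
exists [set c]; split; [exact: measurable_set1|exact: lebesgue_measure_set1|].
by move=> t /= /negP; rewrite negbK => /eqP.
Qed.

Lemma lebesgue_ae_itvoo (a b : R) : {ae mu, forall t, a <= t <= b -> a < t < b}.
Proof.
apply: lebesgue_aeS2 (lebesgue_ae_neq a) (lebesgue_ae_neq b) => t ta tb.
by rewrite !lt_neqAle eq_sym ta tb.
Qed.

Lemma lebesgue_Rintegral_ae (D : set R) (f g : R -> R) :
  ae_eq mu D f g -> \int[mu]_(x in D) f x = \int[mu]_(x in D) g x.
Proof. exact: Rintegral_ae. Qed.

End lebesgue_ae.

(** * Integrals over segments *)

Section primitives.
Context (R : realType).
Notation mu := (@lebesgue_measure R).
Implicit Types (a b c x y : R) (f g u v w : R -> R).

Definition integrable_on a b f := mu.-integrable `[a, b] (EFin \o f).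

Lemma within_continuous_itvP a b f :
  {within `[a, b], continuous f} <->
  forall c, a <= c <= b -> forall e, 0 < e -> exists2 d, 0 < d &
    forall x, a <= x <= b -> `|x - c| < d -> `|f x - f c| < e.
Proof.
rewrite subspace_continuousP; split=> cf c.
  move=> acb e e0; have /cvgrPdist_lt/(_ e e0) := cf c acb.
  rewrite near_withinE => -[d /= d0 dP]; exists d => // x axb xc.
  by rewrite distrC; apply: dP => //=; rewrite distrC.
rewrite /= in_itv/= => acb; apply/cvgrPdist_lt => e e0; rewrite near_withinE.
have [d d0 dP] := cf c acb e e0; exists d => //= x xc; rewrite in_itv/= => axb.
by rewrite distrC; apply: dP => //; rewrite distrC.
Qed.

Lemma integrable_onS a b x y f : a <= x -> y <= b ->
  integrable_on a b f -> integrable_on x y f.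
Proof.
by move=> ax yb; apply: integrableS => //; apply: subset_itv; rewrite bnd_simp.
Qed.

Lemma integrable_onD a b f g : integrable_on a b f -> integrable_on a b g ->
  integrable_on a b (fun t => f t + g t).
Proof. by move=> fi gi; exact: (integrableD _ fi gi). Qed.

Lemma integrable_onZ a b k f : integrable_on a b f ->
  integrable_on a b (fun t => k * f t).
Proof. by move=> fi; exact: (integrableZl _ k fi). Qed.

Lemma integrable_onB a b f g : integrable_on a b f -> integrable_on a b g ->
  integrable_on a b (fun t => f t - g t).
Proof. by move=> fi gi; exact: (integrableB _ fi gi). Qed.

Lemma integrable_on_norm a b f : integrable_on a b f ->
  integrable_on a b (fun t => `|f t|).
Proof. by move=> fi; exact: (integrable_norm fi). Qed.

Lemma integrable_on_sum (I : finType) a b (f : I -> R -> R) :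
  (forall i, integrable_on a b (f i)) ->
  integrable_on a b (fun t => \sum_i f i t).
Proof.
move=> fi; have := @integrable_sum _ _ _ mu `[a, b]%classic (measurable_itv _)
  _ (index_enum I) xpredT (fun i t => (f i t)%:E) (fun i _ => fi i).
by apply: eq_integrable => // t _; rewrite /= sumEFin.
Qed.

Lemma integrable_on_continuous a b f : {within `[a, b], continuous f} ->
  integrable_on a b f.
Proof. by apply: continuous_compact_integrable; exact: segment_compact. Qed.

Lemma integrable_on_cst a b k : integrable_on a b (fun=> k).
Proof. by apply/integrable_on_continuous/continuous_subspaceT => x; exact: cvg_cst. Qed.

Lemma integrable_onM a b f g : {within `[a, b], continuous f} ->
  integrable_on a b g -> integrable_on a b (fun t => f t * g t).
Proof.
move=> cf gi; apply: (integrableMr _ _ _ gi) => //.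
  exact: subspace_continuous_measurable_fun.
have /compact_bounded[M [_ mrt]] := continuous_compact cf (@segment_compact _ a b).
by exists M; split; rewrite ?num_real // => ? ? ? ?; exact: mrt.
Qed.

Lemma integral_on_cat a b c f : a <= c -> c <= b -> integrable_on a b f ->
  \int[mu]_(t in `[a, b]) f t =
  \int[mu]_(t in `[a, c]) f t + \int[mu]_(t in `[c, b]) f t.
Proof.
move=> ac cb fi.
have := @Rintegral_itvB R f (BLeft a) (BRight b) c fi.
rewrite !bnd_simp => /(_ ac cb) H; apply/eqP; rewrite addrC -subr_eq H; apply/eqP.
apply: Rintegral_itv_obnd_cbnd; apply: integrableS fi => //.
by apply: subset_itv; rewrite bnd_simp.
Qed.

Lemma integral_on_set1 a f : \int[mu]_(t in `[a, a]) f t = 0.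
Proof. by rewrite set_itv1 Rintegral_set1. Qed.

Lemma integral_on_cst a b k : a <= b -> \int[mu]_(t in `[a, b]) k = k * (b - a).
Proof.
move=> ab; rewrite Rintegral_cst//; congr (_ * _).
transitivity (fine (if (a%:E < b%:E)%E then (b%:E - a%:E)%E else 0%E)).
  by congr fine; exact: lebesgue_measure_itv.
rewrite lte_fin; move: ab; rewrite le_eqVlt => /predU1P[->|->//].
by rewrite ltxx subrr.
Qed.

Lemma integral_onD a b f g : integrable_on a b f -> integrable_on a b g ->
  \int[mu]_(t in `[a, b]) (f t + g t) =
  \int[mu]_(t in `[a, b]) f t + \int[mu]_(t in `[a, b]) g t.
Proof. by move=> fi gi; exact: RintegralD. Qed.

Lemma integral_onB a b f g : integrable_on a b f -> integrable_on a b g ->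
  \int[mu]_(t in `[a, b]) (f t - g t) =
  \int[mu]_(t in `[a, b]) f t - \int[mu]_(t in `[a, b]) g t.
Proof. by move=> fi gi; exact: RintegralB. Qed.

Lemma integral_onZ a b k f : integrable_on a b f ->
  \int[mu]_(t in `[a, b]) (k * f t) = k * \int[mu]_(t in `[a, b]) f t.
Proof. by move=> fi; exact: RintegralZl. Qed.

Lemma integral_on_sum (I : finType) a b (f : I -> R -> R) :
  (forall i, integrable_on a b (f i)) ->
  \int[mu]_(t in `[a, b]) (\sum_i f i t) =
  \sum_i \int[mu]_(t in `[a, b]) f i t.
Proof.
move=> fi; elim: (index_enum I) => [|i s IH].
  rewrite big_nil -[RHS](mul0r (fine (mu `[a, b]))) -Rintegral_cst//.
  by apply: eq_Rintegral => t _; rewrite big_nil.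
rewrite big_cons -IH -RintegralD//.
- by apply: eq_Rintegral => t _; rewrite big_cons.
- exact: fi.
have := @integrable_sum _ _ _ mu `[a, b]%classic (measurable_itv _)
  _ s xpredT (fun i t => (f i t)%:E) (fun i _ => fi i).
by apply: eq_integrable => // t _; rewrite /= sumEFin.
Qed.

Lemma le_integral_on a b f g : integrable_on a b f -> integrable_on a b g ->
  {ae mu, forall t, a <= t <= b -> f t <= g t} ->
  \int[mu]_(t in `[a, b]) f t <= \int[mu]_(t in `[a, b]) g t.
Proof.
move=> fi gi fg; rewrite -subr_ge0 -integral_onB//.
(* The difference is nonnegative only almost everywhere; its absolute value is so everywhere and has
   the same integral. *)
rewrite (@lebesgue_Rintegral_ae R _ _ (fun t => `|g t - f t|)); last first.
  apply: lebesgue_aeS fg => t + /=; rewrite in_itv/= => /[apply] ?.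
  by rewrite ger0_norm ?subr_ge0.
exact: Rintegral_ge0.
Qed.

Lemma eq_integral_on a b f g : {ae mu, forall t, a <= t <= b -> f t = g t} ->
  \int[mu]_(t in `[a, b]) f t = \int[mu]_(t in `[a, b]) g t.
Proof.
by move=> fg; apply: lebesgue_Rintegral_ae; apply: lebesgue_aeS fg => t + /=; rewrite in_itv.
Qed.

Lemma normr_integral_on a b f : integrable_on a b f ->
  `|\int[mu]_(t in `[a, b]) f t| <= \int[mu]_(t in `[a, b]) `|f t|.
Proof. by move=> fi; exact: le_normr_Rintegral. Qed.

(* The increments are compared only on small intervals around each point; the
   supremum of the times up to which the inequality holds is then [b]. *)
Lemma le_of_local_increments a b (H m : R -> R) : a <= b ->
  (forall eta, 0 < eta -> forall c, a <= c <= b -> exists2 d, 0 < d &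
    forall x y, a <= x -> x <= c -> c <= y -> y <= b -> c - x < d -> y - c < d ->
      H y - H x <= eta * (m y - m x)) ->
  H b <= H a.
Proof.
move=> ab Hm.
suff He eta : 0 < eta -> H b - H a <= eta * (m b - m a).
  rewrite -subr_le0 leNgt; apply/negP => Hab.
  have [mab|mab] := leP (m b - m a) 0.
    have := He 1 ltr01; rewrite mul1r => /(lt_le_trans Hab); rewrite ltNge.
    by rewrite mab.
  (* This [eta] makes the right-hand side half of the positive number [H b - H a]. *)
  have := He _ (divr_gt0 Hab (mulr_gt0 (ltr0Sn R 1) mab)).
  have -> : (H b - H a) / (2 * (m b - m a)) * (m b - m a) = (H b - H a) / 2.
    by field; rewrite gt_eqF.
  by lra.
move=> eta0; pose S := [set x | a <= x <= b /\ H x - H a <= eta * (m x - m a)].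
have Sa : S a by split; rewrite ?lexx ?ab// !subrr mulr0.
have Sub : ubound S b by move=> x [/andP[]].
have supS : has_sup S by split; [exists a|exists b].
have ac : a <= sup S by apply: ub_le_sup => //; exists b.
have cb : sup S <= b by apply: ge_sup => //; exists a.
have [d d0 dP] := Hm eta eta0 (sup S) (introT andP (conj ac cb)).
have [x Sx cx] := sup_adherent d0 supS; have [/andP[ax xb] Hx] := Sx.
have xc : x <= sup S by apply: ub_le_sup => //; exists b.
have Sy y : sup S <= y -> y <= b -> y - sup S < d -> S y.
  move=> cy yb yd; split; first by rewrite yb (le_trans ac).
  have := dP x y ax xc cy yb _ yd; rewrite ltrBlDr -ltrBlDl => /(_ _).
  by move: cx; rewrite ltrBlDr => cx /(_ ltac:(lra)); lra.
have [cltb|] := ltP (sup S) b; last first.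
  move=> bc; have [] := Sy b cb (lexx b) => //.
  by rewrite (le_lt_trans _ d0)// subr_le0.
pose y := Num.min b (sup S + d / 2).
have cy : sup S < y by rewrite lt_min cltb ltrDl divr_gt0.
have yb : y <= b by rewrite ge_min lexx.
have yd : y <= sup S + d / 2 by rewrite ge_min lexx orbT.
have : y <= sup S.
  by apply: ub_le_sup; [exists b|apply: Sy => //; [exact: ltW|lra]].
by rewrite leNgt cy.
Qed.

End primitives.

(** * Absolutely continuous functions *)

Section primitives.
Context (R : realType).
Notation mu := (@lebesgue_measure R).
Implicit Types (a b c x y : R) (f g u v w z : R -> R).

(** Absolute continuity with density [w], in integral form. Asking for every subinterval makes
    restriction immediate and singles out no initial time. *)
Definition primitive_on a b u w := integrable_on a b w /\
  forall x y, a <= x -> x <= y -> y <= b -> u y - u x = \int[mu]_(t in `[x, y]) w t.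

Lemma primitive_onS a b x y u w : a <= x -> y <= b ->
  primitive_on a b u w -> primitive_on x y u w.
Proof.
move=> ax yb [wi uw]; split; first exact: integrable_onS wi.
move=> p q xp pq qy; apply: uw => //; [exact: le_trans xp|exact: le_trans yb].
Qed.

Lemma primitive_on_continuous a b u w : primitive_on a b u w ->
  {within `[a, b], continuous u}.
Proof.
move=> [wi uw]; have [ab|ba] := leP a b; last first.
  by rewrite set_itv_ge ?bnd_simp -?ltNge//; exact: continuous_subspace0.
apply: (@subspace_eq_continuous _ _ _ (fun x => u a + \int[mu]_(t in `[a, x]) w t)).
  move=> x; rewrite inE/= in_itv/= => /andP[ax xb]; rewrite -uw//.
  by rewrite subrKC.
have := parameterized_integral_continuous ab wi.
move/within_continuous_itvP => ci; apply/within_continuous_itvP => c /ci{}ci e /ci.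
move=> [d d0 dP]; exists d => // x xab /(dP _ xab).
by congr (`|_| < e); rewrite opprD addrACA subrr add0r.
Qed.

Lemma primitive_onD a b u v w z : primitive_on a b u w -> primitive_on a b v z ->
  primitive_on a b (fun t => u t + v t) (fun t => w t + z t).
Proof.
move=> [wi uw] [zi vz]; split; first exact: integrable_onD.
move=> x y ax xy yb; rewrite integral_onD; [|exact: integrable_onS wi|exact: integrable_onS zi].
by rewrite -uw// -vz//; lra.
Qed.

Lemma primitive_onZ a b k u w : primitive_on a b u w ->
  primitive_on a b (fun t => k * u t) (fun t => k * w t).
Proof.
move=> [wi uw]; split; first exact: integrable_onZ.
move=> x y ax xy yb; rewrite integral_onZ; last exact: integrable_onS wi.
by rewrite -uw//; lra.
Qed.

Lemma primitive_onB a b u v w z : primitive_on a b u w -> primitive_on a b v z ->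
  primitive_on a b (fun t => u t - v t) (fun t => w t - z t).
Proof.
move=> [wi uw] [zi vz]; split; first exact: integrable_onB.
move=> x y ax xy yb; rewrite integral_onB; [|exact: integrable_onS wi|exact: integrable_onS zi].
by rewrite -uw// -vz//; lra.
Qed.

Lemma primitive_on_cst a b k : primitive_on a b (fun=> k) (fun=> 0).
Proof.
split; first exact: integrable_on_cst.
by move=> x y _ xy _; rewrite integral_on_cst// subrr mul0r.
Qed.

Lemma primitive_on_sum (I : finType) a b (u w : I -> R -> R) :
  (forall i, primitive_on a b (u i) (w i)) ->
  primitive_on a b (fun t => \sum_i u i t) (fun t => \sum_i w i t).
Proof.
move=> uw; split; first by apply: integrable_on_sum => i; case: (uw i).
move=> x y ax xy yb; rewrite integral_on_sum -?sumrB.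
  by apply: eq_bigr => i _; case: (uw i) => _ ->.
by move=> i; case: (uw i) => wi _; exact: integrable_onS wi.
Qed.

Lemma primitive_on_integral a b f : integrable_on a b f ->
  primitive_on a b (fun x => \int[mu]_(t in `[a, x]) f t) f.
Proof.
move=> fi; split=> // x y ax xy yb.
rewrite (integral_on_cat ax xy); first by rewrite addrAC subrr add0r.
exact: integrable_onS fi.
Qed.

Lemma eq_primitive_on a b u v w : (forall t, a <= t <= b -> u t = v t) ->
  primitive_on a b u w -> primitive_on a b v w.
Proof.
move=> uv [wi uw]; split=> // x y ax xy yb.
by rewrite -uw// -!uv// ?ax ?yb ?(le_trans xy) ?(le_trans ax).
Qed.

(** The function [m] measures how much may happen on a short interval: time itself when velocities
    are continuous, the integral of [|w|] when the density [w] is merely integrable and the length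
    controls nothing. *)
Lemma eq_of_local_increments a b (H m : R -> R) : a <= b ->
  (forall eta, 0 < eta -> forall c, a <= c <= b -> exists2 d, 0 < d &
    forall x y, a <= x -> x <= c -> c <= y -> y <= b -> c - x < d -> y - c < d ->
      `|H y - H x| <= eta * (m y - m x)) ->
  H b = H a.
Proof.
move=> ab Hm; apply/eqP; rewrite eq_le; apply/andP; split.
  apply: (@le_of_local_increments _ a b H m ab) => eta eta0 c acb.
  have [d d0 dP] := Hm eta eta0 c acb; exists d => // x y *.
  by apply: le_trans (ler_norm _) (dP x y _ _ _ _ _ _).
rewrite -lerN2; apply: (@le_of_local_increments _ a b (fun t => - H t) m ab) => eta eta0 c acb.
have [d d0 dP] := Hm eta eta0 c acb; exists d => // x y *.
apply: le_trans (dP x y _ _ _ _ _ _) => //.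
by rewrite opprK addrC -normrN opprB ler_norm.
Qed.

(** On a short interval around [c], both [phi \o u] and the integral of the candidate derivative
    grow by [phi' (u c)] times the increment of [u], up to a small multiple of the integral of
    [|w|]; hence their difference is constant. No pointwise differentiability of [u] enters. *)
Lemma primitive_on_chain a b K (phi phi' : R -> R) u w : 0 <= K ->
  (forall p q c, `|phi q - phi p - phi' c * (q - p)| <=
     K * (`|p - c| + `|q - c|) * `|q - p|) ->
  continuous phi' ->
  primitive_on a b u w ->
  primitive_on a b (phi \o u) (fun t => phi' (u t) * w t).
Proof.
move=> K0 phiP cphi' uw0; have [wi uw] := uw0.
have cu := primitive_on_continuous uw0.
have cpu : {within `[a, b], continuous (phi' \o u)}.
  apply/subspace_continuousP => t tab.
  apply: (@cvg_comp _ _ _ u phi'); last exact: cphi'.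
  by move: cu => /subspace_continuousP; apply.
have pi := integrable_onM cpu wi.
split=> // x y ax xy yb.
pose H t := phi (u t) - \int[mu]_(s in `[x, t]) (phi' (u s) * w s).
pose m t := \int[mu]_(s in `[x, t]) `|w s|.
suff : H y = H x by rewrite /H integral_on_set1 subr0 /= => <-; rewrite opprB addrC subrK.
apply: (@eq_of_local_increments _ _ H m xy) => eta eta0 c /andP[xc cy].
(* Chosen so that the Taylor error, at most [K * (e1 + e1)] times the integral of [|w|], uses up
   half of [eta]; the summand 1 keeps the denominator positive when [K = 0]. *)
pose e1 := eta / (4 * (K + 1)).
have e10 : 0 < e1 by rewrite divr_gt0// mulr_gt0// ltr_wpDl.
have acb : a <= c <= b by rewrite (le_trans ax xc) (le_trans cy yb).
have [d1 d10 d1P] := (within_continuous_itvP _ _ _).1 cu c acb _ e10.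
have e20 : 0 < eta / 2 by rewrite divr_gt0.
have [d2 d20 d2P] := (within_continuous_itvP _ _ _).1 cpu c acb _ e20.
exists (Num.min d1 d2); first by rewrite lt_min d10.
move=> p q xp pc cq qy; rewrite !lt_min => /andP[cp1 cp2] /andP[qc1 qc2].
have ap : a <= p by exact: le_trans xp.
have qb : q <= b by exact: le_trans yb.
have pq : p <= q by exact: le_trans cq.
have wpq : integrable_on p q w by exact: integrable_onS wi.
have ppq : integrable_on p q (fun s => phi' (u s) * w s) by exact: integrable_onS pi.
have -> : m q - m p = \int[mu]_(s in `[p, q]) `|w s|.
  by apply/eqP; rewrite subr_eq addrC /m (integral_on_cat xp pq)//;
    apply: integrable_on_norm; exact: integrable_onS wi.
(* The Taylor error of [phi] at [u c], and the oscillation of [phi' (u s)] around [phi' (u c)]. *)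
have -> : H q - H p = (phi (u q) - phi (u p) - phi' (u c) * (u q - u p)) +
   \int[mu]_(s in `[p, q]) ((phi' (u c) - phi' (u s)) * w s).
  have -> : \int[mu]_(s in `[p, q]) ((phi' (u c) - phi' (u s)) * w s) =
     phi' (u c) * (u q - u p) - \int[mu]_(s in `[p, q]) (phi' (u s) * w s).
    rewrite uw// -integral_onZ// -integral_onB//; last exact: integrable_onZ.
    by apply: eq_Rintegral => s _; rewrite mulrBl.
  rewrite /H (integral_on_cat xp pq)//; first by lra.
  exact: integrable_onS pi.
have near1 s : p <= s <= q -> `|u s - u c| < e1 /\ `|phi' (u c) - phi' (u s)| < eta / 2.
  move=> /andP[ps sq]; have asb : a <= s <= b by rewrite (le_trans ap)// (le_trans sq).
  have sc : `|s - c| < Num.min d1 d2.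
    by rewrite lt_min; apply/andP; split; rewrite ltr_norml; apply/andP; split; lra.
  move: sc; rewrite lt_min => /andP[sc1 sc2]; split; first exact: d1P.
  by rewrite distrC; apply: d2P.
have nw : `|u q - u p| <= \int[mu]_(s in `[p, q]) `|w s|.
  by rewrite uw//; exact: normr_integral_on.
have iw0 : 0 <= \int[mu]_(s in `[p, q]) `|w s| by exact: Rintegral_ge0.
apply: le_trans (ler_normD _ _) _.
have -> : eta = eta / 2 + eta / 2 by rewrite -splitr.
rewrite mulrDl lerD//.
  apply: le_trans (phiP _ _ _) _; apply: ler_pM => //.
    by rewrite mulr_ge0// addr_ge0.
  have [/ltW up _] := near1 p (introT andP (conj (lexx p) pq)).
  have [/ltW uq _] := near1 q (introT andP (conj pq (lexx q))).
  have K1 : 0 < K + 1 by rewrite ltr_wpDl.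
  have : K * (`|u p - u c| + `|u q - u c|) <= (K + 1) * (e1 + e1).
    by apply: ler_pM; rewrite ?addr_ge0// ?lerDl// lerD.
  move=> /le_trans; apply; rewrite le_eqVlt; apply/orP; left; apply/eqP.
  by rewrite /e1; field; rewrite gt_eqF.
have fi : integrable_on p q (fun s => (phi' (u c) - phi' (u s)) * w s).
  have -> : (fun s => (phi' (u c) - phi' (u s)) * w s) =
     (fun s => phi' (u c) * w s - phi' (u s) * w s).
    by apply/funext => s; rewrite mulrBl.
  by apply: integrable_onB => //; exact: integrable_onZ.
apply: le_trans (normr_integral_on fi) _.
rewrite -integral_onZ; last exact: integrable_on_norm.
apply: le_integral_on; [exact: integrable_on_norm|by apply: integrable_onZ; exact: integrable_on_norm|].
apply: lebesgue_aeW => s psq; rewrite normrM ler_wpM2r//.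
by have [_ /ltW] := near1 s psq.
Qed.

Lemma primitive_on_sqr a b u w : primitive_on a b u w ->
  primitive_on a b (fun t => u t ^+ 2) (fun t => 2 * u t * w t).
Proof.
apply: (@primitive_on_chain _ _ 1 (fun x => x ^+ 2) (fun x => 2 * x)) => //.
  move=> p q c; have -> : q ^+ 2 - p ^+ 2 - 2 * c * (q - p) =
    ((p - c) + (q - c)) * (q - p) by ring.
  by rewrite normrM mul1r ler_wpM2r// ler_normD.
by move=> x; apply: cvgM; [exact: cvg_cst|exact: cvg_id].
Qed.

Lemma pos_sqr_taylor p q c :
  `|Num.max q 0 ^+ 2 - Num.max p 0 ^+ 2 - 2 * Num.max c 0 * (q - p)| <=
  2 * (`|p - c| + `|q - c|) * `|q - p|.
Proof.
wlog pq : p q / p <= q => [H|].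
  have [|/ltW qp] := leP p q; first exact: H.
  rewrite (distrC q p) (addrC `|p - c|); apply: le_trans (H _ _ qp).
  rewrite -normrN le_eqVlt; apply/orP; left; apply/eqP; congr (`|_|); ring.
rewrite [X in _ <= _ * X]ger0_norm ?subr_ge0//.
set A : R := `|p - c|; set B : R := `|q - c|.
have D0 : 0 <= q - p by rewrite subr_ge0.
(* These products of nonnegative factors make each of the sign cases below a matter of linear
   arithmetic. *)
have A0 : 0 <= A * (q - p) by rewrite mulr_ge0 ?normr_ge0.
have B0 : 0 <= B * (q - p) by rewrite mulr_ge0 ?normr_ge0.
have A1 : 0 <= (A - (p - c)) * (q - p) by rewrite mulr_ge0// subr_ge0 ler_norm.
have A2 : 0 <= (A - (c - p)) * (q - p) by rewrite mulr_ge0// subr_ge0 /A distrC ler_norm.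
have B1 : 0 <= (B - (q - c)) * (q - p) by rewrite mulr_ge0// subr_ge0 ler_norm.
have B2 : 0 <= (B - (c - q)) * (q - p) by rewrite mulr_ge0// subr_ge0 /B distrC ler_norm.
have pD x y : 0 <= x -> 0 <= y -> 0 <= x * y by exact: mulr_ge0.
have nD x : x <= 0 -> 0 <= - x * (q - p) by move=> x0; rewrite mulr_ge0// oppr_ge0.
rewrite ler_norml; clearbody A B.
case: (leP p 0) => p0; case: (leP q 0) => q0; case: (leP c 0) => c0.
- move=> *; apply/andP; split; lra.
- have := pD _ _ (ltW c0) D0; have := nD _ p0; have := nD _ q0; move=> *; apply/andP; split; lra.
- have := nD _ c0; have := pD q (- p) (ltW q0); rewrite oppr_ge0 => /(_ p0).
  have := pD _ _ (ltW q0) (ltW q0); move=> *; apply/andP; split; lra.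
- have := pD q (- p) (ltW q0); rewrite oppr_ge0 => /(_ p0).
  have := nD _ p0; have := pD _ _ (ltW c0) D0.
  have := pD _ _ (ltW q0) (ltW q0); move=> *; apply/andP; split; lra.
- by move: pq; rewrite leNgt (le_lt_trans q0 p0).
- by move: pq; rewrite leNgt (le_lt_trans q0 p0).
- have := nD _ c0; have := pD _ _ (ltW p0) D0; have := pD _ _ (ltW q0) D0.
  move=> *; apply/andP; split; lra.
- move=> *; apply/andP; split; lra.
Qed.

Lemma primitive_on_pos_sqr a b u w : primitive_on a b u w ->
  primitive_on a b (fun t => Num.max (u t) 0 ^+ 2)
    (fun t => 2 * Num.max (u t) 0 * w t).
Proof.
apply: (@primitive_on_chain _ _ 2 (fun x => Num.max x 0 ^+ 2)
  (fun x => 2 * Num.max x 0)) => //; last first.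
  move=> x; apply: cvgM; first exact: cvg_cst.
  by apply: continuous_max; [exact: cvg_id|exact: cvg_cst].
exact: pos_sqr_taylor.
Qed.

Lemma primitive_onM a b u v w z : primitive_on a b u w -> primitive_on a b v z ->
  primitive_on a b (fun t => u t * v t) (fun t => w t * v t + u t * z t).
Proof.
move=> uw vz.
(* Polarisation: [u * v] is a quarter of the difference of the squares of [u + v] and [u - v]. *)
have := primitive_onZ 4^-1 (primitive_onB (primitive_on_sqr (primitive_onD uw vz))
  (primitive_on_sqr (primitive_onB uw vz))).
congr primitive_on; by apply/funext => t /=; field.
Qed.

Lemma primitive_on_C1 a b f g : (forall x, is_derive x (1 : R) f (g x)) ->
  continuous g -> primitive_on a b f g.
Proof.
move=> fg cg; split; first by apply/integrable_on_continuous/continuous_subspaceT.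
move=> x y _ + _; rewrite le_eqVlt => /predU1P[->|xy].
  by rewrite integral_on_set1 subrr.
have cf : continuous f.
  by move=> t; apply/differentiable_continuous/derivable1_diffP; case: (fg t).
rewrite /Rintegral (@continuous_FTC2 _ g f)//.
- exact: continuous_subspaceT.
- split; first by move=> t _; case: (fg t).
  + exact/cvg_at_right_filter/cf.
  + exact/cvg_at_left_filter/cf.
- by move=> t _; rewrite derive1E; case: (fg t).
Qed.

Lemma primitive_on_le a b F f : a <= b -> primitive_on a b F f ->
  {ae mu, forall t, a <= t <= b -> f t <= 0} -> F b <= F a.
Proof.
move=> ab [fi Ff] f0; rewrite -subr_le0 Ff//.
have <- : \int[mu]_(t in `[a, b]) (0 : R) = 0 by rewrite integral_on_cst// mul0r.
by apply: le_integral_on => //; exact: integrable_on_cst.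
Qed.

(** The product of [F] with the integrating factor [expR (- C * t)] has a nonpositive density. The
    rate [C] may be negative, as happens in well-posedness when the least eigenvalue exceeds
    [eps^-1]. *)
Lemma gronwall a b C F f : a <= b -> primitive_on a b F f ->
  {ae mu, forall t, a <= t <= b -> f t <= C * F t} ->
  F b <= expR (C * (b - a)) * F a.
Proof.
move=> ab Ff fF.
have dE x : is_derive x (1 : R) (fun t => expR (- C * t)) (expR (- C * x) * - C).
  apply: is_derive_eq; by rewrite scaler1.
have cE : continuous (fun x => expR (- C * x) * - C).
  move=> x; apply: cvgM; last exact: cvg_cst.
  apply: (@continuous_comp _ _ _ (fun x => - C * x) expR); last exact: continuous_expR.
  by apply: cvgM; [exact: cvg_cst|exact: cvg_id].
have := primitive_on_le ab (primitive_onM (primitive_on_C1 a b dE cE) Ff).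
move=> H; have {}H : expR (- C * b) * F b <= expR (- C * a) * F a.
  apply: H; apply: lebesgue_aeS fF => t /[apply].
  rewrite -subr_le0 => fF.
  have -> : expR (- C * t) * - C * F t + expR (- C * t) * f t =
    expR (- C * t) * (f t - C * F t) by ring.
  by rewrite mulr_ge0_le0// expR_ge0.
have -> : expR (C * (b - a)) = expR (C * b) * expR (- C * a).
  by rewrite -expRD; congr expR; ring.
rewrite -mulrA -ler_pdivrMl ?expR_gt0// -expRN.
by rewrite -mulNr.
Qed.

End primitives.

(** * Derivatives and smooth steps *)

Section derivatives.
Context (R : realType).
Notation mu := (@lebesgue_measure R).
Implicit Types (a b c x y l : R) (f g u w : R -> R).

Lemma is_derive1P f c l : is_derive c (1 : R) f l <->
  forall e, 0 < e -> exists2 d, 0 < d &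
    forall x, `|x - c| < d -> `|f x - f c - l * (x - c)| <= e * `|x - c|.
Proof.
have E h : h != 0 -> `|l - h^-1 *: ((f \o shift c) (h *: (1 : R)) - f c)| =
    `|f (h + c) - f c - l * h| / `|h|.
  move=> h0; rewrite -normfV -normrM -normrN /= /GRing.scale/= mulr1.
  by congr (`|_|); field.
split=> [[df dfl] e e0|H].
  have : (fun h => h^-1 *: ((f \o shift c) (h *: (1 : R)) - f c)) @ 0^' --> l.
    by rewrite -dfl.
  move/cvgrPdist_le => /(_ e e0); rewrite near_withinE => -[d /= d0 dP].
  exists d => // x xc; have [->|xc0] := eqVneq x c.
    by rewrite !subrr mulr0 subrr normr0 mulr0.
  have xc1 : x - c != 0 by rewrite subr_eq0.
  have := dP (x - c); rewrite E// subrK ler_pdivrMr ?normr_gt0//; apply=> //=.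
  by rewrite sub0r normrN.
have : (fun h => h^-1 *: ((f \o shift c) (h *: (1 : R)) - f c)) @ 0^' --> l.
  apply/cvgrPdist_le => e e0; rewrite near_withinE; have [d d0 dP] := H e e0.
  exists d => // h; rewrite /ball_/= sub0r normrN => hd h0.
  by rewrite E// ler_pdivrMr ?normr_gt0//; have := dP (h + c); rewrite addrK; apply.
by move=> fl; split; [apply/cvg_ex; exists l|exact/cvg_lim].
Qed.

Lemma is_derive1_unique f c l m :
  is_derive c (1 : R) f l -> is_derive c (1 : R) f m -> l = m.
Proof. by move=> [_ <-] [_ <-]. Qed.

Lemma is_derive1_continuous f c l : is_derive c (1 : R) f l -> {for c, continuous f}.
Proof. by move=> [df _]; exact/differentiable_continuous/derivable1_diffP. Qed.

Lemma is_derive1_eq_near f g c l d : 0 < d ->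
  (forall x, `|x - c| < d -> f x = g x) ->
  is_derive c (1 : R) f l -> is_derive c (1 : R) g l.
Proof.
move=> d0 fg; apply: near_eq_is_derive; exists d => // x.
by rewrite /ball_/= distrC; exact: fg.
Qed.

Lemma is_derive1_ge0 f c l : (forall x y, x <= y -> f x <= f y) ->
  is_derive c (1 : R) f l -> 0 <= l.
Proof.
move=> ndf /is_derive1P H; rewrite leNgt; apply/negP => l0.
have [|d d0 dP] := H (- l / 2); first by rewrite divr_gt0// oppr_gt0.
have := dP (c + d / 2); rewrite addrAC subrr add0r gtr0_norm ?divr_gt0//.
rewrite ltr_pdivrMr// ltr_pMr// ltr1n => /(_ isT); rewrite ler_norml => /andP[_].
have : f c <= f (c + d / 2) by apply: ndf; rewrite lerDl divr_ge0// ltW.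
have := mulr_gt0 d0 (etrans (oppr_gt0 l) l0); lra.
Qed.

Lemma is_derive1_min f c l d : 0 < d ->
  (forall x, `|x - c| < d -> f c <= f x) -> is_derive c (1 : R) f l -> l = 0.
Proof.
move=> d0 fc /is_derive1P H; apply/eqP; rewrite -normr_eq0 eq_le normr_ge0 andbT.
apply/ler_addgt0Pl => e e0; rewrite addr0.
have [d' d'0 dP] := H e e0; pose h := Num.min d d' / 2.
have h0 : 0 < h by rewrite divr_gt0// lt_min d0.
have hd : h < d by rewrite ltr_pdivrMr// gt_min ltr_pMr// ltr1n.
have hd' : h < d' by rewrite ltr_pdivrMr// gt_min [X in _ || X]ltr_pMr// ltr1n orbT.
have := dP (c + h); have := dP (c - h); rewrite [c + h]addrC [c - h]addrC !addrK normrN gtr0_norm//.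
move=> /(_ hd') + /(_ hd').
have := fc (h + c); have := fc (- h + c); rewrite !addrK normrN gtr0_norm// => /(_ hd) f1 /(_ hd) f2.
rewrite !ler_norml => /andP[H1 H2] /andP[H3 H4].
have A1 : - e * h <= l * h by lra.
have A2 : l * h <= e * h by lra.
by apply/andP; split; [move: A1|move: A2]; rewrite ler_pM2r.
Qed.

Lemma is_derive1_max f c l d : 0 < d ->
  (forall x, `|x - c| < d -> f x <= f c) -> is_derive c (1 : R) f l -> l = 0.
Proof.
move=> d0 fc dfl; have dN := is_deriveN dfl.
apply/eqP; rewrite -oppr_eq0; apply/eqP; apply: is_derive1_min d0 _ dN => x xc.
by rewrite lerN2; exact: fc.
Qed.

Lemma primitive_on_ae_derive a b u w : primitive_on a b u w ->
  {ae mu, forall t, a < t < b -> is_derive t (1 : R) u (w t)}.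
Proof.
move=> uw0; have [wi uw] := uw0; pose g := w \_ `[a, b].
have gl : locally_integrable setT g by exact: integrable_locally.
have gi : mu.-integrable `[a, b] (EFin \o g).
  by rewrite /g -restrict_EFin; apply/integrable_restrict => //=; rewrite setIid.
have gw t : a <= t <= b -> g t = w t by move=> tab; rewrite /g patchE mem_set//= in_itv.
have := lebesgue_differentiation gl; apply: lebesgue_aeS => t gt /andP[ta tb].
have [|df f'] := @FTC1_lebesgue_pt R g (BLeft a) t b tb gi _ gt.
  by rewrite lte_fin.
have {df f'} dF : is_derive t (1 : R)
    (fun y => u a + \int[mu]_(s in `[a, y]) g s) (g t).
  have H : is_derive t (1 : R) (fun y => \int[mu]_(s in `[a, y]) g s) (g t).
    by rewrite -f' derive1E; exact: derivableP.
  by have := is_deriveD (is_derive_cst (u a) t (1 : R)) H; rewrite add0r.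
rewrite -gw ?(ltW ta) ?(ltW tb)//.
apply: (@is_derive1_eq_near _ u t _ (Num.min (t - a) (b - t))) dF.
  by rewrite lt_min !subr_gt0 ta.
move=> x; rewrite lt_min !ltr_norml => /andP[/andP[x1 _] /andP[_ x2]].
have ax : a <= x by lra.
have xb : x <= b by lra.
rewrite (_ : \int[mu]_(s in _) _ = \int[mu]_(s in `[a, x]) w s).
  by rewrite -uw// subrKC.
apply: eq_integral_on; apply: lebesgue_aeW => s /andP[sa sx].
by rewrite gw// sa (le_trans sx).
Qed.

End derivatives.

(** * Smooth transitions between 0 and 1 *)

Section smooth_step.
Context (R : realType).
Notation mu := (@lebesgue_measure R).
Implicit Types (a b c x y l : R) (f g u w : R -> R).

(** The classical function exp(-1/x), extended by 0; the extra powers of 1/x close the family under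
    differentiation up to linear combinations. *)
Definition flat n x : R := if 0 < x then x^-1 ^+ n * expR (- x^-1) else 0.

Lemma flat_ge0 n x : 0 <= flat n x.
Proof.
rewrite /flat; case: ifPn => // x0.
by rewrite mulr_ge0 ?expR_ge0// exprn_ge0// invr_ge0 ltW.
Qed.

(** The exponential series at 1/x dominates its term of degree [n.+2]. The quadratic decay that
    remains gives the derivative 0 at the origin. *)
Lemma flat_le n x : `|flat n x| <= n.+2`!%:R * `|x| ^+ 2.
Proof.
rewrite ger0_norm ?flat_ge0// /flat; case: ifPn => [x0|_]; last first.
  by rewrite mulr_ge0// exprn_ge0.
have y0 : 0 <= x^-1 by rewrite invr_ge0 ltW.
have := expR_ge1Dxn n.+1 y0; rewrite gtr0_norm// expRN => H.
rewrite ler_pdivrMr ?expR_gt0//.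
have {}H : x^-1 ^+ n.+2 / n.+2`!%:R <= expR x^-1 by apply: le_trans H; rewrite lerDr.
have F0 : 0 < n.+2`!%:R :> R by rewrite ltr0n fact_gt0.
move: H; rewrite ler_pdivrMr// => H.
rewrite -mulrA [_ ^+ 2 * _]mulrC mulrA -ler_pdivrMr ?exprn_gt0//.
by rewrite -exprVn -exprD addn2 mulrC.
Qed.

Lemma is_derive_flat n x :
  is_derive x (1 : R) (flat n) (flat n.+2 x - n%:R * flat n.+1 x).
Proof.
have [x0|x0|->] := ltgtP x 0.
- apply: (@is_derive1_eq_near _ (cst 0) _ x _ (- x)); first by rewrite oppr_gt0.
    move=> y; rewrite ltr_norml => /andP[_ yx].
    by rewrite /flat ltNge (_ : y <= 0)//; lra.
  by rewrite /flat ltNge ltW//= mulr0 subr0; exact: is_derive_cst.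
- apply: (@is_derive1_eq_near _ (fun y => y^-1 ^+ n * expR (- y^-1)) _ x _ x) => //.
    move=> y; rewrite ltr_norml => /andP[yx _].
    by rewrite /flat (_ : 0 < y)//; lra.
  have xn0 : x != 0 by rewrite gt_eqF.
  have dV : is_derive x (1 : R) (fun y : R => y^-1) (- (x ^+ 2)^-1).
    have := @is_deriveV R id x 1 1 xn0 (is_derive_id x 1).
    by rewrite /GRing.scale/= mulr1.
  have dE := @is_derive1_comp R expR _ x _ _ (is_derive_expR _) (is_deriveN dV).
  have -> : (fun y : R => y^-1 ^+ n * expR (- y^-1)) =
      (fun y => y^-1) ^+ n * (expR \o - (fun y => y^-1)).
    by apply/funext => y; rewrite !fctE.
  apply: (is_derive_eq (is_deriveM (is_deriveX n dV) dE)); rewrite /flat x0 !fctE.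
  rewrite /GRing.scale/= opprK; case: n => [|n] /=.
    by rewrite mul0r mulr0n mul0r; field.
  by rewrite -exprVn; set y := x^-1; rewrite !exprS; ring.
- apply/is_derive1P => e e0; exists (e / n.+2`!%:R).
    by rewrite divr_gt0// ltr0n fact_gt0.
  have f0 m : flat m 0 = 0 by rewrite /flat ltxx.
  move=> y; rewrite !f0 mulr0 !subr0 mul0r subr0 => ye.
  apply: le_trans (flat_le n y) _; rewrite expr2 mulrA ler_wpM2r//.
  by rewrite mulrC -ler_pdivlMr ?ltr0n ?fact_gt0// ltW.
Qed.

(* Built from functions that are flat at 0, so that differentiation never leaves
   the class and every member is infinitely differentiable. *)
Inductive smooth_expr : (R -> R) -> Prop :=
| smooth_flat n s c : smooth_expr (fun x => flat n (s * x + c))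
| smooth_cst c : smooth_expr (fun=> c)
| smooth_add f g : smooth_expr f -> smooth_expr g -> smooth_expr (fun x => f x + g x)
| smooth_mul f g : smooth_expr f -> smooth_expr g -> smooth_expr (fun x => f x * g x)
| smooth_inv f : (forall x, f x != 0) -> smooth_expr f -> smooth_expr (fun x => (f x)^-1).

Lemma smooth_expr_derive f : smooth_expr f ->
  exists2 g, smooth_expr g & forall x, is_derive x (1 : R) f (g x).
Proof.
elim=> {f} [n s c|c|f g sf [f' sf' df] sg [g' sg' dg]|f g sf [f' sf' df] sg [g' sg' dg]|f f0 sf [f' sf' df]].
- exists (fun x => (flat n.+2 (s * x + c) + - n%:R * flat n.+1 (s * x + c)) * s).
    apply: smooth_mul; last exact: smooth_cst.
    apply: smooth_add; first exact: smooth_flat.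
    by apply: smooth_mul; [exact: smooth_cst|exact: smooth_flat].
  move=> x.
  have H : is_derive x (1 : R) (fun x => s * x + c) s.
    apply/is_derive1P => e e0; exists 1 => // y _.
    have -> : s * y + c - (s * x + c) - s * (y - x) = 0 by ring.
    by rewrite normr0 mulr_ge0// ltW.
  have := @is_derive1_comp R (flat n) _ x _ _ (is_derive_flat n (s * x + c)) H.
  by rewrite mulNr.
- by exists (fun=> 0); [exact: smooth_cst|move=> x; exact: is_derive_cst].
- by exists (fun x => f' x + g' x); [exact: smooth_add|move=> x; exact: is_deriveD].
- exists (fun x => f x * g' x + g x * f' x).
    by apply: smooth_add; exact: smooth_mul.
  by move=> x; exact: is_deriveM.
- exists (fun x => - 1 * ((f x)^-1 * (f x)^-1) * f' x).
    apply: smooth_mul => //; apply: smooth_mul; first exact: smooth_cst.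
    by apply: smooth_mul; exact: smooth_inv.
  move=> x; have := @is_deriveV R f x _ 1 (f0 x) (df x).
  by congr is_derive; rewrite /GRing.scale/= mulN1r -exprVn expr2 mulNr.
Qed.

Lemma smooth_expr_derivable f : smooth_expr f ->
  forall k x, derivable (derive1n k f) x 1.
Proof.
move=> sf k; suff [g sg ->] : exists2 g, smooth_expr g & derive1n k f = g.
  by have [g' _ dg'] := smooth_expr_derive sg => x; have [] := dg' x.
elim: k => [|k [g sg gE]]; first by exists f.
have [g' sg' dg'] := smooth_expr_derive sg; exists g' => //.
rewrite derive1nS gE; apply/funext => x; rewrite derive1E.
by have [] := dg' x.
Qed.

(** For [a < b] the two summands of the denominator never vanish together, so the quotient is
    smooth; it is 0 up to [a] and 1 from [b] on. *)
Definition smooth_step a b x : R :=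
  flat 0 (x - a) / (flat 0 (x - a) + flat 0 (b - x)).

Lemma flat0_gt0 x : 0 < x -> 0 < flat 0 x.
Proof. by move=> x0; rewrite /flat x0 expr0 mul1r expR_gt0. Qed.

Lemma flat0_eq0 x : x <= 0 -> flat 0 x = 0.
Proof. by move=> x0; rewrite /flat ltNge x0. Qed.

Lemma flat0_nd x y : x <= y -> flat 0 x <= flat 0 y.
Proof.
move=> xy; have [x0|x0] := leP x 0; first by rewrite flat0_eq0// flat_ge0.
rewrite /flat x0 (lt_le_trans x0 xy) !expr0 !mul1r ler_expR lerN2.
by rewrite lef_pV2// posrE// (lt_le_trans x0).
Qed.

Lemma smooth_step_den_gt0 a b x : a < b -> 0 < flat 0 (x - a) + flat 0 (b - x).
Proof.
move=> ab; have [xa|xa] := leP x a.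
  by rewrite ltr_wpDl ?flat_ge0// flat0_gt0// subr_gt0 (le_lt_trans xa).
by rewrite ltr_pwDl ?flat_ge0// flat0_gt0// subr_gt0.
Qed.

Lemma smooth_step_smooth a b : a < b -> smooth_expr (smooth_step a b).
Proof.
move=> ab; have E s c (f : R -> R) : (forall x, s * x + c = f x) ->
    smooth_expr (fun x => flat 0 (f x)).
  move=> fE; rewrite (_ : (fun x => flat 0 (f x)) = fun x => flat 0 (s * x + c)).
    exact: smooth_flat.
  by apply/funext => x; rewrite fE.
have E1 : smooth_expr (fun x => flat 0 (x - a)) by apply: (E 1 (- a)) => x; ring.
have E2 : smooth_expr (fun x => flat 0 (b - x)) by apply: (E (- 1) b) => x; ring.
apply: smooth_mul => //; apply: smooth_inv; last exact: smooth_add.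
by move=> x; rewrite gt_eqF// smooth_step_den_gt0.
Qed.

Lemma smooth_step_eq0 a b x : x <= a -> smooth_step a b x = 0.
Proof. by move=> xa; rewrite /smooth_step flat0_eq0 ?mul0r// subr_le0. Qed.

Lemma smooth_step_eq1 a b x : a < b -> b <= x -> smooth_step a b x = 1.
Proof.
move=> ab bx; rewrite /smooth_step (@flat0_eq0 (b - x)) ?subr_le0// addr0 divff//.
by rewrite gt_eqF// flat0_gt0// subr_gt0 (lt_le_trans ab).
Qed.

Lemma smooth_step_01 a b x : a < b -> 0 <= smooth_step a b x <= 1.
Proof.
move=> ab; have d0 := smooth_step_den_gt0 x ab; apply/andP; split.
  by rewrite divr_ge0 ?flat_ge0// ltW.
by rewrite ler_pdivrMr// mul1r lerDl flat_ge0.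
Qed.

Lemma smooth_step_nd a b x y : a < b -> x <= y -> smooth_step a b x <= smooth_step a b y.
Proof.
move=> ab xy; rewrite /smooth_step ler_pdivrMr ?smooth_step_den_gt0//.
rewrite mulrAC ler_pdivlMr ?smooth_step_den_gt0//.
have : flat 0 (x - a) * flat 0 (b - y) <= flat 0 (y - a) * flat 0 (b - x).
  by apply: ler_pM; rewrite ?flat_ge0//; apply: flat0_nd; lra.
lra.
Qed.

End smooth_step.

(** * Weak derivatives *)

Section weak_derivatives.
Context (R : realType).
Notation mu := (@lebesgue_measure R).
Implicit Types (a b c x y s t : R) (f g u w phi : R -> R).

Lemma integral_itvoo a b f : integrable_on a b f ->
  \int[mu]_(x in `]a, b[) f x = \int[mu]_(x in `[a, b]) f x.
Proof.
move=> fi; rewrite Rintegral_itv_bndo_bndc; last first.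
  by apply: integrableS fi => //; apply: subset_itv; rewrite bnd_simp.
rewrite Rintegral_itv_obnd_cbnd//.
by apply: integrableS fi => //; apply: subset_itv; rewrite bnd_simp.
Qed.

(** A smoothed indicator of [[s, t]]: its derivative approximates the Dirac mass at [s] minus the
    one at [t], so testing with it produces [u t - u s]. *)
Lemma test_function_step a b s t d : a < s -> s <= t -> 0 < d -> t + d < b ->
  test_function a b (fun x => smooth_step s (s + d) x - smooth_step t (t + d) x).
Proof.
move=> sa st d0 tb.
have sd : s < s + d by rewrite ltrDl.
have td : t < t + d by rewrite ltrDl.
set phi := (fun x => _).
have sub : closure [set x | phi x != 0] `<=` `[s, t + d].
  rewrite closureE; apply: smallest_sub; first exact: interval_closed.
  move=> x /=; apply: contraNP => /negP; rewrite in_itv/= negb_and -!ltNge => /orP[xs|tx].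
    by rewrite /phi !smooth_step_eq0 ?subrr// ltW// (lt_le_trans xs).
  rewrite /phi !smooth_step_eq1 ?subrr// ltW//.
  by rewrite (le_lt_trans _ tx)// lerD2r.
split; first apply: smooth_expr_derivable.
  rewrite (_ : phi = fun x => smooth_step s (s + d) x + -1 * smooth_step t (t + d) x).
    apply: smooth_add; first exact: smooth_step_smooth.
    by apply: smooth_mul; [exact: smooth_cst|exact: smooth_step_smooth].
  by apply/funext => x; rewrite mulN1r.
split.
  apply: (subclosed_compact _ (@segment_compact _ s (t + d))) => //.
  exact: closed_closure.
apply: subset_trans sub _ => x /=; rewrite !in_itv/= => /andP[sx xt].
by rewrite (lt_le_trans sa sx) (le_lt_trans xt tb).
Qed.

Lemma smooth_step_C1 s t : s < t -> exists2 rho : R -> R, continuous rho &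
  forall x, is_derive x (1 : R) (smooth_step s t) (rho x).
Proof.
move=> /smooth_step_smooth /smooth_expr_derive[rho srho drho]; exists rho => // x.
by have [rho' _ /(_ x)] := smooth_expr_derive srho; exact: is_derive1_continuous.
Qed.

(** The derivative of a narrow step is a probability density on [[s, s + d]] and averages [u] near
    [s]. The step differs from the indicator of [[s, b]] only on [[s, s + d]], where [|w|] has small
    mass because its primitive is continuous. *)
Lemma smooth_step_cvg a b s u w eta : a <= s -> s < b ->
  {within `[a, b], continuous u} -> integrable_on a b w -> 0 < eta ->
  exists2 d0, 0 < d0 & forall d rho, 0 < d -> d < d0 ->
    continuous rho ->
    (forall x, is_derive x (1 : R) (smooth_step s (s + d)) (rho x)) ->
    `|\int[mu]_(x in `[a, b]) (u x * rho x) - u s| <= eta /\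
    `|\int[mu]_(x in `[a, b]) (smooth_step s (s + d) x * w x) -
      \int[mu]_(x in `[s, b]) w x| <= eta.
Proof.
move=> sa sb cu wi eta0.
have sab : a <= s <= b by rewrite sa ltW.
have [d1 d10 d1P] := (within_continuous_itvP _ _ _).1 cu s sab _ eta0.
have nwi := integrable_on_norm wi.
have cW := primitive_on_continuous (primitive_on_integral nwi).
have [d2 d20 d2P] := (within_continuous_itvP _ _ _).1 cW s sab _ eta0.
exists (Num.min (Num.min d1 d2) (b - s)); first by rewrite !lt_min d10 d20 subr_gt0.
move=> d rho d0; rewrite !lt_min => /andP[/andP[dd1 dd2] db] crho drho.
have sd : s < s + d by rewrite ltrDl.
have sdb : s + d <= b by lra.
have [rhoi rhoE] := primitive_on_C1 a b drho crho.
have rho0 x : 0 <= rho x.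
  by apply: is_derive1_ge0 (drho x) => y z; exact: smooth_step_nd.
have rho_out x : x < s \/ s + d < x -> rho x = 0.
  case=> [xs|xs]; apply: (is_derive1_unique (drho x)).
    apply: (@is_derive1_eq_near _ (cst 0) _ x _ (s - x)); first by rewrite subr_gt0.
      move=> y; rewrite ltr_norml => /andP[_ ys]; rewrite smooth_step_eq0//.
      by lra.
  apply: (@is_derive1_eq_near _ (cst 1) _ x _ (x - (s + d))); first by rewrite subr_gt0.
    move=> y; rewrite ltr_norml => /andP[ys _]; rewrite smooth_step_eq1//.
    by lra.
have int1 : \int[mu]_(x in `[a, b]) rho x = 1.
  rewrite -rhoE// ?(le_trans sa (ltW sb))// (smooth_step_eq1 sd sdb).
  by rewrite smooth_step_eq0// subr0.
have uri : integrable_on a b (fun x => u x * rho x) by exact: integrable_onM.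
have cst_i : integrable_on a b (fun x => u s * rho x) by exact: integrable_onZ.
split.
  rewrite -[X in _ - X]mulr1 -int1 -integral_onZ// -integral_onB//.
  apply: le_trans (normr_integral_on (integrable_onB uri cst_i)) _.
  rewrite -[X in _ <= X]mulr1 -int1 -integral_onZ//.
  apply: le_integral_on; [exact/integrable_on_norm/integrable_onB|exact: integrable_onZ|].
  apply: lebesgue_aeW => x xab; rewrite -mulrBl normrM (ger0_norm (rho0 x)).
  have [xs|xs] := ltP x s; first by rewrite rho_out ?mulr0//; left.
  have [xs'|xs'] := ltP (s + d) x; first by rewrite rho_out ?mulr0//; right.
  rewrite ler_wpM2r// ltW// d1P//.
  by rewrite ger0_norm ?subr_ge0//; lra.
have cstep : continuous (smooth_step s (s + d)).
  by move=> x; exact: is_derive1_continuous (drho x).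
have swi : integrable_on a b (fun x => smooth_step s (s + d) x * w x).
  by apply: integrable_onM => //; exact: continuous_subspaceT.
have swi' : integrable_on s (s + d) (fun x => smooth_step s (s + d) x * w x).
  exact: integrable_onS swi.
have wi' : integrable_on s (s + d) w by exact: integrable_onS wi.
rewrite (integral_on_cat sa (ltW sb))// (@eq_integral_on _ a s _ (fun=> 0)); last first.
  by apply: lebesgue_aeW => x /andP[_ xs]; rewrite smooth_step_eq0// mul0r.
rewrite integral_on_cst// mul0r add0r.
rewrite (@integral_on_cat _ s b (s + d)) ?(ltW sd)//; last exact: integrable_onS swi.
rewrite [X in _ - X](@integral_on_cat _ s b (s + d)) ?(ltW sd)//; last exact: integrable_onS wi.
rewrite (@eq_integral_on _ (s + d) b _ w); last first.
  by apply: lebesgue_aeW => x /andP[xs _]; rewrite smooth_step_eq1// mul1r.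
rewrite opprD addrACA subrr addr0 -integral_onB//.
apply: le_trans (normr_integral_on (integrable_onB swi' wi')) _.
have -> : eta = 0 + eta by rewrite add0r.
rewrite -lerBlDr; apply: (@le_trans _ _ (\int[mu]_(x in `[s, s + d]) `|w x| - eta)).
  rewrite lerD2r; apply: le_integral_on.
  - exact/integrable_on_norm/integrable_onB.
  - exact: integrable_on_norm.
  apply: lebesgue_aeW => x _; rewrite -{2}[w x]mul1r -mulrBl normrM.
  rewrite -[X in _ <= X]mul1r ler_wpM2r//.
  have /andP[h0 h1] := smooth_step_01 x sd.
  by rewrite ler_norml; apply/andP; split; lra.
rewrite subr_le0 ltW//; have := d2P (s + d).
rewrite (@integral_on_cat _ a (s + d) s) ?(ltW sd)//; last exact: integrable_onS nwi.
have AB (A B : R) : A + B - A = B by ring.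
rewrite !AB (gtr0_norm d0) sdb (le_trans sa (ltW sd)) => /(_ isT dd2).
exact/le_lt_trans/ler_norm.
Qed.

(** Smoothed indicators give the increment formula between interior times; continuity of [u] and of
    the integral of [w] carries it to the endpoints. *)
Lemma weak_derivative_primitive a b u w : a < b ->
  {within `[a, b], continuous u} -> integrable_on a b w ->
  weak_derivative a b u w -> primitive_on a b u w.
Proof.
move=> ab cu wi uw; split=> //.
have inner_eq s t : a < s -> s <= t -> t < b ->
    u t - u s = \int[mu]_(x in `[s, t]) w x.
  move=> sa st tb; have sb := le_lt_trans st tb; have ta := lt_le_trans sa st.
  rewrite -[RHS](addrK (\int[mu]_(x in `[t, b]) w x)) -integral_on_cat// ?(ltW tb)//; last first.
    exact: (integrable_onS (ltW sa) (lexx b) wi).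
  apply/eqP; rewrite -subr_eq0 -normr_eq0 eq_le normr_ge0 andbT.
  apply/ler_addgt0Pl => e e0; rewrite addr0.
  (* Four errors are to be added: a Dirac mass and an indicator, at [s] and at [t]. *)
  have e40 : 0 < e / 4 by rewrite divr_gt0.
  have [d1 d10 d1P] := smooth_step_cvg (ltW sa) sb cu wi e40.
  have [d2 d20 d2P] := smooth_step_cvg (ltW ta) tb cu wi e40.
  pose d := Num.min (Num.min d1 d2) (b - t) / 2.
  have m0 : 0 < Num.min (Num.min d1 d2) (b - t) by rewrite !lt_min d10 d20 subr_gt0.
  have d0 : 0 < d by rewrite divr_gt0.
  have : d < Num.min (Num.min d1 d2) (b - t).
    by rewrite ltr_pdivrMr// ltr_pMr// ltr1n.
  rewrite !lt_min => /andP[/andP[dd1 dd2] dbt].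
  have sd : s < s + d by rewrite ltrDl.
  have td : t < t + d by rewrite ltrDl.
  have [r1 cr1 dr1] := smooth_step_C1 sd.
  have [r2 cr2 dr2] := smooth_step_C1 td.
  have [A1 A2] := d1P d r1 d0 dd1 cr1 dr1.
  have [B1 B2] := d2P d r2 d0 dd2 cr2 dr2.
  have tdb : t + d < b by lra.
  have := uw _ (test_function_step sa st d0 tdb).
  have -> : derive1 (fun x => smooth_step s (s + d) x - smooth_step t (t + d) x) =
      fun x => r1 x - r2 x.
    apply/funext => x; rewrite derive1E; have := is_deriveB (dr1 x) (dr2 x).
    by case.
  have i1 : integrable_on a b (fun x => u x * r1 x).
    by apply: integrable_onM => //; exact/integrable_on_continuous/continuous_subspaceT.
  have i2 : integrable_on a b (fun x => u x * r2 x).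
    by apply: integrable_onM => //; exact/integrable_on_continuous/continuous_subspaceT.
  have i3 : integrable_on a b (fun x => smooth_step s (s + d) x * w x).
    apply: integrable_onM => //; apply: continuous_subspaceT => x.
    exact: is_derive1_continuous (dr1 x).
  have i4 : integrable_on a b (fun x => smooth_step t (t + d) x * w x).
    apply: integrable_onM => //; apply: continuous_subspaceT => x.
    exact: is_derive1_continuous (dr2 x).
  have -> : (fun x => u x * (r1 x - r2 x)) = (fun x => u x * r1 x - u x * r2 x).
    by apply/funext => x; rewrite mulrBr.
  have -> : (fun x => w x * (smooth_step s (s + d) x - smooth_step t (t + d) x)) =
     (fun x => smooth_step s (s + d) x * w x - smooth_step t (t + d) x * w x).
    by apply/funext => x; rewrite -mulrBl mulrC.
  rewrite !integral_itvoo; [|exact: integrable_onB|exact: integrable_onB].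
  rewrite !integral_onB//.
  move: A1 A2 B1 B2.
  move: (\int[mu]_(x in _) (u x * r1 x)) => I1.
  move: (\int[mu]_(x in _) (u x * r2 x)) => I2.
  move: (\int[mu]_(x in _) (smooth_step s _ x * w x)) => I3.
  move: (\int[mu]_(x in _) (smooth_step t _ x * w x)) => I4.
  move: (\int[mu]_(x in `[s, b]) w x) => I5.
  move: (\int[mu]_(x in `[t, b]) w x) => I6.
  rewrite !ler_norml => /andP[? ?] /andP[? ?] /andP[? ?] /andP[? ?] ?.
  by apply/andP; split; lra.
have cW := primitive_on_continuous (primitive_on_integral wi).
pose H x := u x - \int[mu]_(y in `[a, x]) w y.
have Hin s t : a < s -> s <= t -> t < b -> H t = H s.
  move=> sa st tb; rewrite /H; have := inner_eq s t sa st tb.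
  rewrite (@integral_on_cat _ a t s) ?(ltW sa)//; first by lra.
  exact: (integrable_onS (lexx a) (ltW tb) wi).
pose m := (a + b) / 2.
have ma : a < m by rewrite ltr_pdivlMr//; lra.
have mb : m < b by rewrite ltr_pdivrMr//; lra.
have Hm x : a < x < b -> H x = H m.
  by move=> /andP[xa xb]; have [xm|/ltW xm] := leP x m; [rewrite (Hin x m)|rewrite (Hin m x)].
have cH : forall c, a <= c <= b -> forall e, 0 < e -> exists2 d, 0 < d &
    forall x, a <= x <= b -> `|x - c| < d -> `|H x - H c| < e.
  move=> c cab e e0; have e20 : 0 < e / 2 by rewrite divr_gt0.
  have [d1 d10 d1P] := (within_continuous_itvP _ _ _).1 cu c cab _ e20.
  have [d2 d20 d2P] := (within_continuous_itvP _ _ _).1 cW c cab _ e20.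
  exists (Num.min d1 d2); first by rewrite lt_min d10.
  move=> x xab; rewrite lt_min => /andP[/(d1P _ xab) + /(d2P _ xab)].
  by rewrite /H !ltr_norml => /andP[? ?] /andP[? ?]; apply/andP; split; lra.
have Hall c : a <= c <= b -> H c = H m.
  move=> cab; apply/eqP; rewrite -subr_eq0 -normr_eq0 eq_le normr_ge0 andbT.
  apply/ler_addgt0Pl => e e0; rewrite addr0.
  have [d d0 dP] := cH c cab e e0.
  have [x xab xc] : exists2 x, a < x < b & `|x - c| < d.
    have [ca|ca] := ltP a c; last first.
      exists (a + Num.min (d / 2) (m - a)).
        rewrite ltrDl lt_min divr_gt0// subr_gt0 ma/=.
        have : Num.min (d / 2) (m - a) <= m - a by rewrite ge_min lexx orbT.
        by lra.
      have -> : c = a by apply/eqP; rewrite eq_le ca; case/andP: cab.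
      rewrite addrAC subrr add0r gtr0_norm ?lt_min ?divr_gt0 ?subr_gt0//.
      by rewrite gt_min ltr_pdivrMr// ltr_pMr// ltr1n.
    exists (c - Num.min (d / 2) ((c - a) / 2)).
      have c1 : Num.min (d / 2) ((c - a) / 2) <= (c - a) / 2 by rewrite ge_min lexx orbT.
      have c2 : 0 < Num.min (d / 2) ((c - a) / 2).
        by rewrite lt_min !divr_gt0// subr_gt0.
      by move: cab => /andP[_ cb]; apply/andP; split; lra.
    have cM (M : R) : c - M - c = - M by ring.
    rewrite cM normrN gtr0_norm; last first.
      by rewrite lt_min !divr_gt0// subr_gt0.
    by rewrite gt_min ltr_pdivrMr// ltr_pMr// ltr1n.
  rewrite -(Hm x xab) distrC ltW// dP//.
  by case/andP: xab => /ltW -> /ltW ->.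
move=> x y ax xy yb.
have /eqP : H y = H x by rewrite !Hall// ?ax ?yb ?(le_trans xy) ?(le_trans ax).
rewrite /H (@integral_on_cat _ a y x)//; last exact: integrable_onS wi.
by move=> /eqP; lra.
Qed.

Lemma primitive_weak_derivative a b u w : a <= b -> primitive_on a b u w ->
  weak_derivative a b u w.
Proof.
move=> ab uw phi [dphi [_ sphi]].
have phi_out x : ~ `]a, b[%classic x -> phi x = 0.
  move=> xab; apply: contrapT => /eqP phix; apply: xab; apply: sphi.
  exact: subset_closure.
have cphi' : continuous (derive1 phi).
  by move=> x; apply/differentiable_continuous/derivable1_diffP; exact: (dphi 1%N).
have phiP : primitive_on a b phi (derive1 phi).
  apply: primitive_on_C1 => // x; rewrite derive1E; apply: derivableP; exact: (dphi 0%N).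
have cphi := primitive_on_continuous phiP.
have cu := primitive_on_continuous uw.
have [_ /(_ a b (lexx _) ab (lexx _))] := primitive_onM uw phiP.
rewrite !phi_out ?mulr0 ?subrr/= ?in_itv/= ?ltxx ?andbF//.
have wi : integrable_on a b w by case: uw.
have i1 : integrable_on a b (fun x => w x * phi x).
  rewrite (_ : (fun x => _) = fun x => phi x * w x); first exact: integrable_onM.
  by apply/funext => x; rewrite mulrC.
have i2 : integrable_on a b (fun x => u x * derive1 phi x).
  by apply: integrable_onM => //; exact/integrable_on_continuous/continuous_subspaceT.
by rewrite integral_onD// !integral_itvoo//; lra.
Qed.

Lemma weak_derivative_ae a b u u' w w' :
  ae_eq mu `]a, b[%classic u u' -> ae_eq mu `]a, b[%classic w w' ->
  weak_derivative a b u w -> weak_derivative a b u' w'.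
Proof.
move=> uu ww uw phi /uw H; rewrite -(@lebesgue_Rintegral_ae _ _ (fun x => u x * derive1 phi x)).
  rewrite H; congr (- _); apply: lebesgue_Rintegral_ae.
  by apply: lebesgue_aeS ww => x /[apply] ->.
by apply: lebesgue_aeS uu => x /[apply] ->.
Qed.

End weak_derivatives.

(** * The projected Euler scheme *)

Section projected_euler.
Context (R : realType) (V : finType).
Implicit Types (x y : V -> R) (tau : R).

(** Widened by the geometric tail [2 * K * 2^-1 ^+ n], the intervals around [z n] are nested; the
    supremum of their lower ends lies in all of them, which yields the limit together with its
    rate. *)
Lemma geometric_increments_limit (z : nat -> R) K :
  (forall n, `|z n.+1 - z n| <= K * 2^-1 ^+ n) ->
  exists l, forall n, `|z n - l| <= 2 * K * 2^-1 ^+ n.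
Proof.
move=> zK; pose p n : R := 2^-1 ^+ n.
have pS n : p n = 2 * p n.+1 by rewrite /p exprS mulrA divff ?mul1r.
pose lo n := z n - 2 * K * p n; pose hi n := z n + 2 * K * p n.
have step n : lo n <= lo n.+1 /\ hi n.+1 <= hi n.
  have := zK n; rewrite -/(p n) ler_norml /lo /hi pS => /andP[? ?]; split; lra.
have K0 : 0 <= K.
  by have := le_trans (normr_ge0 _) (zK 0%N); rewrite expr0 mulr1.
have p0 n : 0 <= 2 * K * p n by rewrite !mulr_ge0// exprn_ge0.
have lohi n k : lo n <= lo (n + k)%N /\ hi (n + k)%N <= hi n.
  elim: k => [|k [IH1 IH2]]; first by rewrite addn0.
  rewrite addnS; have [s1 s2] := step (n + k)%N.
  by split; [exact: le_trans s1|exact: le_trans IH2].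
have lohi' n m : lo n <= hi m.
  have [h1 _] := lohi n m; have [_ h2] := lohi m n.
  rewrite addnC in h2; apply: (le_trans h1); apply: le_trans h2.
  by have := p0 (n + m)%N; rewrite /lo /hi; lra.
pose l := sup (range lo).
have ub m : ubound (range lo) (hi m) by move=> _ [n _ <-].
exists l => n; rewrite ler_norml; apply/andP; split.
  have : l <= hi n by apply: ge_sup => //; exists (lo 0%N), 0%N.
  by rewrite /hi /p; lra.
have : lo n <= l by apply: ub_le_sup; [exists (hi 0%N)|exists n].
by rewrite /lo /p; lra.
Qed.

Definition clip01 (a : R) : R := Num.max 0 (Num.min a 1).

Lemma clip01E a : clip01 a = if a <= 0 then 0 else if 1 <= a then 1 else a.
Proof.
rewrite /clip01; case: (leP a 1) => a1.
  case: (leP a 0) => a0; case: (leP 1 a) => // a1'.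
  by apply/eqP; rewrite eq_le a1.
by rewrite (max_idPr ler01) leNgt (lt_trans ltr01 a1)/= ltW.
Qed.

Lemma clip01_itv a : 0 <= clip01 a <= 1.
Proof.
by rewrite clip01E; case: (leP a 0) => ?; [|case: (leP 1 a) => ?]; apply/andP; split; lra.
Qed.

Lemma clip01_id a : 0 <= a <= 1 -> clip01 a = a.
Proof. by rewrite clip01E => /andP[? ?]; case: (leP a 0) => ?; [|case: (leP 1 a) => ?]; lra. Qed.

Lemma clip01_lt0 a : a <= 0 -> clip01 a = 0.
Proof. by rewrite clip01E => ->. Qed.

Lemma clip01_gt1 a : 1 <= a -> clip01 a = 1.
Proof. by rewrite clip01E => a1; rewrite a1 leNgt (lt_le_trans ltr01 a1). Qed.

Lemma clip01_lip a b : `|clip01 a - clip01 b| <= `|a - b|.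
Proof.
wlog ab : a b / a <= b => [H|].
  have [|/ltW] := leP a b; first exact: H.
  by rewrite distrC (distrC a); exact: H.
have ab0 : a - b <= 0 by rewrite subr_le0.
rewrite (ler0_norm ab0) ler_norml !clip01E.
case: (leP a 0) => ?; [|case: (leP 1 a) => ?]; (case: (leP b 0) => ?; [|case: (leP 1 b) => ?]);
  apply/andP; split; lra.
Qed.

(** Two successive clipped moves in the same direction, as [0 <= b * c] expresses, amount to one.
    For opposite directions this fails, since the motion lost at an obstacle would not be
    restored. *)
Lemma clip01_clip a b c : 0 <= a <= 1 -> 0 <= b * c ->
  clip01 (clip01 (a + b) + c) = clip01 (a + b + c).
Proof.
move=> /andP[a0 a1] bc.
have [ab0|ab0] := leP (a + b) 0.
  rewrite (clip01_lt0 ab0).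
  have c0 : c <= 0 \/ b = 0.
    have [->|bn0] := eqVneq b 0; first by right.
    left; have b0 : b < 0 by rewrite lt_neqAle bn0/=; lra.
    by rewrite -(nmulr_rge0 _ b0).
  case: c0 => [c0|b0]; first by rewrite !clip01_lt0 ?add0r//; lra.
  by congr clip01; lra.
have [ab1|ab1] := leP 1 (a + b).
  rewrite (clip01_gt1 ab1).
  have c0 : 0 <= c \/ b = 0.
    have [->|bn0] := eqVneq b 0; first by right.
    left; have b0 : 0 < b by rewrite lt_neqAle eq_sym bn0/=; lra.
    by rewrite -(pmulr_rge0 _ b0).
  case: c0 => [c0|b0]; first by rewrite !clip01_gt1//; lra.
  by congr clip01; lra.
by rewrite (@clip01_id (a + b)) // !ltW.
Qed.

Variables (g : (V -> R) -> V -> R) (L C : R).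
Hypothesis L0 : 0 <= L.
Hypothesis C0 : 0 <= C.
Hypothesis gL : forall x y N, in01 x -> in01 y ->
  (forall j, `|x j - y j| <= N) -> forall i, `|g x i - g y i| <= L * N.
Hypothesis gC : forall x, in01 x -> forall i, `|g x i| <= C.

Definition euler_step tau x : V -> R := fun i => clip01 (x i + tau * g x i).

Definition euler tau n x : V -> R := iter n (euler_step tau) x.

Lemma euler_in01 tau n x : in01 x -> in01 (euler tau n x).
Proof. by case: n => //= n _ i; exact: clip01_itv. Qed.

Lemma euler_step_lip tau x y N : 0 <= tau -> in01 x -> in01 y ->
  (forall j, `|x j - y j| <= N) ->
  forall i, `|euler_step tau x i - euler_step tau y i| <= (1 + tau * L) * N.
Proof.
move=> tau0 x01 y01 xyN i; apply: le_trans (clip01_lip _ _) _.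
have -> : x i + tau * g x i - (y i + tau * g y i) =
  (x i - y i) + tau * (g x i - g y i) by ring.
apply: le_trans (ler_normD _ _) _; rewrite mulrDl mul1r lerD//.
by rewrite normrM ger0_norm// -mulrA ler_wpM2l// gL.
Qed.

Lemma euler_step_dist tau x i : 0 <= tau -> in01 x ->
  `|euler_step tau x i - x i| <= tau * C.
Proof.
move=> tau0 x01; rewrite -[X in _ - X](clip01_id (x01 i)).
apply: le_trans (clip01_lip _ _) _; rewrite addrAC subrr add0r normrM ger0_norm//.
by rewrite ler_wpM2l// gC.
Qed.

Lemma euler_dist tau n x i : 0 <= tau -> in01 x ->
  `|euler tau n x i - x i| <= n%:R * tau * C.
Proof.
move=> tau0 x01; elim: n => [|n IH]; first by rewrite /= subrr normr0 !mul0r.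
rewrite /euler iterS -/(euler tau n x) -(subrKA (euler tau n x i)).
apply: le_trans (ler_normD _ _) _; rewrite -[in X in _ <= X]natr1 mulrDl mul1r mulrDl addrC lerD//.
by apply: euler_step_dist => //; exact: euler_in01.
Qed.

(** With the field frozen at [x], the [n] clipped steps collapse into one by [clip01_clip].
    Unfreezing costs [tau * L * (n%:R * tau * C)] in the next step, since the polygon has moved by
    at most [n%:R * tau * C]; the sum closes because [n ^ 2 + n <= (n + 1) ^ 2]. *)
Lemma euler_local tau n x i : 0 <= tau -> in01 x ->
  `|euler tau n x i - clip01 (x i + n%:R * tau * g x i)| <=
  L * C * (n%:R * tau) ^+ 2.
Proof.
move=> tau0 x01; elim: n => [|n IH].
  by rewrite /= !mul0r addr0 clip01_id// subrr normr0 expr0n/= mulr0.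
set y := euler tau n x in IH *.
have y01 : in01 y by exact: euler_in01.
have -> : x i + n.+1%:R * tau * g x i = x i + n%:R * tau * g x i + tau * g x i.
  by rewrite -natr1; ring.
rewrite -clip01_clip//; last first.
  have -> : n%:R * tau * g x i * (tau * g x i) = n%:R * (tau * g x i) ^+ 2 by ring.
  by rewrite mulr_ge0// sqr_ge0.
rewrite /euler iterS -/(euler tau n x) -/y /euler_step.
apply: le_trans (clip01_lip _ _) _.
have -> : y i + tau * g y i - (clip01 (x i + n%:R * tau * g x i) + tau * g x i) =
  (y i - clip01 (x i + n%:R * tau * g x i)) + tau * (g y i - g x i) by ring.
apply: le_trans (ler_normD _ _) _.
have gyx : `|tau * (g y i - g x i)| <= tau * (L * (n%:R * tau * C)).
  rewrite normrM (ger0_norm tau0) ler_wpM2l//; apply: gL => // j.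
  exact: euler_dist.
apply: le_trans (lerD IH gyx) _.
have : 0 <= L * C * (n.+1%:R * tau ^+ 2) by rewrite !mulr_ge0// sqr_ge0.
by rewrite -!natr1; lra.
Qed.

(** Discrete Gronwall: two half steps differ from a full one by at most [L * C * tau ^+ 2], and each
    step amplifies earlier errors by [1 + tau * L <= expR (tau * L)]. *)
Lemma euler_refine tau k x i : 0 <= tau -> in01 x ->
  `|euler (tau / 2) (2 * k) x i - euler tau k x i| <=
  k%:R * (L * C * tau ^+ 2) * expR (L * (k%:R * tau)).
Proof.
move=> tau0 x01; elim: k i => [|k IH] i.
  by rewrite muln0 /= subrr normr0 !mul0r.
rewrite mulnS /euler iterD -/(euler (tau / 2) (2 * k) x) iterS -/(euler tau k x).
set y := euler (tau / 2) (2 * k) x in IH *; set z := euler tau k x in IH *.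
have y01 : in01 y by exact: euler_in01.
have z01 : in01 z by exact: euler_in01.
have t20 : 0 <= tau / 2 by rewrite divr_ge0.
have := euler_local 2 i t20 y01; rewrite (_ : 2%:R * (tau / 2) = tau); last by field.
rewrite -/(euler_step tau y i) => H1.
have H2 := euler_step_lip tau0 y01 z01 IH i.
have -> : iter 2 (euler_step (tau / 2)) y i - euler_step tau z i =
  (euler (tau / 2) 2 y i - euler_step tau y i) +
  (euler_step tau y i - euler_step tau z i) by rewrite /euler; ring.
apply: le_trans (ler_normD _ _) _; apply: le_trans (lerD H1 H2) _.
have D0 : 0 <= L * C * tau ^+ 2 by rewrite !mulr_ge0// sqr_ge0.
have -> : expR (L * (k.+1%:R * tau)) = expR (tau * L) * expR (L * (k%:R * tau)).
  by rewrite -expRD; congr expR; rewrite -natr1; ring.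
have e1 : 1 + tau * L <= expR (tau * L) by exact: expR_ge1Dx.
have tL : 0 <= tau * L by rewrite mulr_ge0.
have e2 : 1 <= expR (tau * L) * expR (L * (k%:R * tau)).
  rewrite -expRD -expR0 ler_expR addr_ge0// mulr_ge0// mulr_ge0//.
have e3 := expR_ge0 (L * (k%:R * tau)).
rewrite -[in X in _ <= X]natr1.
set E := expR (tau * L) * _ in e2 *; set D := L * C * tau ^+ 2 in D0 *.
have -> : (k%:R + 1) * D * E = D * E + k%:R * D * E by ring.
apply: lerD.
  by rewrite -{1}[D]mulr1 ler_wpM2l.
rewrite mulrCA ler_wpM2l//; first by rewrite mulr_ge0.
exact: ler_wpM2r.
Qed.

Definition dyadic n : R := 2^-1 ^+ n.

Local Notation h := dyadic.

Lemma dyadic_gt0 n : 0 < h n.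
Proof. by rewrite exprn_gt0. Qed.

Lemma dyadicS n : h n.+1 = h n / 2.
Proof. by rewrite /dyadic exprSr. Qed.

Definition steps n (t : R) := Num.truncn (t * 2 ^+ n).

Lemma steps_itv n t : 0 <= t ->
  (steps n t)%:R * h n <= t /\ t < (steps n t)%:R * h n + h n.
Proof.
move=> t0; have t2 : 0 <= t * 2 ^+ n by rewrite mulr_ge0// exprn_ge0.
have /andP[] := truncn_itv t2; rewrite -/(steps n t).
have P0 : 0 < 2 ^+ n :> R by rewrite exprn_gt0.
rewrite /dyadic exprVn => k1 k2; split; first by rewrite ler_pdivrMr.
by rewrite -[X in _ + X]mul1r -mulrDl natr1 ltr_pdivlMr.
Qed.

Definition euler_dyadic n t u0 : V -> R := euler (h n) (steps n t) u0.

Lemma euler_dyadic_cvg u0 t n i : in01 u0 -> 0 <= t ->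
  `|euler_dyadic n.+1 t u0 i - euler_dyadic n t u0 i| <=
  (L * C * t * expR (L * t) + C) * h n.
Proof.
move=> u01 t0; set k := steps n t; have hn0 := ltW (dyadic_gt0 n).
have [k1 k2] := steps_itv n t0; have [m1 m2] := steps_itv n.+1 t0.
rewrite -/k in k1 k2.
(* Twice as many half steps reach the same grid point, and at most one further half step, counted by
   [e], fits before [t]. *)
have [e ee eE] : exists2 e, (e <= 1)%N & steps n.+1 t = (e + 2 * k)%N.
  exists (steps n.+1 t - 2 * k)%N; last first.
    rewrite subnK// -ltnS -(ltr_nat R) -natr1 -(ltr_pM2r (dyadic_gt0 n.+1)) mulrDl mul1r.
    by apply: le_lt_trans m2; rewrite natrM dyadicS; lra.
  rewrite leq_subLR -ltnS -(ltr_nat R) -(ltr_pM2r (dyadic_gt0 n.+1)).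
  apply: le_lt_trans m1 _; rewrite -natr1 natrD natrM dyadicS; lra.
rewrite /euler_dyadic eE -/k dyadicS /euler iterD -/(euler (h n / 2) (2 * k) u0).
set y := euler (h n / 2) (2 * k) u0.
have y01 : in01 y by exact: euler_in01.
have t20 : 0 <= h n / 2 by rewrite divr_ge0.
have H1 := euler_dist e i t20 y01.
have H2 := euler_refine k i hn0 u01.
rewrite -(subrKA (y i)); apply: le_trans (ler_normD _ _) _.
rewrite addrC mulrDl lerD//; last first.
  apply: le_trans H1 _; rewrite mulrC ler_wpM2l//.
  have : e%:R <= 1 :> R by rewrite (ler_nat R e 1).
  by move=> e1; apply: (@le_trans _ _ (1 * (h n / 2))); [exact: ler_wpM2r|lra].
apply: le_trans H2 _.
have -> : k%:R * (L * C * h n ^+ 2) = L * C * (k%:R * h n) * h n by ring.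
have -> : L * C * t * expR (L * t) * h n = L * C * t * h n * expR (L * t) by ring.
have kh0 : 0 <= k%:R * h n by rewrite mulr_ge0.
apply: ler_pM; rewrite ?expR_ge0//.
- by rewrite mulr_ge0// mulr_ge0// mulr_ge0.
- by rewrite ler_wpM2r// ler_wpM2l// mulr_ge0.
- by rewrite ler_expR ler_wpM2l.
Qed.

(* The projected Euler polygons converge along dyadic step sizes. *)
Lemma projected_flow u0 : in01 u0 -> exists u : R -> V -> R,
  [/\ u 0 = u0, forall t, 0 <= t -> in01 (u t) &
   forall s t i, 0 <= s -> s <= t ->
    `|u t i - clip01 (u s i + (t - s) * g (u s) i)| <= L * C * (t - s) ^+ 2].
Proof.
move=> u01.
pose K t := 2 * (L * C * t * expR (L * t) + C).
have /choice[u uP] : forall t, exists ut : V -> R, 0 <= t ->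
    forall n i, `|euler_dyadic n t u0 i - ut i| <= K t * h n.
  move=> t; have [t0|t0] := leP 0 t; last by exists (fun=> 0).
  have /choice[ut utP] : forall i, exists l,
      forall n, `|euler_dyadic n t u0 i - l| <= K t * h n.
    by move=> i; apply: geometric_increments_limit => n; exact: euler_dyadic_cvg.
  by exists ut => _ n i; exact: utP.
have smallh (c e : R) : 0 < e -> exists n, `|c| * h n <= e.
  move=> e0; exists (Num.truncn (`|c| / e)); set n := Num.truncn _.
  have := truncnS_gt (`|c| / e); rewrite -/n ltr_pdivrMr// => /ltW ce.
  rewrite /dyadic exprVn ler_pdivrMr ?exprn_gt0//; apply: (le_trans ce).
  by rewrite mulrC ler_pM2l// -natrX ler_nat ltn_expl.
have K0 t : 0 <= t -> 0 <= K t.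
  by move=> t0; rewrite mulr_ge0// addr_ge0// !mulr_ge0// expR_ge0.
clearbody K.
have uin t : 0 <= t -> in01 (u t).
  move=> t0 i; apply/andP; split; apply/ler_addgt0Pl => e e0.
    have [n hn] := smallh (K t) e e0; have := uP t t0 n i.
    have /andP[] := euler_in01 (h n) (steps n t) u01 i.
    rewrite -/(euler_dyadic n t u0 i) ler_norml.
    by rewrite ger0_norm ?K0// in hn; move=> ? ? /andP[? ?]; lra.
  have [n hn] := smallh (K t) e e0; have := uP t t0 n i.
  have /andP[] := euler_in01 (h n) (steps n t) u01 i.
  rewrite -/(euler_dyadic n t u0 i) ler_norml.
  by rewrite ger0_norm ?K0// in hn; move=> ? ? /andP[? ?]; lra.
(* At time 0 every polygon is at [u0], so prescribing this value keeps the convergence estimate. *)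
pose u' t := if t == 0 then u0 else u t.
have u'P t : 0 <= t -> forall n i, `|euler_dyadic n t u0 i - u' t i| <= K t * h n.
  move=> t0 n i; rewrite /u'; case: eqVneq => [->|_]; last exact: uP.
  rewrite /euler_dyadic /steps mul0r truncn0/= subrr normr0.
  by rewrite mulr_ge0 ?K0// ltW// dyadic_gt0.
have u'in t : 0 <= t -> in01 (u' t).
  by move=> t0; rewrite /u'; case: eqVneq => [_|_] //; exact: uin.
exists u'; split => //; first by rewrite /u' eqxx.
move=> s t i s0 st; have t0 := le_trans s0 st.
have ts0 : 0 <= t - s by rewrite subr_ge0.
apply/ler_addgt0Pl => e e0.
(* The coefficients of [h n] in the total error: convergence at [t] and at [s], the mismatch between
   [m] grid steps and [t - s] in the quadratic bound and in the displacement, and the change of the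
   field between polygon and limit at time [s]. *)
pose M := K t + K s + L * C * (4 * (t - s) + 4) + 2 * C + (t - s) * L * K s.
have M0 : 0 <= M.
  have ? := K0 t t0; have ? := K0 s s0.
  have LC0 : 0 <= L * C by rewrite mulr_ge0.
  have ? : 0 <= L * C * (4 * (t - s) + 4) by rewrite mulr_ge0//; lra.
  have ? : 0 <= (t - s) * L * K s by rewrite mulr_ge0// mulr_ge0.
  have ? : 0 <= 2 * C by rewrite mulr_ge0.
  by rewrite /M; do ?apply: addr_ge0.
have [n Mn] := smallh M e e0; rewrite ger0_norm// in Mn.
have hn0 := dyadic_gt0 n.
have hn1 : h n <= 1 by rewrite exprn_ile1// invf_le1// ler1n.
set ut := euler_dyadic n t u0; set us := euler_dyadic n s u0.
have [s1 s2] := steps_itv n s0; have [t1 t2] := steps_itv n t0.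
have st_steps : (steps n s <= steps n t)%N.
  by apply: le_truncn; rewrite ler_wpM2r// exprn_ge0.
pose m := (steps n t - steps n s)%N.
have mE : m%:R * h n = (steps n t)%:R * h n - (steps n s)%:R * h n.
  by rewrite /m natrB// mulrBl.
have us01 : in01 us by exact: euler_in01.
have utE : ut = euler (h n) m us.
  by rewrite /ut /us /euler_dyadic /euler -iterD subnK.
have H1 := euler_local m i (ltW hn0) us01; rewrite -utE in H1.
have H2 := u'P t t0 n i; rewrite -/ut in H2.
have H3 := u'P s s0 n; rewrite -/us in H3.
have H4 := gL us01 (u'in s s0) H3 i.
have H5 := gC us01 i.
have H6 : `|clip01 (us i + m%:R * h n * g us i) -
    clip01 (u' s i + (t - s) * g (u' s) i)| <=
    K s * h n + (2 * h n * C + (t - s) * (L * (K s * h n))).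
  apply: le_trans (clip01_lip _ _) _.
  have -> : us i + m%:R * h n * g us i - (u' s i + (t - s) * g (u' s) i) =
    (us i - u' s i) + ((m%:R * h n - (t - s)) * g us i + (t - s) * (g us i - g (u' s) i)).
    by ring.
  apply: le_trans (ler_normD _ _) _; apply: lerD => //.
  apply: le_trans (ler_normD _ _) _; apply: lerD.
    rewrite normrM; apply: ler_pM => //.
    by rewrite mE ler_norml; apply/andP; split; lra.
  by rewrite normrM (ger0_norm ts0) ler_wpM2l.
have H7 : L * C * (m%:R * h n) ^+ 2 <=
    L * C * (t - s) ^+ 2 + L * C * (4 * (t - s) + 4) * h n.
  have -> : L * C * (t - s) ^+ 2 + L * C * (4 * (t - s) + 4) * h n =
    L * C * ((t - s) ^+ 2 + (4 * (t - s) + 4) * h n) by ring.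
  rewrite ler_wpM2l// ?mulr_ge0//.
  have mh : m%:R * h n <= t - s + 2 * h n by rewrite mE; lra.
  apply: (@le_trans _ _ ((t - s + 2 * h n) ^+ 2)).
    have m0 : 0 <= m%:R * h n by rewrite mulr_ge0// ltW.
    by rewrite !expr2; apply: ler_pM.
  have : h n * h n <= h n by rewrite ler_piMr// ltW.
  by rewrite !expr2; lra.
have -> : u' t i - clip01 (u' s i + (t - s) * g (u' s) i) =
  (u' t i - ut i) + ((ut i - clip01 (us i + m%:R * h n * g us i)) +
   (clip01 (us i + m%:R * h n * g us i) - clip01 (u' s i + (t - s) * g (u' s) i))).
  by ring.
apply: le_trans (ler_normD _ _) _; rewrite distrC.
have := ler_normD (ut i - clip01 (us i + m%:R * h n * g us i))
   (clip01 (us i + m%:R * h n * g us i) - clip01 (u' s i + (t - s) * g (u' s) i)).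
move: Mn; rewrite /M; lra.
Qed.

End projected_euler.

(** * Regularity of the projected flow *)

Section power_functions.
Context (R : realType).
Implicit Types (a b : R) (m : nat).

Lemma exprn_taylor a b m : 0 <= a <= 1 -> 0 <= b <= 1 ->
  `|b ^+ m - a ^+ m - m%:R * a ^+ m.-1 * (b - a)| <= m%:R ^+ 2 * (b - a) ^+ 2.
Proof.
move=> /andP[a0 a1] /andP[b0 b1]; elim: m => [|m IH].
  by rewrite !expr0 subrr !mul0r subrr normr0 mulr_ge0// sqr_ge0.
have E : b ^+ m.+1 - a ^+ m.+1 - m.+1%:R * a ^+ m * (b - a) =
   b * (b ^+ m - a ^+ m - m%:R * a ^+ m.-1 * (b - a)) +
   m%:R * a ^+ m.-1 * (b - a) ^+ 2.
  rewrite -natr1; case: m {IH} => [|m] /=; first by rewrite !expr0; ring.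
  by rewrite !exprS; ring.
rewrite /= E; apply: le_trans (ler_normD _ _) _.
have B1 : `|b * (b ^+ m - a ^+ m - m%:R * a ^+ m.-1 * (b - a))| <= m%:R ^+ 2 * (b - a) ^+ 2.
  by rewrite normrM (ger0_norm b0); apply: le_trans IH; rewrite ler_piMl.
have s0 := sqr_ge0 (b - a).
have B2 : `|m%:R * a ^+ m.-1 * (b - a) ^+ 2| <= m%:R * (b - a) ^+ 2.
  have p0 : 0 <= m%:R * a ^+ m.-1 by rewrite mulr_ge0// exprn_ge0.
  rewrite normrM (ger0_norm p0) (ger0_norm s0); apply: ler_wpM2r => //.
  by rewrite ler_piMr// exprn_ile1.
apply: le_trans (lerD B1 B2) _; rewrite -natr1.
have : 0 <= m%:R * (b - a) ^+ 2 by rewrite mulr_ge0.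
by move: s0; rewrite !expr2; lra.
Qed.

Lemma bernoulli_ineq a m : 0 <= a <= 1 -> 1 - m%:R * a <= (1 - a) ^+ m.
Proof.
move=> /andP[a0 a1]; elim: m => [|m IH]; first by rewrite mul0r subr0 expr0.
have := ler_wpM2l (_ : 0 <= 1 - a) IH; rewrite subr_ge0 => /(_ a1).
have : 0 <= m%:R * (a * a) by rewrite !mulr_ge0.
by rewrite exprS -natr1; lra.
Qed.

(* [cutoff_prim m] tends to the identity on [[0, 1]], while its derivative
   [cutoff m] vanishes at 0 and 1 and tends to 1 in between. *)
Definition cutoff m a := 1 - a ^+ m - (1 - a) ^+ m.

Definition cutoff_prim m a :=
  a - a ^+ m.+1 / m.+1%:R + (1 - a) ^+ m.+1 / m.+1%:R.

Lemma cutoff_prim_taylor a b m : 0 <= a <= 1 -> 0 <= b <= 1 ->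
  `|cutoff_prim m b - cutoff_prim m a - cutoff m a * (b - a)| <=
  2 * m.+1%:R * (b - a) ^+ 2.
Proof.
move=> a01 b01; have T1 := exprn_taylor m.+1 a01 b01.
have a01' : 0 <= 1 - a <= 1 by move: a01 => /andP[? ?]; apply/andP; split; lra.
have b01' : 0 <= 1 - b <= 1 by move: b01 => /andP[? ?]; apply/andP; split; lra.
have T2 := exprn_taylor m.+1 a01' b01'.
have m0 : 0 < m.+1%:R :> R by rewrite ltr0n.
have -> : cutoff_prim m b - cutoff_prim m a - cutoff m a * (b - a) =
  ((1 - b) ^+ m.+1 - (1 - a) ^+ m.+1 - m.+1%:R * (1 - a) ^+ m * (1 - b - (1 - a))) / m.+1%:R
  - (b ^+ m.+1 - a ^+ m.+1 - m.+1%:R * a ^+ m * (b - a)) / m.+1%:R.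
  by rewrite /cutoff_prim /cutoff; field; rewrite gt_eqF.
apply: le_trans (ler_normB _ _) _; rewrite !normrM normfV (gtr0_norm m0) -mulrDl.
rewrite ler_pdivrMr//; move: T1 T2 => /=.
have -> : 1 - b - (1 - a) = - (b - a) by ring.
rewrite sqrrN !expr2; lra.
Qed.

Lemma cutoff_itv a m : (0 < m)%N -> 0 <= a <= 1 -> 0 <= cutoff m a <= 1.
Proof.
move=> m0 /andP[a0 a1]; have p1 : a ^+ m <= a by rewrite ler_iXnr.
have p2 : (1 - a) ^+ m <= 1 - a by rewrite ler_iXnr//; lra.
have ? : 0 <= a ^+ m by rewrite exprn_ge0.
have ? : 0 <= (1 - a) ^+ m by rewrite exprn_ge0// subr_ge0.
by rewrite /cutoff; apply/andP; split; lra.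
Qed.

(** Bernoulli's inequality at both ends: the cutoff is at most [m] times the distance to either
    obstacle, which is what later absorbs the error of clipping. *)
Lemma cutoff_le a m : 0 <= a <= 1 ->
  cutoff m a <= m%:R * a /\ cutoff m a <= m%:R * (1 - a).
Proof.
move=> a01; have /andP[a0 a1] := a01.
have a01' : 0 <= 1 - a <= 1 by apply/andP; split; lra.
have := bernoulli_ineq m a01; have := bernoulli_ineq m a01'.
have -> : 1 - (1 - a) = a by ring.
rewrite /cutoff.
have ? : 0 <= a ^+ m by rewrite exprn_ge0.
have ? : 0 <= (1 - a) ^+ m by rewrite exprn_ge0// subr_ge0.
by split; lra.
Qed.

Lemma cutoff_prim_dist a m : 0 <= a <= 1 -> `|cutoff_prim m a - a| <= m.+1%:R^-1.
Proof.
move=> /andP[a0 a1]; have m0 : 0 < m.+1%:R :> R by rewrite ltr0n.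
have -> : cutoff_prim m a - a = ((1 - a) ^+ m.+1 - a ^+ m.+1) / m.+1%:R.
  by rewrite /cutoff_prim; field; rewrite gt_eqF.
rewrite normrM normfV (gtr0_norm m0) ler_piMl ?invr_ge0 ?(ltW m0)//.
have ? : 0 <= a ^+ m.+1 <= 1 by rewrite exprn_ge0//= exprn_ile1.
have ? : 0 <= (1 - a) ^+ m.+1 <= 1.
  by rewrite exprn_ge0 ?exprn_ile1//= ?subr_ge0//; lra.
by rewrite ler_norml; apply/andP; split; lra.
Qed.

Lemma cvg_cutoff a : 0 <= a <= 1 ->
  (fun m => cutoff m.+1 a) @ \oo --> (if 0 < a < 1 then 1 else 0 : R).
Proof.
move=> /andP[a0 a1].
have pow z : 0 <= z -> z < 1 -> (fun m => z ^+ m.+1) @ \oo --> (0 : R).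
  move=> z0 z1; have := @cvg_geometric R z z; rewrite ger0_norm// => /(_ z1).
  by apply: cvg_trans; apply: near_eq_cvg; near=> m; rewrite /= exprS.
case: ifPn => [/andP[a0' a1']|].
  rewrite -[X in _ --> X]subr0 -[X in _ --> X]subr0.
  apply: cvgB; last by apply: pow; lra.
  by apply: cvgB; [exact: cvg_cst|exact: pow].
rewrite negb_and -!leNgt => a01.
have -> : (fun m => cutoff m.+1 a) = cst 0; last exact: cvg_cst.
apply/funext => m; rewrite /cutoff /=; case/orP: a01 => ?.
  have -> : a = 0 by apply/eqP; rewrite eq_le a0 andbT.
  by rewrite subr0 expr1n expr0n/= subr0 subrr.
have -> : a = 1 by apply/eqP; rewrite eq_le a1.
by rewrite subrr expr1n expr0n/= subrr subr0.
Unshelve. all: by end_near. Qed.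

End power_functions.

(** * The velocity of the projected flow *)

Section projected_flow_regularity.
Context (R : realType) (V : finType).
Notation mu := (@lebesgue_measure R).
Variables (g : (V -> R) -> V -> R) (L C D : R) (u : R -> V -> R).
Hypothesis L0 : 0 <= L.
Hypothesis C0 : 0 <= C.
Hypothesis D0 : 0 <= D.
Hypothesis gL : forall x y N, in01 x -> in01 y ->
  (forall j, `|x j - y j| <= N) -> forall i, `|g x i - g y i| <= L * N.
Hypothesis gC : forall x, in01 x -> forall i, `|g x i| <= C.
Hypothesis u01 : forall t, 0 <= t -> in01 (u t).
Hypothesis uE : forall s t i, 0 <= s -> s <= t ->
  `|u t i - clip01 (u s i + (t - s) * g (u s) i)| <= D * (t - s) ^+ 2.

Lemma flow_dist s t i : 0 <= s -> s <= t -> t - s <= 1 ->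
  `|u t i - u s i| <= (C + D) * (t - s).
Proof.
move=> s0 st ts1; have ts0 : 0 <= t - s by rewrite subr_ge0.
rewrite -(subrKA (clip01 (u s i + (t - s) * g (u s) i))).
apply: le_trans (ler_normD _ _) _; rewrite addrC.
have -> : (C + D) * (t - s) = C * (t - s) + D * (t - s) by ring.
apply: lerD.
  rewrite -[X in _ - X](clip01_id (u01 s0 i)); apply: le_trans (clip01_lip _ _) _.
  rewrite addrAC subrr add0r normrM ger0_norm// mulrC; apply: ler_wpM2r => //.
  by apply: gC; exact: u01.
apply: le_trans (uE i s0 st) _; rewrite ler_wpM2l//.
by rewrite expr2 ler_piMr.
Qed.

Lemma flow_dist_abs s t i : 0 <= s -> 0 <= t -> `|t - s| <= 1 ->
  `|u t i - u s i| <= (C + D) * `|t - s|.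
Proof.
move=> s0 t0; have [st|/ltW ts] := leP s t.
  by rewrite (ger0_norm (_ : 0 <= t - s)) ?subr_ge0//; exact: flow_dist.
rewrite distrC (distrC (u t i)) (ger0_norm (_ : 0 <= s - t)) ?subr_ge0//.
exact: flow_dist.
Qed.

Lemma lip_continuous (f : R -> R) M b : 0 <= M ->
  (forall s t, 0 <= s -> 0 <= t -> `|t - s| <= 1 -> `|f t - f s| <= M * `|t - s|) ->
  {within `[0, b], continuous f}.
Proof.
move=> M0 fM; apply/within_continuous_itvP => c /andP[c0 _] e e0.
exists (Num.min 1 (e / (M + 1))).
  by rewrite lt_min ltr01 divr_gt0// ltr_wpDl.
move=> x /andP[x0 _]; rewrite lt_min => /andP[xc1 xc2].
apply: le_lt_trans (fM c x c0 x0 (ltW xc1)) _.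
move: xc2; rewrite ltr_pdivlMr ?ltr_wpDl// mulrDr mulr1 mulrC; apply: le_lt_trans.
by rewrite lerDl.
Qed.

Lemma flow_continuous b i : {within `[0, b], continuous (u ^~ i)}.
Proof.
apply: (@lip_continuous _ (C + D)); first exact: addr_ge0.
by move=> *; exact: flow_dist_abs.
Qed.

Lemma flow_field_continuous b i : {within `[0, b], continuous (fun t => g (u t) i)}.
Proof.
apply: (@lip_continuous _ (L * (C + D))); first by rewrite mulr_ge0// addr_ge0.
move=> s t s0 t0 st; rewrite -mulrA; apply: gL; [exact: u01|exact: u01|] => j.
exact: flow_dist_abs.
Qed.

(** Three errors: the Taylor remainder of [cutoff_prim], the deviation of the flow from a clipped
    step, and the clipping itself. The last is only of first order, at most [(t - s) * C], but it
    occurs only within that distance of an obstacle, where [cutoff] is at most [m] times as large;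
    the product is of second order. *)
Lemma flow_cutoff_increment m s t i : (0 < m)%N -> 0 <= s -> s <= t -> t - s <= 1 ->
  `|cutoff_prim m (u t i) - cutoff_prim m (u s i) -
    cutoff m (u s i) * g (u s) i * (t - s)| <=
  (2 * m.+1%:R * (C + D) ^+ 2 + D + m%:R * C ^+ 2) * (t - s) ^+ 2.
Proof.
move=> m0 s0 st ts1; have t0 := le_trans s0 st.
have ts0 : 0 <= t - s by rewrite subr_ge0.
have us := u01 s0 i; have ut := u01 t0 i.
have T := cutoff_prim_taylor m us ut.
have du := flow_dist i s0 st ts1.
have gus := gC (u01 s0) i.
set a := u s i in us T du *; set b := u t i in ut T du *; set h := t - s in ts0 ts1 du *.
set G := g (u s) i in gus *.
have -> : cutoff_prim m b - cutoff_prim m a - cutoff m a * G * h =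
  (cutoff_prim m b - cutoff_prim m a - cutoff m a * (b - a)) +
  (cutoff m a * (b - clip01 (a + h * G)) +
   cutoff m a * (clip01 (a + h * G) - (a + h * G))) by ring.
have /andP[q0 q1] := cutoff_itv m0 us.
have [q2 q3] := cutoff_le m us.
have -> : (2 * m.+1%:R * (C + D) ^+ 2 + D + m%:R * C ^+ 2) * h ^+ 2 =
  2 * m.+1%:R * (C + D) ^+ 2 * h ^+ 2 + (D * h ^+ 2 + m%:R * C ^+ 2 * h ^+ 2) by ring.
apply: le_trans (ler_normD _ _) _; apply: lerD.
  apply: le_trans T _; rewrite -[X in _ <= X]mulrA; apply: ler_wpM2l => //.
  rewrite -exprMn -real_normK ?num_real// ler_sqr// nnegrE//.
  by rewrite mulr_ge0// addr_ge0.
apply: le_trans (ler_normD _ _) _; apply: lerD.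
  rewrite normrM (ger0_norm q0); apply: le_trans (uE i s0 st).
  by rewrite ler_piMl.
rewrite normrM (ger0_norm q0).
have hG : `|h * G| <= h * C by rewrite normrM (ger0_norm ts0) ler_wpM2l.
move: hG; rewrite ler_norml => /andP[hG1 hG2].
have R0 : 0 <= m%:R * C ^+ 2 * h ^+ 2 by rewrite mulr_ge0 ?sqr_ge0// mulr_ge0// sqr_ge0.
have hC0 : 0 <= h * C by rewrite mulr_ge0.
have -> : m%:R * C ^+ 2 * h ^+ 2 = (m%:R * (h * C)) * (h * C) by ring.
have mh : 0 <= m%:R * (h * C) by rewrite mulr_ge0.
have /andP[a0 a1] := us.
have [neg|pos] := leP (a + h * G) 0.
  rewrite clip01_lt0// sub0r normrN; apply: ler_pM => //.
    by apply: le_trans q2 _; rewrite ler_wpM2l//; lra.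
  by rewrite ler_norml; apply/andP; split; lra.
have [big|small] := leP 1 (a + h * G).
  rewrite clip01_gt1//; apply: ler_pM => //.
    by apply: le_trans q3 _; rewrite ler_wpM2l//; lra.
  by rewrite ler_norml; apply/andP; split; lra.
by rewrite clip01_id ?subrr ?normr0 ?mulr0 ?mulr_ge0// !ltW.
Qed.

Lemma flow_cutoff_primitive m b i : (0 < m)%N ->
  primitive_on 0 b (fun t => cutoff_prim m (u t i))
    (fun t => cutoff m (u t i) * g (u t) i).
Proof.
move=> m0; set k := fun t => cutoff m (u t i) * g (u t) i.
have ck : {within `[0, b], continuous k}.
  apply/subspace_continuousP => t tb; apply: cvgM; last first.
    by have /subspace_continuousP := @flow_field_continuous b i; exact.
  have ccut : continuous (@cutoff R m).
    move=> x; apply: cvgB; last first.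
      apply: (@cvg_comp _ _ _ (fun x : R => 1 - x) (fun x => x ^+ m)).
        by apply: cvgB; [exact: cvg_cst|exact: cvg_id].
      exact: exprn_continuous.
    by apply: cvgB; [exact: cvg_cst|exact: exprn_continuous].
  apply: (@cvg_comp _ _ _ (u ^~ i) (@cutoff R m)); last exact: ccut.
  by have /subspace_continuousP := @flow_continuous b i; exact.
have ki := integrable_on_continuous ck.
split=> // x y x0 xy yb.
pose H t := cutoff_prim m (u t i) - \int[mu]_(s in `[x, t]) k s.
suff : H y = H x by rewrite /H integral_on_set1 subr0 /= => <-; rewrite opprB addrC subrK.
apply: (@eq_of_local_increments _ _ _ H id xy) => eta eta0 c /andP[xc cy].
pose M := 2 * m.+1%:R * (C + D) ^+ 2 + D + m%:R * C ^+ 2.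
have M0 : 0 <= M.
  by rewrite /M !addr_ge0// mulr_ge0 ?sqr_ge0.
have c0b : 0 <= c <= b by rewrite (le_trans x0 xc) (le_trans cy yb).
have e40 : 0 < eta / 4 by rewrite divr_gt0.
have [d1 d10 d1P] := (within_continuous_itvP _ _ _).1 ck c c0b _ e40.
(* With the radius below, [q - p] is at most 1 and at most [2 * d2], so the second-order error
   [M * (q - p) ^+ 2] is at most [eta / 2 * (q - p)]. *)
pose d2 := eta / (4 * (M + 1)).
have M1 : 0 < M + 1 by rewrite ltr_wpDl.
have d20 : 0 < d2 by rewrite divr_gt0// mulr_gt0.
exists (Num.min d1 (Num.min 2^-1 d2)); first by rewrite !lt_min d10 d20 invr_gt0 ltr0n.
move=> p q xp pc cq qy; rewrite !lt_min => /andP[cp1 /andP[cp2 cp3]] /andP[qc1 /andP[qc2 qc3]].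
have p0 : 0 <= p by exact: le_trans xp.
have qb : q <= b by exact: le_trans yb.
have pq : p <= q by exact: le_trans cq.
have pq1 : q - p <= 1 by lra.
have kpq : integrable_on p q k by exact: integrable_onS ki.
have INC := flow_cutoff_increment i m0 p0 pq pq1.
have near1 s : p <= s <= q -> `|k s - k p| <= eta / 2.
  have kc r : p <= r <= q -> `|k r - k c| < eta / 4.
    move=> /andP[pr rq]; apply: d1P; first by rewrite (le_trans p0)// (le_trans rq).
    by rewrite ltr_norml; apply/andP; split; lra.
  move=> /kc; have := kc p; rewrite lexx pq => /(_ isT).
  by rewrite !ltr_norml ler_norml => /andP[? ?] /andP[? ?]; apply/andP; split; lra.
have -> : H q - H p = (cutoff_prim m (u q i) - cutoff_prim m (u p i) - k p * (q - p)) -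
    \int[mu]_(s in `[p, q]) (k s - k p).
  rewrite integral_onB//; last exact: integrable_on_cst.
  rewrite integral_on_cst// /H (integral_on_cat xp pq); first by lra.
  exact: integrable_onS ki.
apply: le_trans (ler_normB _ _) _.
have I2 : `|\int[mu]_(s in `[p, q]) (k s - k p)| <= eta / 2 * (q - p).
  have di : integrable_on p q (fun s => k s - k p).
    by apply: integrable_onB => //; exact: integrable_on_cst.
  apply: le_trans (normr_integral_on di) _; rewrite -integral_on_cst//.
  apply: le_integral_on; [exact: integrable_on_norm|exact: integrable_on_cst|].
  exact: lebesgue_aeW.
have I1 : M * (q - p) ^+ 2 <= eta / 2 * (q - p).
  rewrite expr2 mulrA ler_wpM2r ?subr_ge0//.
  have qp2 : q - p <= 2 * d2 by lra.
  apply: (@le_trans _ _ ((M + 1) * (2 * d2))).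
    by apply: ler_pM; rewrite ?subr_ge0// lerDl.
  by rewrite /d2 le_eqVlt; apply/orP; left; apply/eqP; field; rewrite gt_eqF.
move: INC; rewrite -/M -/(k p) => INC.
by have := le_trans INC I1; lra.
Qed.

Definition flow_speed t i := if 0 < u t i < 1 then g (u t) i else 0.

Lemma flow_speed_le t i : 0 <= t -> `|flow_speed t i| <= C.
Proof.
move=> t0; rewrite /flow_speed; case: ifPn => _; last by rewrite normr0.
exact/gC/u01.
Qed.

(** The speed jumps at the obstacles, so the identity is a limit of those for [cutoff_prim]: the
    left-hand sides converge because [cutoff_prim] tends to the identity, the integrals by dominated
    convergence with the constant bound [C]. *)
Lemma flow_primitive b i : primitive_on 0 b (u ^~ i) (flow_speed ^~ i).
Proof.
(* The index is shifted because [cutoff 0] is the constant -1. *)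
pose f m t := cutoff m.+1 (u t i) * g (u t) i.
have fi m x y : 0 <= x -> y <= b -> integrable_on x y (f m).
  by move=> x0 yb; have [H _] := @flow_cutoff_primitive m.+1 b i isT; exact: integrable_onS H.
have fw t : 0 <= t -> (f ^~ t) @ \oo --> flow_speed t i.
  move=> t0; rewrite /f /flow_speed.
  have -> : (if 0 < u t i < 1 then g (u t) i else 0) =
      (if 0 < u t i < 1 then 1 else 0) * g (u t) i.
    by case: ifP; rewrite ?mul1r ?mul0r.
  by apply: cvgM; [exact/cvg_cutoff/u01|exact: cvg_cst].
have DC x y : 0 <= x -> y <= b -> integrable_on x y (flow_speed ^~ i) /\
    (fun m => \int[mu]_(t in `[x, y]) f m t) @ \oo --> \int[mu]_(t in `[x, y]) flow_speed t i.
  move=> x0 yb.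
  have mf m : measurable_fun `[x, y] (f m).
    by have /integrableP[/measurable_EFinP] := fi m x y x0 yb.
  have xt t : `[x, y]%classic t -> 0 <= t.
    by rewrite /= in_itv/= => /andP[xt _]; exact: le_trans xt.
  have mw : measurable_fun `[x, y] (flow_speed ^~ i).
    by apply: measurable_fun_cvg mf _ => t /xt; exact: fw.
  have := @dominated_convergence _ _ R mu `[x, y]%classic (measurable_itv _)
    (fun m t => (f m t)%:E) (fun t => (flow_speed t i)%:E) (cst C%:E).
  case.
  - by move=> m; apply/measurable_EFinP; exact: mf.
  - by apply/measurable_EFinP; exact: mw.
  - apply: lebesgue_aeW => t /xt t0; apply: cvg_EFin; first exact: nearW.
    exact: fw.
  - exact: integrable_on_cst.
  - apply: lebesgue_aeW => t m /xt t0; rewrite lee_fin normrM -[C]mul1r.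
    have /andP[c0 c1] := cutoff_itv (ltn0Sn m) (u01 t0 i).
    rewrite (ger0_norm c0); apply: ler_pM => //.
    by apply: gC; exact: u01.
  move=> wi _ cw; split; first exact: wi.
  have wE : (\int[mu]_(t in `[x, y]) (flow_speed t i)%:E)%E =
     (\int[mu]_(t in `[x, y]) flow_speed t i)%:E.
    by rewrite /Rintegral fineK//; exact: integrable_fin_num.
  by move: cw; rewrite wE => /fine_cvg.
split; first by have [] := DC 0 b (lexx _) (lexx _).
move=> x y x0 xy yb; have [_ cI] := DC x y x0 yb.
have y0 := le_trans x0 xy.
apply: (@cvg_unique _ (@Rhausdorff R) _ _ _ _ _ cI).
have E m : \int[mu]_(t in `[x, y]) f m t =
    cutoff_prim m.+1 (u y i) - cutoff_prim m.+1 (u x i).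
  by have [_ ->] := @flow_cutoff_primitive m.+1 b i isT.
have -> : (fun m => \int[mu]_(t in `[x, y]) f m t) =
    (fun m => cutoff_prim m.+1 (u y i) - cutoff_prim m.+1 (u x i)) by exact/funext.
have cP t : 0 <= t -> (fun m => cutoff_prim m.+1 (u t i)) @ \oo --> u t i.
  move=> t0; apply/cvgrPdist_le => e e0.
  have := @cvg_harmonic R; move/cvgrPdist_le => /(_ e e0); apply: filterS => m /=.
  rewrite sub0r normrN ger0_norm ?invr_ge0// => me; rewrite distrC.
  apply: le_trans (cutoff_prim_dist _ (u01 t0 i)) _; apply: le_trans me.
  by rewrite lef_pV2 ?posrE ?ltr0n// ler_nat.
by apply: cvgB; exact: cP.
Qed.

(** At an obstacle the derivative is 0 for almost every such time. If the field pointed inwards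
    there, the one-step estimate would move [u] away at a speed of first order, a contradiction. *)
Lemma flow_complementarity b i : {ae mu, forall t, 0 <= t <= b ->
  [/\ u t i = 0 -> g (u t) i <= 0 /\ flow_speed t i = 0,
      0 < u t i < 1 -> flow_speed t i = g (u t) i &
      u t i = 1 -> 0 <= g (u t) i /\ flow_speed t i = 0]}.
Proof.
apply: lebesgue_aeS2 (lebesgue_ae_itvoo 0 b)
  (primitive_on_ae_derive (@flow_primitive b i)) => t tb dt t0b.
have /is_derive1P dt' : is_derive t (1 : R) (u ^~ i) (flow_speed t i).
  exact/dt/tb.
have /andP[t0 _] := t0b.
set G := g (u t) i.
have small : flow_speed t i = 0 -> G != 0 -> exists h, [/\ 0 < h, h * `|G| <= 1,
    `|u (t + h) i - u t i| <= `|G| / 2 * h & D * h < `|G| / 2].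
  move=> sp Gn0; rewrite sp in dt'; have G0 : 0 < `|G| by rewrite normr_gt0.
  have [d d0 dP] := dt' (`|G| / 2) (divr_gt0 G0 (ltr0Sn R 1)).
  (* Small enough for the derivative estimate, for the step to remain in the unit interval, and for
     the error [D * h ^+ 2] to stay below half of [|G| * h]. *)
  pose h := Num.min (d / 2) (Num.min (`|G|^-1) (`|G| / (4 * (D + 1)))).
  have D1 : 0 < 4 * (D + 1) by rewrite mulr_gt0// ltr_wpDl.
  have h0 : 0 < h by rewrite /h !lt_min invr_gt0 G0 !divr_gt0.
  have h1 : h <= d / 2 by rewrite /h ge_min lexx.
  have h2 : h <= `|G|^-1 by rewrite /h !ge_min lexx !orbT.
  have h3 : h <= `|G| / (4 * (D + 1)) by rewrite /h !ge_min lexx !orbT.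
  exists h; split=> //.
  - by rewrite -ler_pdivlMr// mul1r.
  - have := dP (t + h); rewrite mul0r subr0 [t + h]addrC addrK gtr0_norm//; apply.
    by apply: le_lt_trans h1 _; rewrite ltr_pdivrMr// ltr_pMr// ltr1n.
  - move: h3; rewrite ler_pdivlMr// => h3; have : 0 < D * h + h by rewrite ltr_wpDl// mulr_ge0// ltW.
    by move: h3; lra.
have step h : 0 < h -> `|u (t + h) i - clip01 (u t i + h * G)| <= D * h ^+ 2.
  move=> h0; have := uE i t0 (_ : t <= t + h).
  by rewrite lerDl ltW// => /(_ isT); rewrite [t + h]addrC addrK.
split=> [ut0|ut|ut1].
- have sp : flow_speed t i = 0 by rewrite /flow_speed ut0 ltxx.
  split=> //; rewrite leNgt; apply/negP => G0.
  have [h [h0 hG1 hG2 hG3]] := small sp (lt0r_neq0 G0).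
  have := step h h0; rewrite (gtr0_norm G0) ut0 in hG1 hG2 hG3 *.
  rewrite clip01_id; last by rewrite add0r hG1 mulr_ge0// ltW.
  move: hG2; rewrite expr2 !ler_norml => /andP[_ A] /andP[B _].
  have := mulr_gt0 h0 (etrans (subr_gt0 _ _) hG3); lra.
- by rewrite /flow_speed ut.
- have sp : flow_speed t i = 0 by rewrite /flow_speed ut1 ltxx andbF.
  split=> //; rewrite leNgt; apply/negP => G0.
  have [h [h0 hG1 hG2 hG3]] := small sp (ltr0_neq0 G0).
  have := step h h0; rewrite (ltr0_norm G0) ut1 in hG1 hG2 hG3 *.
  rewrite clip01_id; last first.
    have : 0 < h * - G by rewrite mulr_gt0// oppr_gt0.
    by move=> ?; apply/andP; split; lra.
  move: hG2; rewrite expr2 !ler_norml => /andP[A _] /andP[_ B].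
  have := mulr_gt0 h0 (etrans (subr_gt0 _ _) hG3); lra.
Qed.

End projected_flow_regularity.

(** * The exponential of a linear operator *)

Section finite_sums.
Context (R : realType) (I : finType).

Lemma is_derive1_sum (f : I -> R -> R) (f' : I -> R) (x : R) :
  (forall i, is_derive x (1 : R) (f i) (f' i)) ->
  is_derive x (1 : R) (fun t => \sum_i f i t) (\sum_i f' i).
Proof.
move=> df; elim: (index_enum I) => [|i s IH].
  rewrite big_nil (_ : (fun t => _) = cst 0); first exact: is_derive_cst.
  by apply/funext => t; rewrite big_nil.
rewrite big_cons (_ : (fun t => _) = f i + (fun t => \sum_(j <- s) f j t)).
  exact: is_deriveD.
by apply/funext => t; rewrite big_cons.
Qed.

Lemma cvgn_sum (f : I -> nat -> R) (l : I -> R) :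
  (forall i, f i @ \oo --> l i) ->
  (fun n => \sum_i f i n) @ \oo --> \sum_i l i.
Proof.
move=> fl; elim: (index_enum I) => [|i s IH].
  rewrite big_nil (_ : (fun t => _) = cst 0); first exact: cvg_cst.
  by apply/funext => t; rewrite big_nil.
rewrite big_cons (_ : (fun t => _) = f i \+ (fun t => \sum_(j <- s) f j t)).
  exact: cvgD.
by apply/funext => t; rewrite big_cons.
Qed.

End finite_sums.

Section operator_exponential.
Context (R : realType) (V : finType).
Variables (F : (V -> R) -> V -> R) (b : V -> V -> R).
Hypothesis FE : forall u i, F u i = \sum_j b i j * u j.
Implicit Types (u v : V -> R) (i j : V) (c : R).

Definition unit_vec j : V -> R := fun i => (i == j)%:R.

Lemma sum_unit_vec u : u = fun i => \sum_j u j * unit_vec j i.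
Proof.
apply/funext => i; rewrite (bigD1 i)//= /unit_vec eqxx mulr1 big1 ?addr0// => j ji.
by rewrite eq_sym (negbTE ji) mulr0.
Qed.

Definition lin_norm := \sum_i \sum_j `|b i j|.

Local Notation K := lin_norm.

Lemma iter_lin_bound k u i : `|iter k F u i| <= K ^+ k * \sum_j `|u j|.
Proof.
have K0 : 0 <= K by rewrite sumr_ge0// => ? _; rewrite sumr_ge0.
have N0 : 0 <= \sum_j `|u j| by rewrite sumr_ge0.
elim: k i => [|k IH] i.
  by rewrite expr0 mul1r (bigD1 i)//= lerDl sumr_ge0.
rewrite iterS FE; apply: le_trans (ler_norm_sum _ _ _) _.
apply: (@le_trans _ _ (\sum_j `|b i j| * (K ^+ k * \sum_j `|u j|))).
  by apply: ler_sum => j _; rewrite normrM ler_wpM2l.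
rewrite -mulr_suml exprS -mulrA; apply: ler_wpM2r.
  by rewrite mulr_ge0// exprn_ge0.
by rewrite /lin_norm [X in _ <= X](bigD1 i)//= lerDl sumr_ge0// => ? _; rewrite sumr_ge0.
Qed.

Definition exp_op_coef u i k : R := iter k F u i / k`!%:R.

Local Notation coef := exp_op_coef.

Lemma exp_opE c u i : exp_op F c u i = limn (pseries (coef u i) c).
Proof.
rewrite /exp_op /pseries; congr (limn (series _)); apply/funext => k.
by rewrite /= /exp_op_coef; ring.
Qed.

Lemma pseries_coef_cvg u i c : cvgn (pseries (coef u i) c).
Proof.
apply: normed_cvg; set N := \sum_j `|u j|.
have N0 : 0 <= N by rewrite sumr_ge0.
have K0 : 0 <= K by rewrite sumr_ge0// => ? _; rewrite sumr_ge0.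
apply: (@series_le_cvg _ _ (N *: exp_coeff (K * `|c|))).
- by move=> n; exact: normr_ge0.
- move=> n; rewrite /= /exp_coeff/= mulr_ge0// mulr_ge0// exprn_ge0//.
  by rewrite mulr_ge0.
- move=> n; rewrite /exp_op_coef /= /exp_coeff /= !normrM normrX normfV.
  rewrite (ger0_norm (_ : 0 <= n`!%:R))//.
  rewrite (_ : (N *: _) n = K ^+ n * N / n`!%:R * `|c| ^+ n); last first.
    transitivity (N * ((K * `|c|) ^+ n / n`!%:R)); first by [].
    by rewrite exprMn; ring.
  apply: ler_wpM2r; first exact: exprn_ge0.
  by apply: ler_wpM2r; [rewrite invr_ge0|exact: iter_lin_bound].
- by apply: is_cvg_seriesZ; exact: is_cvg_series_exp_coeff.
Qed.

Lemma exp_op_cvg u i c : pseries (coef u i) c @ \oo --> exp_op F c u i.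
Proof. by rewrite exp_opE; exact: pseries_coef_cvg. Qed.

Lemma is_derive_exp_op c u i :
  is_derive c (1 : R) (fun c => exp_op F c u i) (exp_op F c (F u) i).
Proof.
(* Differentiating the power series shifts the iterates by one, that is, replaces [v] by [F v]. *)
have dE v : pseries_diffs (coef v i) = coef (F v) i.
  apply/funext => k; rewrite /pseries_diffs /exp_op_coef -iterSr factS natrM.
  by rewrite invfM mulrCA mulVKf// pnatr_eq0.
have c0 := @pseries_coef_cvg u i (`|c| + 1).
have c1 : cvgn (pseries (pseries_diffs (coef u i)) (`|c| + 1)).
  by rewrite dE; exact: pseries_coef_cvg.
have c2 : cvgn (pseries (pseries_diffs (pseries_diffs (coef u i))) (`|c| + 1)).
  by rewrite !dE; exact: pseries_coef_cvg.
have cK : `|c| < `| `|c| + 1 |.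
  by rewrite [X in _ < X]ger0_norm ?addr_ge0// ltrDl.
have := pseries_snd_diffs c0 c1 c2 cK; rewrite dE -exp_opE; congr is_derive.
by apply/funext => x; rewrite exp_opE.
Qed.

Lemma exp_op0 u : exp_op F 0 u = u.
Proof.
apply/funext => i; rewrite exp_opE; apply/cvg_lim => //.
rewrite -(cvg_shiftS (pseries (coef u i) 0)) (_ : (fun n => _) = cst (u i)); first exact: cvg_cst.
apply/funext => n; rewrite /pseries /series /= big_nat_recl//= big1 ?addr0.
  by rewrite /exp_op_coef expr0 mulr1 fact0 divr1.
by move=> k _; rewrite exprS mul0r mulr0.
Qed.

(** The entries [h j] may vary: a fixed entry yields linearity in the vector, varying entries yield
    commutation with [F], whose rows combine several coordinates. *)
Lemma exp_op_lincomb (I : finType) c u i (a : I -> R) (v : I -> V -> R) (h : I -> V) :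
  (forall k, iter k F u i = \sum_j a j * iter k F (v j) (h j)) ->
  exp_op F c u i = \sum_j a j * exp_op F c (v j) (h j).
Proof.
move=> uE; apply: (@cvg_unique _ (@Rhausdorff R) _ _ _ _ (@exp_op_cvg u i c)).
have -> : pseries (coef u i) c = fun n => \sum_j a j * pseries (coef (v j) (h j)) c n.
  apply/funext => n; rewrite /pseries /series /=.
  under [RHS]eq_bigr do rewrite mulr_sumr.
  rewrite exchange_big/=; apply: eq_bigr => k _.
  rewrite /exp_op_coef uE !mulr_suml; apply: eq_bigr => j _; ring.
apply: cvgn_sum => j; apply: cvgM; first exact: cvg_cst.
exact: exp_op_cvg.
Qed.

Lemma iter_lin_sum (I : finType) k (a : I -> R) (v : I -> V -> R) i :
  iter k F (fun i => \sum_j a j * v j i) i = \sum_j a j * iter k F (v j) i.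
Proof.
elim: k i => [|k IH] i //=; rewrite FE.
transitivity (\sum_j \sum_l b i j * (a l * iter k F (v l) j)).
  by apply: eq_bigr => j _; rewrite IH mulr_sumr.
rewrite exchange_big/=; apply: eq_bigr => j _; rewrite FE mulr_sumr.
by apply: eq_bigr => l _; ring.
Qed.

Lemma exp_op_sum (I : finType) c (a : I -> R) (v : I -> V -> R) i :
  exp_op F c (fun i => \sum_j a j * v j i) i = \sum_j a j * exp_op F c (v j) i.
Proof. by apply: exp_op_lincomb => k; exact: iter_lin_sum. Qed.

Lemma exp_op_unit c u i : exp_op F c u i = \sum_j u j * exp_op F c (unit_vec j) i.
Proof. by rewrite {1}(sum_unit_vec u) exp_op_sum. Qed.

Lemma exp_op_unitF c u i :
  exp_op F c (F u) i = \sum_j u j * exp_op F c (F (unit_vec j)) i.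
Proof.
apply: (@exp_op_lincomb V c (F u) i u (fun j => F (unit_vec j)) (fun=> i)) => k.
rewrite -iterSr {1}(sum_unit_vec u) iter_lin_sum.
by apply: eq_bigr => j _; rewrite iterSr.
Qed.

Lemma exp_op_comm c u : F (exp_op F c u) = exp_op F c (F u).
Proof.
apply/funext => i; rewrite FE; apply/esym.
apply: (@exp_op_lincomb V c (F u) i (b i) (fun=> u) id) => k.
by rewrite -iterSr iterS FE.
Qed.

Lemma exp_op_lin c u v k l i :
  exp_op F c (fun j => k * u j + l * v j) i = k * exp_op F c u i + l * exp_op F c v i.
Proof.
rewrite exp_op_unit (exp_op_unit c u) (exp_op_unit c v) !mulr_sumr -big_split/=.
by apply: eq_bigr => j _; ring.
Qed.

Lemma is_derive_exp_op_affine s d u i c :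
  is_derive c (1 : R) (fun t => exp_op F (s * t + d) u i)
    (s * exp_op F (s * c + d) (F u) i).
Proof.
have aff : is_derive c (1 : R) (fun t => s * t + d) s.
  apply/is_derive1P => e e0; exists 1 => // t _.
  have -> : s * t + d - (s * c + d) - s * (t - c) = 0 by ring.
  by rewrite normr0 mulr_ge0// ltW.
rewrite mulrC.
exact: (@is_derive1_comp R (fun c => exp_op F c u i) (fun t => s * t + d)
  c _ _ (is_derive_exp_op _ _ _) aff).
Qed.

Lemma is_derive_exp_opM (y : R -> V -> R) (y' : V -> R) c s d i :
  (forall j, is_derive c (1 : R) (y ^~ j) (y' j)) ->
  is_derive c (1 : R) (fun t => exp_op F (s * t + d) (y t) i)
    (exp_op F (s * c + d) y' i + s * exp_op F (s * c + d) (F (y c)) i).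
Proof.
move=> dy; rewrite (_ : (fun t => _) = fun t => \sum_j y t j * exp_op F (s * t + d) (unit_vec j) i); last first.
  by apply/funext => t; rewrite exp_op_unit.
have -> : exp_op F (s * c + d) y' i + s * exp_op F (s * c + d) (F (y c)) i =
   \sum_j (y c j * (s * exp_op F (s * c + d) (F (unit_vec j)) i) +
           exp_op F (s * c + d) (unit_vec j) i * y' j).
  rewrite addrC big_split/=; congr (_ + _); last first.
    by rewrite exp_op_unit; apply: eq_bigr => j _; rewrite mulrC.
  rewrite exp_op_unitF mulr_sumr; apply: eq_bigr => j _; ring.
apply: is_derive1_sum => j.
exact: (is_deriveM (dy j) (is_derive_exp_op_affine s d (unit_vec j) i c)).
Qed.

Lemma exp_opD a c u : exp_op F a (exp_op F c u) = exp_op F (a + c) u.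
Proof.
apply/funext => i.
(* Constant in [t], since the two exponents move in opposite directions; its values at 0 and at [a]
   are the two sides. *)
pose H t := exp_op F (-1 * t + a) (exp_op F (1 * t + c) u) i.
have dH t : is_derive t (1 : R) H 0.
  have dy j : is_derive t (1 : R) (fun t => exp_op F (1 * t + c) u j)
      (exp_op F (1 * t + c) (F u) j).
    by have := is_derive_exp_op_affine 1 c u j t; rewrite mul1r.
  have := @is_derive_exp_opM (fun t => exp_op F (1 * t + c) u) _ t (-1) a i dy.
  rewrite exp_op_comm; set A := exp_op F _ _ i.
  by rewrite (_ : A + -1 * A = 0)//; ring.
have := is_derive_0_is_cst 0 a dH; rewrite /H !mulr0 !add0r => ->.
by rewrite mulN1r addNr exp_op0 mul1r.
Qed.

End operator_exponential.

(** * Rayleigh quotients and the graph Laplacian *)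

Section rayleigh.
Context (R : realType) (V : finType).
Variables (F : (V -> R) -> V -> R) (b : V -> V -> R) (d : V -> R).
Hypothesis FE : forall u i, F u i = \sum_j b i j * u j.
Hypothesis d_gt0 : forall i, 0 < d i.
Hypothesis F_sym : forall u v, \sum_i d i * (F u i * v i) = \sum_i d i * (u i * F v i).
Implicit Types (u v z h : V -> R).

Local Notation ptw := (prod_topology (fun _ : V => R)).

Let q z := \sum_i d i * (F z i * z i).
Let N z := \sum_i d i * z i ^+ 2.

Lemma lin_axpy u v (s : R) i : F (fun j => u j + s * v j) i = F u i + s * F v i.
Proof.
rewrite !FE mulr_sumr -big_split/=; apply: eq_bigr => j _; ring.
Qed.

Lemma compact_box (M : R) :
  compact [set f : ptw | forall i, `[- M, M]%classic (f i)].
Proof.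
apply: (@tychonoff V (fun=> R) (fun=> `[- M, M]%classic)) => i.
exact: segment_compact.
Qed.

Lemma coord_continuous i : continuous (fun f : ptw => f i).
Proof. exact: (@proj_continuous V (fun=> R) i). Qed.

Section form_continuity.
Context (T : topologicalType) (x : V -> T -> R).
Hypothesis cx : forall i, continuous (x i).

Lemma sum_continuous (f : V -> T -> R) :
  (forall i, continuous (f i)) -> continuous (fun t => \sum_i f i t).
Proof.
move=> cf; elim: (index_enum V) => [|i s IH].
  rewrite (_ : (fun x => _) = cst 0); first by move=> t; exact: cvg_cst.
  by apply/funext => t; rewrite big_nil.
rewrite (_ : (fun x => _) = f i \+ (fun t => \sum_(j <- s) f j t)).
  by move=> t; apply: cvgD; [exact: cf|exact: IH].
by apply/funext => t; rewrite big_cons.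
Qed.

Lemma sqr_form_continuous : continuous (fun t => N (x ^~ t)).
Proof.
apply: sum_continuous => i t; apply: cvgM; first exact: cvg_cst.
have -> : (fun t => x i t ^+ 2) = fun t => x i t * x i t.
  by apply/funext => s; rewrite expr2.
by rewrite expr2; apply: cvgM; exact: cx.
Qed.

Lemma lin_form_continuous : continuous (fun t => q (x ^~ t)).
Proof.
have cF i : continuous (fun t => F (x ^~ t) i).
  have -> : (fun t => F (x ^~ t) i) = fun t => \sum_j b i j * x j t.
    by apply/funext => t; rewrite FE.
  by apply: sum_continuous => j t; apply: cvgM; [exact: cvg_cst|exact: cx].
apply: sum_continuous => i t; apply: cvgM; first exact: cvg_cst.
by apply: cvgM; [exact: cF|exact: cx].
Qed.

End form_continuity.

(* The minimum of the Rayleigh quotient over the unit sphere is an eigenvalue. *)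
Lemma rayleigh_min (i0 : V) : exists l, spectrum F l /\ forall z, l * N z <= q z.
Proof.
(* A box around the unit sphere: there [z i ^+ 2 <= (d i)^-1 <= M], and [M <= M ^+ 2] thanks to the
   summand 1. *)
pose M := 1 + \sum_i (d i)^-1.
have dinv0 i : 0 <= (d i)^-1 by rewrite invr_ge0 ltW.
have M1 : 1 <= M by rewrite lerDl sumr_ge0.
pose S := [set f : ptw | forall i, `[- M, M]%classic (f i)]
  `&` (N @^-1` [set 1]).
have cN : continuous (N : ptw -> R) := sqr_form_continuous coord_continuous.
have cq : continuous (q : ptw -> R) := lin_form_continuous coord_continuous.
have cS : compact S.
  apply: compact_closedI; first exact: compact_box.
  exact: (continuous_closedP _).1.
have inS z : N z = 1 -> S z.
  move=> Nz; split=> // i; rewrite /= in_itv/= -ler_norml.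
  have zi : `|z i| ^+ 2 <= M.
    rewrite real_normK ?num_real//.
    have : d i * z i ^+ 2 <= 1.
      rewrite -Nz /N (bigD1 i)//= lerDl sumr_ge0// => j _.
      by rewrite mulr_ge0 ?sqr_ge0// ltW.
    rewrite mulrC -ler_pdivlMr// div1r => /le_trans; apply.
    by rewrite /M (bigD1 i)//= addrCA lerDl addr_ge0// sumr_ge0.
  have M0 : 0 <= M by rewrite (le_trans ler01).
  rewrite -ler_sqr ?nnegrE//; apply: le_trans zi _.
  by rewrite expr2 ler_peMl.
have q_hom s z : q (fun i => s * z i) = s ^+ 2 * q z.
  rewrite /q mulr_sumr; apply: eq_bigr => i _.
  have -> : F (fun i => s * z i) i = s * F z i.
    by rewrite !FE mulr_sumr; apply: eq_bigr => j _; ring.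
  ring.
have N_hom s z : N (fun i => s * z i) = s ^+ 2 * N z.
  by rewrite /N mulr_sumr; apply: eq_bigr => i _; ring.
have N_ge0 z : 0 <= N z.
  by rewrite sumr_ge0// => i _; rewrite mulr_ge0 ?sqr_ge0// ltW.
have N_eq0 z : N z = 0 -> z = fun=> 0.
  move=> /eqP; rewrite psumr_eq0 => [/allP Nz|i _]; last first.
    by rewrite mulr_ge0 ?sqr_ge0// ltW.
  apply/funext => i; have := Nz i (mem_index_enum i).
  by rewrite /= mulf_eq0 gt_eqF//= sqrf_eq0 => /eqP.
have normalize z : N z != 0 -> N (fun i => (Num.sqrt (N z))^-1 * z i) = 1.
  move=> Nz; rewrite N_hom exprVn sqr_sqrtr ?N_ge0// mulVf//.
have S0 : S !=set0.
  pose e : V -> R := fun i => (i == i0)%:R.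
  have Ne : N e != 0.
    apply/eqP => /N_eq0 /(congr1 (fun f => f i0)); rewrite /e eqxx => /eqP.
    by rewrite oner_eq0.
  by exists (fun i => (Num.sqrt (N e))^-1 * e i); exact/inS/normalize.
have [c cS' cmin] := compact_EVT_min S0 cS (continuous_subspaceT cq).
have Nc : N c = 1 by move: cS'; rewrite inE => -[].
exists (q c).
have ray z : q c * N z <= q z.
  have [/N_eq0 ->|Nz] := eqVneq (N z) 0.
    have -> : N (fun=> 0) = 0 by rewrite /N big1// => i _; rewrite expr0n/= mulr0.
    by rewrite mulr0 /q big1// => i _; rewrite mulr0 mulr0.
  have Nz0 : 0 < N z by rewrite lt_neqAle eq_sym Nz N_ge0.
  have := cmin (fun i => (Num.sqrt (N z))^-1 * z i).
  rewrite inE => /(_ (inS _ (normalize _ Nz))).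
  by rewrite q_hom exprVn sqr_sqrtr ?N_ge0// mulrC ler_pdivlMr.
(* The residual of the eigenvalue equation is taken as the direction of variation: the first-order
   change of [q - q c * N] is then [2 * s * N h], and minimality forces [N h = 0]. *)
split=> //; pose h i := F c i - q c * c i.
have ccross (s : R) : 0 <= s ^+ 2 * (q h - q c * N h) + 2 * s * N h.
  have qE : q (fun i => c i + s * h i) = q c + 2 * s * (\sum_i d i * (F c i * h i)) + s ^+ 2 * q h.
    have E1 : q (fun i => c i + s * h i) = q c + s * (\sum_i d i * (F c i * h i)) +
      s * (\sum_i d i * (F h i * c i)) + s ^+ 2 * q h.
      rewrite /q !mulr_sumr -!big_split/=; apply: eq_bigr => i _.
      by rewrite lin_axpy; ring.
    rewrite E1 (F_sym h c) (_ : \sum_i d i * (h i * F c i) = \sum_i d i * (F c i * h i)); first by ring.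
    by apply: eq_bigr => i _; ring.
  have NE : N (fun i => c i + s * h i) = N c + 2 * s * (\sum_i d i * (c i * h i)) + s ^+ 2 * N h.
    by rewrite /N !mulr_sumr -!big_split/=; apply: eq_bigr => i _; ring.
  have hE : N h = \sum_i d i * (F c i * h i) - q c * \sum_i d i * (c i * h i).
    rewrite mulr_sumr -sumrB /N; apply: eq_bigr => i _; rewrite expr2 {1}/h; ring.
  have := ray (fun i => c i + s * h i); rewrite qE NE Nc.
  set X := \sum_i d i * (F c i * h i) in hE *; set Y := \sum_i d i * (c i * h i) in hE *.
  have : 2 * s * N h = 2 * s * X - q c * (2 * s * Y) by rewrite hE; ring.
  clear; lra.
exists c; split.
  move=> c0; move: Nc; rewrite c0 /N big1 => [/eqP|i _]; last by rewrite expr0n/= mulr0.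
  by rewrite eq_sym oner_eq0.
have Nh : N h = 0.
  apply/eqP; rewrite eq_le N_ge0 andbT leNgt; apply/negP => Nh.
  set P := q h - q c * N h in ccross *.
  have P1 : 0 < `|P| + 1 by rewrite ltr_wpDl.
  (* For [s = - t] with [t * P <= N h], the quadratic term is at most [t * N h] and cannot offset
     the linear term [- 2 * t * N h]. *)
  have := ccross (- (N h / (`|P| + 1))); rewrite sqrrN.
  set t := N h / (`|P| + 1).
  have t0 : 0 < t by rewrite divr_gt0.
  have tP : t * P <= N h.
    apply: (@le_trans _ _ (t * (`|P| + 1))).
      by rewrite ler_wpM2l ?(ltW t0)// (le_trans (ler_norm P))// lerDl.
    by rewrite /t divfK// gt_eqF.
  have := mulr_gt0 t0 Nh; have := ler_wpM2l (ltW t0) tP; rewrite expr2; lra.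
have h0 := N_eq0 _ Nh; apply/funext => i.
have : h i = 0 by rewrite h0.
by rewrite /h => /eqP; rewrite subr_eq0 => /eqP.
Qed.

End rayleigh.

(** * The Laplacian with fidelity as a symmetric operator *)

Section graph_operators.
Context (R : realType) (V : finType) (G : weighted_graph R V).
Hypothesis hV : (1 < #|V|)%N.
Variables (r : R) (mu : V -> R).
Hypothesis hmu : forall i, 0 <= mu i.
Implicit Types (u v p : V -> R).

Lemma deg_gt0 i : 0 < deg G i.
Proof.
have [j ji] : exists j, j != i.
  apply/existsP; rewrite -negb_forall; apply/negP => /forallP all_i.
  move: hV; rewrite ltnNge => /negP; apply; rewrite -(card1 i).
  by apply: subset_leq_card; apply/fintype.subsetP => j _; rewrite inE; exact: all_i.
have /connectP[[|k s]] := edge_connected G i j.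
  by move=> _ /= ji'; rewrite ji' eqxx in ji.
rewrite /= => /andP[ik _] _; rewrite /deg (bigD1 k)//=.
by rewrite ltr_pwDl ?weight_edge ?ik// sumr_ge0// => l _; exact: weight_ge0.
Qed.

Lemma degr_gt0 i : 0 < deg G i `^ r.
Proof. by rewrite powR_gt0// deg_gt0. Qed.

Lemma degr_laplacian u i :
  deg G i `^ r * laplacian G r u i = \sum_j weight G i j * (u i - u j).
Proof. by rewrite /laplacian powRN mulrA divff ?mul1r// gt_eqF// degr_gt0. Qed.

Lemma opA_linear : exists a : V -> V -> R,
  forall u i, opA G r mu u i = \sum_j a i j * u j.
Proof.
exists (fun i j => deg G i `^ (- r) * ((i == j)%:R * deg G i - weight G i j) +
  (i == j)%:R * mu i) => u i.
have dirac c : \sum_j (i == j)%:R * c * u j = c * u i.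
  rewrite (bigD1 i)//= eqxx mul1r big1 ?addr0// => j ji.
  by rewrite eq_sym (negbTE ji) !mul0r.
under eq_bigr do rewrite mulrDl.
rewrite big_split/= dirac; congr (_ + _); rewrite /laplacian.
under [RHS]eq_bigr do rewrite -mulrA mulrBl.
rewrite -mulr_sumr sumrB dirac; congr (_ * _); rewrite /deg mulr_suml -sumrB.
by apply: eq_bigr => j _; rewrite mulrBr.
Qed.

Lemma opB_linear eps : exists a : V -> V -> R,
  forall u i, opB G r eps mu u i = \sum_j a i j * u j.
Proof.
have [a aE] := opA_linear.
exists (fun i j => a i j - (i == j)%:R * eps^-1) => u i.
rewrite /opB aE; under [RHS]eq_bigr do rewrite mulrBl.
rewrite sumrB; congr (_ - _); rewrite (bigD1 i)//= eqxx mul1r big1 ?addr0// => j ji.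
by rewrite eq_sym (negbTE ji) !mul0r.
Qed.

(** Discrete Green formula: the sum is averaged with its copy in which the ends of each edge are
    exchanged. *)
Lemma laplacian_form u v : \sum_i deg G i `^ r * (laplacian G r u i * v i) =
  2^-1 * \sum_i \sum_j weight G i j * ((u i - u j) * (v i - v j)).
Proof.
under eq_bigr do rewrite mulrA degr_laplacian mulr_suml.
set S := LHS.
have S' : S = \sum_i \sum_j weight G i j * (u j - u i) * v j.
  rewrite /S exchange_big/=; apply: eq_bigr => i _; apply: eq_bigr => j _.
  by rewrite weight_sym.
have -> : \sum_i \sum_j weight G i j * ((u i - u j) * (v i - v j)) = S + S.
  rewrite {2}S' /S -big_split/=; apply: eq_bigr => i _; rewrite -big_split/=.
  by apply: eq_bigr => j _; ring.
by field.
Qed.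

Lemma fidelity_form u v : \sum_i deg G i `^ r * (fidelity mu u i * v i) =
  \sum_i deg G i `^ r * (mu i * (u i * v i)).
Proof. by apply: eq_bigr => i _; rewrite /fidelity -mulrA. Qed.

Lemma opA_form u v : \sum_i deg G i `^ r * (opA G r mu u i * v i) =
  2^-1 * (\sum_i \sum_j weight G i j * ((u i - u j) * (v i - v j))) +
  \sum_i deg G i `^ r * (mu i * (u i * v i)).
Proof.
rewrite -laplacian_form -fidelity_form -big_split/=; apply: eq_bigr => i _.
by rewrite /opA /=; ring.
Qed.

Lemma opA_sym u v : \sum_i deg G i `^ r * (opA G r mu u i * v i) =
  \sum_i deg G i `^ r * (u i * opA G r mu v i).
Proof.
transitivity (\sum_i deg G i `^ r * (opA G r mu v i * u i)); last first.
  by apply: eq_bigr => i _; rewrite [u i * _]mulrC.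
rewrite !opA_form; congr (_ * _ + _); last by apply: eq_bigr => i _; ring.
by apply: eq_bigr => i _; apply: eq_bigr => j _; rewrite [X in _ * X]mulrC.
Qed.

(** Truncation is monotone, so across every edge the differences of [p] and of its positive part
    have the same sign. *)
Lemma opA_pos_part p : 0 <= \sum_i deg G i `^ r * (opA G r mu p i * Num.max (p i) 0).
Proof.
rewrite opA_form addr_ge0//.
  rewrite mulr_ge0// sumr_ge0// => i _; rewrite sumr_ge0// => j _.
  apply: mulr_ge0; first exact: weight_ge0.
  have [ij|ij] := leP (p i) (p j).
    by apply: mulr_le0; rewrite subr_le0// ge_max !le_max ij lexx !orbT.
  by apply: mulr_ge0; rewrite subr_ge0 ?(ltW ij)// ge_max !le_max (ltW ij) lexx !orbT.
apply: sumr_ge0 => i _; rewrite mulr_ge0 ?(ltW (degr_gt0 i))// mulr_ge0//.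
by case: (leP (p i) 0) => [_|/ltW p0]; [rewrite mulr0|rewrite mulr_ge0].
Qed.

Lemma opA_rayleigh : exists l, spectrum (opA G r mu) l /\
  forall z, l * inner G r z z <= inner G r (opA G r mu z) z.
Proof.
have [a aE] := opA_linear.
have i0 : V by move: hV; rewrite cardE; case: (enum V).
have [l [sl lP]] := rayleigh_min aE degr_gt0 opA_sym i0.
exists l; split=> // z; have := lP z.
have -> : \sum_i deg G i `^ r * z i ^+ 2 = inner G r z z.
  by apply: eq_bigr => i _; ring.
by congr (_ <= _); apply: eq_bigr => i _; rewrite mulrC.
Qed.

End graph_operators.

(** * Time intervals and Sobolev functions *)

Section time_interval.
Context (R : realType) (T : set R).
Notation mu := (@lebesgue_measure R).
Hypothesis hT : (exists2 T0 : R, 0 < T0 & T = `[0, T0]%classic) \/ T = `[0, +oo[%classic.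
Implicit Types (s t b : R).

Lemma time_ge0 t : T t -> 0 <= t.
Proof. by case: hT => [[T0 _ ->]|->]; rewrite /= in_itv/= => /andP[]. Qed.

Lemma time_le s t : 0 <= s -> s <= t -> T t -> T s.
Proof.
move=> s0 st; case: hT => [[T0 _ ->]|->]; rewrite /= !in_itv/= s0//=.
by move=> /andP[_]; exact: le_trans.
Qed.

Lemma time0 : T 0.
Proof. by case: hT => [[T0 /ltW T00 ->]|->]; rewrite /= in_itv/= lexx. Qed.

(** Countably many bounded intervals cover [T], so their exceptional null sets can be united. *)
Lemma time_exhaustion : exists b : nat -> R, [/\ forall n, 0 < b n, forall n, T (b n) &
  forall t, T t -> exists n, t <= b n].
Proof.
case: hT => [[T0 T00 TE]|TE].
  exists (fun=> T0); split=> //; first by move=> _; rewrite TE /= in_itv/= lexx ltW.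
  by move=> t; rewrite TE /= in_itv/= => /andP[_ tT]; exists 0%N.
exists (fun n => n.+1%:R); split=> [n|n|t _]; first by rewrite ltr0n.
  by rewrite TE /= in_itv/= ler0n.
by exists (Num.truncn t); exact/ltW/truncnS_gt.
Qed.

Lemma ae_time (P : R -> Prop) :
  (forall b, 0 < b -> T b -> {ae mu, forall t, 0 <= t <= b -> P t}) ->
  {ae mu, forall t, T t -> P t}.
Proof.
move=> Pb; have [b [b0 bT bE]] := time_exhaustion.
apply: lebesgue_aeS (lebesgue_ae_nat (fun n => Pb _ (b0 n) (bT n))) => t Pt Tt.
by have [n tn] := bE t Tt; apply: (Pt n); rewrite (time_ge0 Tt).
Qed.

Lemma ae_time_itv (P : R -> Prop) b : T b -> {ae mu, forall t, T t -> P t} ->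
  {ae mu, forall t, 0 <= t <= b -> P t}.
Proof.
by move=> Tb; apply: lebesgue_aeS => t Pt /andP[t0 tb]; apply/Pt/time_le/Tb.
Qed.

Lemma within_time (f : R -> R) :
  {within T, continuous f} <-> forall b, T b -> {within `[0, b], continuous f}.
Proof.
split=> [cf b Tb|cf].
  apply: continuous_subspaceW cf => t; rewrite /= in_itv/= => /andP[t0 tb].
  exact: time_le Tb.
case: hT => [[T0 T00 TE]|TE].
  by rewrite TE; apply: cf; rewrite TE /= in_itv/= lexx ltW.
apply/subspace_continuousP => c Tc; apply/cvgrPdist_lt => e e0.
have Tc1 : T (c + 1).
  by rewrite TE /= in_itv/= andbT addr_ge0// time_ge0.
have [|d d0 dP] := (within_continuous_itvP _ _ _).1 (cf _ Tc1) c _ e e0.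
  by rewrite time_ge0//= lerDl.
rewrite near_withinE; exists (Num.min d 1); first by rewrite /= lt_min d0 ltr01.
move=> t; rewrite /ball_/= lt_min distrC => /andP[td]; rewrite ltr_norml => /andP[_ t1] Tt.
rewrite distrC; apply: dP => //; rewrite time_ge0//=; lra.
Qed.

End time_interval.

(** * Sobolev functions of time as absolutely continuous functions *)

Section sobolev.
Context (R : realType) (V : finType).
Notation mu := (@lebesgue_measure R).
Implicit Types (u w W : R -> V -> R) (a b : R).

Lemma bounded_L2 a b (f : R -> R) C : integrable_on a b f ->
  {ae mu, forall t, a <= t <= b -> `|f t| <= C} -> L2 `]a, b[ f.
Proof.
move=> fi fC; have /integrableP[/measurable_EFinP mf _] := fi.
(* The bound holds only almost everywhere; truncation makes it hold everywhere. *)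
pose g t := Num.max (- C) (Num.min (f t) C).
have mg : measurable_fun `]a, b[ g.
  apply: measurable_maxr => //; apply: measurable_minr => //.
  by apply: measurable_funS mf => //; apply: subset_itv; rewrite bnd_simp.
exists g; last first.
  apply: lebesgue_aeS fC => t + /=; rewrite in_itv/= => fC /andP[/ltW at0 /ltW tb].
  have /ler_normlP[Cf fC'] : `|f t| <= C by apply: fC; rewrite at0.
  by rewrite /g (min_idPl fC') (max_idPr _)// lerNl.
split=> //; apply: (@measurable_bounded_integrable _ _ _ mu (fun t => g t ^+ 2)) => //.
- have fin : ((if (a%:E < b%:E)%E then (b%:E - a%:E)%E else 0%E) < +oo)%E.
    by case: ifP => // _; rewrite -EFinB ltry.
  apply: le_lt_trans fin; rewrite le_eqVlt; apply/orP; left; apply/eqP.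
  exact: lebesgue_measure_itv.
- exact: measurable_funX.
exists (`|C| ^+ 2); split; first by rewrite num_real.
move=> M CM t _; apply: le_trans (ltW CM); rewrite normrX.
apply: lerXn2r; rewrite ?nnegrE// /g ler_norml.
have := ler_norm C; have := ler_norm (- C); rewrite normrN => C1 C2.
by rewrite le_max ge_max ge_min lerN2 C1 C2 orbT.
Qed.

Lemma L2_integrable_on a b (f : R -> R) : L2 `]a, b[ f ->
  exists2 g, integrable_on a b g & {ae mu, forall t, a <= t <= b -> f t = g t}.
Proof.
move=> [g [mg gi] fg]; exists (g \_ `]a, b[).
  rewrite /integrable_on -restrict_EFin; apply/integrable_restrict => //=.
  rewrite setIidr; last by apply: subset_itv; rewrite bnd_simp.
  have oneI : mu.-integrable `]a, b[ (EFin \o (fun=> 1 : R)).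
    apply: (integrableS _ _ _ (integrable_on_cst a b 1)) => //.
    by apply: subset_itv; rewrite bnd_simp.
  (* [|g| <= 1 + g ^+ 2], and constants are integrable on a bounded interval. *)
  apply: le_integrable (integrableD _ oneI gi) => //; first exact/measurable_EFinP.
  move=> t _; rewrite /= lee_fin [X in _ <= X]ger0_norm ?addr_ge0 ?sqr_ge0//.
  have := sqr_ge0 (`|g t| - 1); rewrite sqrrB1 real_normK ?num_real//.
  by have := sqr_ge0 (g t); lra.
apply: lebesgue_aeS2 (lebesgue_ae_itvoo a b) fg => t tab fgt t_ab.
rewrite patchE mem_set//=; first by apply: fgt; rewrite /= in_itv/= tab.
by rewrite in_itv/= tab.
Qed.

Lemma H1_with_primitive a b u w W C :
  (forall i, primitive_on a b (u ^~ i) (W ^~ i)) ->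
  (forall i, {ae mu, forall t, a <= t <= b -> `|W t i| <= C}) ->
  {ae mu, forall t, a <= t <= b -> w t = W t} ->
  H1_with a b u w.
Proof.
(* [H1loc] ranges over both orders of the endpoints; for [b < a] the interval is empty. *)
move=> uW WC wW i; have [ab|ba] := leP a b; last first.
  have E : `]a, b[%classic = set0 :> set R by rewrite set_itv_ge// bnd_simp -leNgt ltW.
  have L20 (f : R -> R) : L2 `]a, b[ f.
    exists (fun=> 0); last by rewrite E; apply: lebesgue_aeW.
    by split; [exact: measurable_cst|rewrite E; exact: integrable_set0].
  split=> // phi _; rewrite /= E !Rintegral_set0 oppr0//.
have uW_ := uW i; have [Wi _] := uW_.
have cu := primitive_on_continuous uW_.
have wW' : {ae mu, forall t, a <= t <= b -> w t i = W t i}.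
  by apply: lebesgue_aeS wW => t /[apply] ->.
have wW'' : ae_eq mu `]a, b[%classic (W ^~ i) (w ^~ i).
  apply: lebesgue_aeS wW' => t + /=; rewrite in_itv/= => wt /andP[/ltW at0 /ltW tb].
  by rewrite wt// at0.
split.
- have := continuous_compact cu (@segment_compact _ a b).
  move=> /compact_bounded[M [_ Mu]].
  apply: (@bounded_L2 _ _ _ (M + 1)); first exact: integrable_on_continuous.
  by apply: lebesgue_aeW => t tab; apply: (Mu (M + 1)); [rewrite ltrDl|exists t => //=; rewrite in_itv].
- have [g mg gW] := bounded_L2 Wi (WC i); exists g => //.
  apply: lebesgue_aeS2 wW'' gW => t H1 H2 tab.
  by rewrite -H1// H2.
- apply: weak_derivative_ae wW'' (primitive_weak_derivative ab uW_).
  exact: lebesgue_aeW.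
Qed.

Variable T : set R.
Hypothesis hT : (exists2 T0 : R, 0 < T0 & T = `[0, T0]%classic) \/ T = `[0, +oo[%classic.

(** The passage from weak derivatives to the integral form; [W] is an integrable representative of
    [w] and is chosen separately for each [b]. *)
Lemma ddt_primitive u w b : C0 T u -> is_ddt T u w -> 0 < b -> T b -> exists W,
  (forall i, primitive_on 0 b (u ^~ i) (W ^~ i)) /\
  {ae mu, forall t, 0 <= t <= b -> w t = W t}.
Proof.
move=> cu uw b0 Tb.
have /choice[W WP] : forall i, exists Wi, primitive_on 0 b (u ^~ i) Wi /\
    {ae mu, forall t, 0 <= t <= b -> w t i = Wi t}.
  move=> i; have [_ /L2_integrable_on[Wi Wint wW] wd] := uw 0 b (time0 hT) Tb i.
  exists Wi; split=> //; apply: weak_derivative_primitive => //.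
    by have /(within_time hT) := cu i; apply.
  apply: weak_derivative_ae wd; first exact: lebesgue_aeW.
  apply: lebesgue_aeS wW => t + /=; rewrite in_itv/= => wt /andP[/ltW t0 /ltW tb].
  by rewrite wt// t0.
exists (fun t i => W i t); split; first by move=> i; case: (WP i).
apply: lebesgue_aeS (lebesgue_ae_fin (fun i => (WP i).2)) => t wW tb.
by apply/funext => i; rewrite wW.
Qed.

(** The neighbourhood inside [T] is recorded so that two-sided extremum arguments apply at these
    times. *)
Lemma ddt_ae_derive u w : C0 T u -> is_ddt T u w -> {ae mu, forall t, T t ->
  (exists2 d, 0 < d & forall x, `|x - t| < d -> T x) /\
  forall i, is_derive t (1 : R) (u ^~ i) (w t i)}.
Proof.
move=> cu uw; apply: ae_time => // b b0 Tb.
have [W [uW wW]] := ddt_primitive cu uw b0 Tb.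
have dW := lebesgue_ae_fin (fun i => primitive_on_ae_derive (uW i)).
apply: lebesgue_aeS2 (lebesgue_ae_itvoo 0 b) (lebesgue_aeI wW dW).
move=> t tb [wt dt] t0b; have /andP[t0 tb'] := tb t0b; split.
  exists (Num.min t (b - t)); first by rewrite lt_min t0 subr_gt0.
  move=> x; rewrite lt_min !ltr_norml => /andP[/andP[x1 _] /andP[_ x2]].
  by apply: (time_le hT) Tb; lra.
by move=> i; rewrite wt//; apply: dt; rewrite t0.
Qed.

Lemma ddt_ae_unique u w w' : C0 T u -> is_ddt T u w -> is_ddt T u w' ->
  {ae mu, forall t, T t -> w t = w' t}.
Proof.
move=> cu uw uw'.
apply: lebesgue_aeS2 (ddt_ae_derive cu uw) (ddt_ae_derive cu uw') => t D D' Tt.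
have [_ d] := D Tt; have [_ d'] := D' Tt.
by apply/funext => i; exact: is_derive1_unique (d i) (d' i).
Qed.

Lemma is_ddt_congr u v w : (forall t, T t -> u t = v t) -> is_ddt T u w -> is_ddt T v w.
Proof.
move=> uv uw a b Ta Tb i; have [u2 w2 wd] := uw a b Ta Tb i.
have uv' : ae_eq mu `]a, b[%classic (u ^~ i) (v ^~ i).
  apply: lebesgue_aeW => t /=; rewrite in_itv/= => /andP[/ltW at0 /ltW tb].
  by rewrite uv//; apply: (time_le hT) Tb => //; exact: le_trans (time_ge0 hT Ta) at0.
split=> //; last by apply: weak_derivative_ae uv' _ wd; exact: lebesgue_aeW.
have [g mg gu] := u2; exists g => //.
by apply: lebesgue_aeS2 uv' gu => t H1 H2 tab; rewrite -H1// H2.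
Qed.

End sobolev.

(** * The double-obstacle Allen--Cahn equation *)

Section allen_cahn.
Context (R : realType) (V : finType) (G : weighted_graph R V).
Notation mes := (@lebesgue_measure R).
Hypothesis hV : (1 < #|V|)%N.
Variables (r : R) (mu tf : V -> R) (eps : R) (T : set R).
Hypothesis hmu : forall i, 0 <= mu i.
Hypothesis htf : in01 tf.
Hypothesis heps : 0 < eps.
Hypothesis hT : (exists2 T0 : R, 0 < T0 & T = `[0, T0]%classic) \/ T = `[0, +oo[%classic.
Local Notation d i := (deg G i `^ r).
Local Notation sol := (solution G r eps mu tf T).
Local Notation ACE := (ace G r eps mu tf).
Local Notation A := (opA G r mu).
Local Notation B := (opB G r eps mu).

Definition source i : R := fidelity mu tf i - (2 * eps)^-1.

Definition field (u : V -> R) i := source i - B u i.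

Let eps_neq0 : eps != 0. Proof. by rewrite gt_eqF. Qed.

Lemma ace_field w u i : ACE w u i = eps * (w i - field u i).
Proof. by rewrite /ace /field /source /opB; field. Qed.

Lemma opBB u v i : B (u \- v) i = B u i - B v i.
Proof.
have [b bE] := opB_linear G r mu eps.
by rewrite !bE -sumrB; apply: eq_bigr => j _; rewrite /= mulrBr.
Qed.

Lemma field_bounds : exists L C : R, [/\ 0 <= L, 0 <= C,
  forall x y N, in01 x -> in01 y ->
    (forall j, `|x j - y j| <= N) -> forall i, `|field x i - field y i| <= L * N &
  forall x, in01 x -> forall i, `|field x i| <= C].
Proof.
have [b bE] := opB_linear G r mu eps.
pose L := \sum_i \sum_j `|b i j|.
have rowL i : \sum_j `|b i j| <= L.
  by rewrite /L [X in _ <= X](bigD1 i)//= lerDl sumr_ge0// => k _; rewrite sumr_ge0.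
have L0 : 0 <= L by rewrite sumr_ge0// => k _; rewrite sumr_ge0.
have BN z N : 0 <= N -> (forall j, `|z j| <= N) -> forall i, `|B z i| <= L * N.
  move=> N0 zN i; rewrite bE; apply: le_trans (ler_norm_sum _ _ _) _.
  apply: (@le_trans _ _ (\sum_j `|b i j| * N)).
    by apply: ler_sum => j _; rewrite normrM ler_wpM2l.
  by rewrite -mulr_suml ler_wpM2r.
exists L, (\sum_i `|source i| + L); split=> //.
- by rewrite addr_ge0// sumr_ge0.
- move=> x y N _ _ xyN i.
  have N0 : 0 <= N by apply: le_trans (xyN i).
  have -> : field x i - field y i = - B (x \- y) i by rewrite opBB /field; ring.
  by rewrite normrN; exact: BN.
- move=> x x01 i; apply: le_trans (ler_normB _ _) _; apply: lerD.
    by rewrite (bigD1 i)//= lerDl sumr_ge0.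
  rewrite -[L]mulr1; apply: BN => // j; have /andP[x0 x1] := x01 j.
  by rewrite ger0_norm.
Qed.

Lemma subdiff_vi (u b eta : V -> R) i : subdiff u b -> in01 eta -> 0 <= b i * (eta i - u i).
Proof.
move=> [u01 /(_ i)[b0 b1 b2]] eta01; have /andP[u0 u1] := u01 i.
have /andP[e0 e1] := eta01 i.
have [ui0|ui0] := eqVneq (u i) 0.
  by rewrite ui0 subr0 mulr_ge0// b0.
have [ui1|ui1] := eqVneq (u i) 1.
  by rewrite mulr_le0 ?b2// subr_le0 ui1.
by rewrite b1 ?mul0r// !lt_neqAle u0 u1 eq_sym ui0 ui1.
Qed.

Lemma subdiff_monotone (u v b c : V -> R) i : subdiff u b -> subdiff v c ->
  (u i - v i) * (b i - c i) <= 0.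
Proof.
move=> ub vc; have [u01 _] := ub; have [v01 _] := vc.
have := subdiff_vi i ub v01; have := subdiff_vi i vc u01; lra.
Qed.

Lemma vi_subdiff (u b : V -> R) : in01 u ->
  (forall eta, in01 eta -> 0 <= inner G r b (eta \- u)) -> subdiff u b.
Proof.
move=> u01 H; have key i e : 0 <= e <= 1 -> 0 <= b i * (e - u i).
  (* Changing a single vertex localises the inequality; the values 0 and 1 of [e] then give the
     signs of [b i]. *)
  move=> e01; pose eta j := if j == i then e else u j.
  have eta01 : in01 eta by move=> j; rewrite /eta; case: ifP.
  have := H eta eta01; rewrite /inner (bigD1 i)//= big1 => [|j ji].
    by rewrite addr0 pmulr_lge0 ?degr_gt0// /eta eqxx.
  by rewrite /eta (negbTE ji) subrr mulr0 mul0r.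
split=> // i; have k0 := key i 0; have k1 := key i 1; split=> [ui|/andP[u0 u1]|ui].
- by have := k1; rewrite ui subr0 mulr1; apply; rewrite ler01 lexx.
- apply/eqP; rewrite eq_le; apply/andP; split.
    have := k0; rewrite lexx ler01 => /(_ isT); rewrite sub0r mulrN oppr_ge0.
    by rewrite pmulr_lle0.
  have := k1; rewrite lexx ler01 => /(_ isT).
  by rewrite pmulr_lge0// subr_gt0.
- have := k0; rewrite ui sub0r mulrN1 oppr_ge0; apply; rewrite ler01 lexx//.
Qed.

Lemma existence u0 : in01 u0 -> exists u beta, sol u beta /\ u 0 = u0.
Proof.
move=> u01; have [L [C [L0 C0 gL gC]]] := field_bounds.
have [u [u_0 uin uE]] := projected_flow L0 C0 gL gC u01.
have D0 : 0 <= L * C by rewrite mulr_ge0.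
pose W t i := flow_speed field u t i.
have uW b i : primitive_on 0 b (u ^~ i) (W ^~ i).
  exact: (flow_primitive L0 C0 D0 gL gC uin uE b i).
have WC i t : 0 <= t -> `|W t i| <= C by move=> t0; exact: (flow_speed_le C0 gC uin).
have ddt : is_ddt T u W.
  move=> a b Ta Tb; apply: (@H1_with_primitive _ _ a b u W W C).
  - by move=> i; apply: primitive_onS (uW b i) => //; exact: time_ge0 hT _ Ta.
  - by move=> i; apply: lebesgue_aeW => t /andP[at0 _]; apply/WC/le_trans/at0/(time_ge0 hT).
  - exact: lebesgue_aeW.
exists u, (fun t => ACE (W t) (u t)); split=> //; split.
  split; first by move=> t Tt; apply/uin/(time_ge0 hT).
    by move=> a b Ta Tb; exists W; exact: ddt.
  by move=> i; apply/(within_time hT) => b _; exact: primitive_on_continuous (uW b i).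
exists W => //; apply: (ae_time hT) => b b0 Tb.
have := lebesgue_ae_fin (fun i => flow_complementarity L0 C0 D0 gL gC uin uE b i).
apply: lebesgue_aeS => t cmpl tb; split=> //.
have t0 : 0 <= t by case/andP: tb.
split=> [|i]; first exact: uin.
have [c0 c1 c2] := cmpl i tb; rewrite ace_field /W; split=> ui.
- by have [g0 ->] := c0 ui; rewrite sub0r mulr_ge0 ?oppr_ge0// ltW.
- by rewrite c1// subrr mulr0.
- by have [g0 ->] := c2 ui; rewrite sub0r mulr_ge0_le0 ?oppr_le0// ltW.
Qed.

Lemma comparison (u beta v gamma du dv : R -> V -> R) :
  regular01 T u -> regular01 T v -> is_ddt T u du -> is_ddt T v dv ->
  {ae mes, forall t, T t ->
     (forall i, beta t i <= ACE (du t) (u t) i) /\ subdiff (u t) (beta t)} ->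
  {ae mes, forall t, T t ->
     (forall i, ACE (dv t) (v t) i <= gamma t i) /\ subdiff (v t) (gamma t)} ->
  (forall i, v 0 i <= u 0 i) -> forall t, T t -> forall i, v t i <= u t i.
Proof.
move=> [u01 _ cu] [v01 _ cv] udu vdv aeu aev uv0 t Tt i.
have [tle0|t0] := leP t 0.
  by have -> : t = 0 by apply/eqP; rewrite eq_le tle0 (time_ge0 hT).
have [W [uW wW]] := ddt_primitive hT cu udu t0 Tt.
have [Z [vZ zZ]] := ddt_primitive hT cv vdv t0 Tt.
pose p s j := v s j - u s j.
have pP j : primitive_on 0 t (p ^~ j) (fun s => Z s j - W s j).
  exact: primitive_onB.
pose F s := \sum_j d j * Num.max (p s j) 0 ^+ 2.
have FP := primitive_on_sum (fun j => primitive_onZ (d j) (primitive_on_pos_sqr (pP j))).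
have Fle : {ae mes, forall s, 0 <= s <= t ->
    \sum_j d j * (2 * Num.max (p s j) 0 * (Z s j - W s j)) <= 2 / eps * F s}.
  apply: lebesgue_aeS2 (lebesgue_aeI wW zZ) (lebesgue_aeI (ae_time_itv hT Tt aeu) (ae_time_itv hT Tt aev)).
  move=> s [dW dZ] [Hu Hv] st; have [bu su] := Hu st; have [gv sv] := Hv st.
  have Apos := opA_pos_part G hV r hmu (p s).
  have step j : d j * (2 * Num.max (p s j) 0 * (Z s j - W s j)) <=
      - 2 * (d j * (A (p s) j * Num.max (p s j) 0)) +
      2 / eps * (d j * Num.max (p s j) 0 ^+ 2).
    rewrite -dW// -dZ//.
    have := bu j; have := gv j; rewrite !ace_field => g1 b1.
    (* Where [v <= u] the truncation annihilates both sides; where [v > u], monotonicity of the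
       subdifferential gives [gamma <= beta]. *)
    have [pj0|pj0] := leP (p s j) 0; first by rewrite expr0n/= !(mulr0, mul0r) addr0.
    have mono : (v s j - u s j) * (gamma s j - beta s j) <= 0 by exact: subdiff_monotone.
    have gb : gamma s j - beta s j <= 0 by rewrite -(pmulr_rle0 _ pj0).
    have zw : eps * (dv s j - du s j) <= eps * (field (v s) j - field (u s) j) by lra.
    rewrite ler_pM2l// in zw.
    have fB : field (v s) j - field (u s) j = - A (p s) j + p s j / eps.
      have := opBB (v s) (u s) j; rewrite /field {1}/opB -/(p s) => E.
      have -> : source j - B (v s) j - (source j - B (u s) j) = - (B (v s) j - B (u s) j) by ring.
      by rewrite -E; rewrite /p /=; ring.
    rewrite fB in zw.
    have dj := degr_gt0 G hV r j.
    have -> : - 2 * (d j * (A (p s) j * p s j)) + 2 / eps * (d j * p s j ^+ 2) =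
       d j * (2 * p s j * (- A (p s) j + p s j / eps)) by ring.
    by rewrite ler_pM2l// ler_pM2l// mulr_gt0.
  apply: le_trans (ler_sum _ (fun j _ => step j)) _.
  by rewrite big_split/= -!mulr_sumr -/(F s); lra.
have := gronwall (ltW t0) FP Fle.
have -> : \sum_j d j * Num.max (p 0 j) 0 ^+ 2 = 0.
  rewrite big1// => j _; rewrite (max_idPr _) ?expr0n ?mulr0//.
  by rewrite subr_le0.
rewrite mulr0 => Ft.
have term0 j : 0 <= d j * Num.max (p t j) 0 ^+ 2.
  by rewrite mulr_ge0 ?sqr_ge0// ltW// degr_gt0.
have : d i * Num.max (p t i) 0 ^+ 2 <= 0.
  by apply: le_trans Ft; rewrite [X in _ <= X](bigD1 i)//= lerDl sumr_ge0.
rewrite pmulr_rle0 ?degr_gt0// -[v t i <= _]subr_le0 -/(p t i).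
by case: (leP (p t i) 0) => // pi0; rewrite leNgt exprn_gt0.
Qed.

Lemma uniqueness (u beta v gamma : R -> V -> R) : sol u beta -> sol v gamma ->
  u 0 = v 0 -> (forall t, T t -> u t = v t) /\
  {ae mes, forall t, T t -> beta t = gamma t}.
Proof.
move=> [ru [w uw aeu]] [rv [z vz aev]] uv0.
have le_sol (x b y c : R -> V -> R) wx wy : regular01 T x -> regular01 T y ->
    is_ddt T x wx -> is_ddt T y wy ->
    {ae mes, forall t, T t -> ACE (wx t) (x t) = b t /\ subdiff (x t) (b t)} ->
    {ae mes, forall t, T t -> ACE (wy t) (y t) = c t /\ subdiff (y t) (c t)} ->
    x 0 = y 0 -> forall t, T t -> forall i, y t i <= x t i.
  move=> rx ry dx dy aex aey xy; apply: (@comparison x b y c wx wy) => //.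
  - by apply: lebesgue_aeS aex => t H /H[-> sx]; split.
  - by apply: lebesgue_aeS aey => t H /H[-> sx]; split.
  - by move=> i; rewrite xy.
have uv t : T t -> u t = v t.
  move=> Tt; apply/funext => i; apply/eqP; rewrite eq_le; apply/andP; split.
    exact: (le_sol v gamma u beta z w).
  exact: (le_sol u beta v gamma w z).
split=> //; have [_ _ cu] := ru; have [_ _ cv] := rv.
have vw := ddt_ae_unique hT cv vz (is_ddt_congr hT uv uw).
apply: lebesgue_aeS2 vw (lebesgue_aeI aeu aev) => t zw [Hu Hv] Tt.
have [<- _] := Hu Tt; have [<- _] := Hv Tt.
by rewrite zw// uv.
Qed.

(* At almost every time where [u i] is 0 or 1, this value is an extremum of
   [u i], so the derivative vanishes there and [beta] is given by the equation;
   the sign of the Laplacian at an extremum then yields the bound on [beta]. *)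
Lemma solution_structure (u beta : R -> V -> R) : sol u beta -> exists w,
  is_ddt T u w /\ {ae mes, forall t, T t ->
    [/\ ACE (w t) (u t) = beta t, subdiff (u t) (beta t) &
     forall i, (w t i = field (u t) i \/ w t i = 0) /\ - 2^-1 <= beta t i <= 2^-1]}.
Proof.
move=> [[u01 _ cu] [w uw aeu]]; exists w; split=> //.
apply: lebesgue_aeS2 aeu (ddt_ae_derive hT cu uw) => t Hu Hd Tt.
have [E s] := Hu Tt; have [[e e0 eT] du] := Hd Tt; split=> // i.
have Ei : eps * (w t i - field (u t) i) = beta t i by rewrite -ace_field E.
have [_ /(_ i)[s0 s1 s2]] := s; have /andP[ui0 ui1] := u01 t Tt i.
have half0 : 0 < 2^-1 :> R by rewrite invr_gt0.
have lapl : deg G i `^ (- r) > 0 by rewrite powR_gt0// deg_gt0.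
have eE : eps * field (u t) i = eps * (mu i * tf i) - 2^-1 - eps * A (u t) i + u t i.
  by rewrite /field /source /opB /fidelity; field.
have /andP[f0 f1] := htf i.
have [uz|unz] := eqVneq (u t i) 0.
  have w0 : w t i = 0.
    apply: is_derive1_min e0 _ (du i) => x xt; rewrite uz.
    by case/andP: (u01 x (eT x xt) i).
  split; first by right.
  have b0 := s0 uz; apply/andP; split.
    by apply: le_trans b0; rewrite oppr_le0 ltW.
  rewrite -Ei w0 sub0r mulrN eE uz.
  have A0 : A (u t) i <= 0.
    rewrite /opA /= /fidelity uz mulr0 addr0 /laplacian uz mulr_ge0_le0 ?(ltW lapl)//.
    rewrite sumr_le0// => j _; rewrite mulr_ge0_le0 ?weight_ge0// sub0r oppr_le0.
    by case/andP: (u01 t Tt j).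
  have : eps * A (u t) i <= 0 by rewrite mulr_ge0_le0// ltW.
  have : 0 <= eps * (mu i * tf i) by rewrite mulr_ge0 ?(ltW heps)// mulr_ge0.
  lra.
have [uo|uno] := eqVneq (u t i) 1.
  have w0 : w t i = 0.
    apply: is_derive1_max e0 _ (du i) => x xt; rewrite uo.
    by case/andP: (u01 x (eT x xt) i).
  split; first by right.
  have b0 := s2 uo; apply/andP; split; last by rewrite (le_trans b0)// ltW.
  rewrite -Ei w0 sub0r mulrN eE uo.
  (* At the value 1 the equation reads [beta = eps * (A u - mu tf) - 2^-1], and the lower bound
     follows from [A u >= mu >= mu tf] at this vertex. *)
  have A0 : mu i <= A (u t) i.
    rewrite /opA /= /fidelity uo mulr1 lerDr /laplacian uo mulr_ge0 ?(ltW lapl)//.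
    rewrite sumr_ge0// => j _; rewrite mulr_ge0 ?weight_ge0// subr_ge0.
    by case/andP: (u01 t Tt j).
  have : eps * mu i <= eps * A (u t) i by rewrite ler_pM2l.
  have : eps * (mu i * tf i) <= eps * mu i by rewrite ler_pM2l// ler_piMr.
  lra.
have b0 : beta t i = 0 by apply: s1; rewrite !lt_neqAle ui0 ui1 eq_sym unz uno.
split; last by rewrite b0 oppr_le0 ltW.
left; apply/eqP; rewrite -subr_eq0.
by move: Ei; rewrite b0 => /eqP; rewrite mulf_eq0 (negbTE eps_neq0).
Qed.

Lemma weak_form (u du beta : R -> V -> R) : regular01 T u -> is_ddt T u du ->
  {ae mes, forall t, T t -> beta t = ACE (du t) (u t)} ->
  (sol u beta <->
   {ae mes, forall t, T t -> forall eta : V -> R, in01 eta ->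
      0 <= inner G r (ACE (du t) (u t)) (eta \- u t)}).
Proof.
move=> ru udu bE; have [u01 _ cu] := ru; split=> [[_ [w uw aeu]]|vi].
  apply: lebesgue_aeS2 bE aeu => t bt Hu Tt eta eta01.
  have [_ s] := Hu Tt; rewrite -bt// sumr_ge0// => i _.
  by rewrite mulr_ge0 ?(ltW (degr_gt0 G hV r i))// (subdiff_vi i s eta01).
split=> //; exists du => //; apply: lebesgue_aeS2 bE vi => t bt Ht Tt.
rewrite bt//; split=> //; apply: vi_subdiff; [exact: u01|exact: Ht].
Qed.

Lemma lipschitz_regularity (u beta : R -> V -> R) : sol u beta ->
  exists L : R, forall s t, T s -> T t -> normV G r (u t \- u s) <= L * `|t - s|.
Proof.
move=> su; have [w [uw aew]] := solution_structure su.
have [[u01 _ cu] _] := su; have [L [C [L0 C0 _ gC]]] := field_bounds.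
have lip i s t : T s -> T t -> s <= t -> `|u t i - u s i| <= C * (t - s).
  move=> Ts Tt st; have s0 := time_ge0 hT Ts.
  have [tle0|t0] := leP t 0.
    have t0 : t = 0 by apply/eqP; rewrite eq_le tle0 (le_trans s0).
    have -> : s = 0 by apply/eqP; rewrite eq_le s0 -t0 st.
    by rewrite t0 !subrr normr0 mulr0.
  have [W [uW wW]] := ddt_primitive hT cu uw t0 Tt.
  have [Wi E] := uW i; rewrite E//.
  have Wst : integrable_on s t (W ^~ i) by exact: integrable_onS Wi.
  apply: le_trans (normr_integral_on Wst) _; rewrite -integral_on_cst//.
  apply: le_integral_on; [exact: integrable_on_norm|exact: integrable_on_cst|].
  apply: lebesgue_aeS2 wW (ae_time_itv hT Tt aew) => x xW H /andP[sx xt].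
  have x0t : 0 <= x <= t by rewrite (le_trans s0).
  have [_ _ /(_ i)[wi _]] := H x0t; rewrite -xW//.
  case: wi => ->; last by rewrite normr0.
  by apply/gC/u01/(time_le hT _ xt Tt)/le_trans/sx.
(* The norm of the constant function [C], where [C] bounds the speed of every coordinate. *)
exists (Num.sqrt (\sum_i d i * C ^+ 2)) => s t Ts Tt.
have lip' i : `|u t i - u s i| <= C * `|t - s|.
  have [st|/ltW ts] := leP s t.
    by rewrite [X in _ * X]ger0_norm ?subr_ge0//; exact: lip.
  by rewrite distrC (distrC t) [X in _ * X]ger0_norm ?subr_ge0//; exact: lip.
rewrite /normV -[X in _ * X]normr_id -sqrtr_sqr -sqrtrM; last first.
  by rewrite sumr_ge0// => i _; rewrite mulr_ge0 ?sqr_ge0// ltW// degr_gt0.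
apply: ler_wsqrtr; rewrite mulr_suml; apply: ler_sum => i _.
rewrite -[leRHS]mulrA -exprMn [leLHS]mulrC ler_wpM2l ?(ltW (degr_gt0 G hV r i))//=.
rewrite -expr2 -real_normK ?num_real//; apply: lerXn2r; rewrite ?nnegrE//.
by rewrite mulr_ge0.
Qed.

Lemma well_posedness (u beta v gamma : R -> V -> R) (xi : R) :
  sol u beta -> sol v gamma ->
  (forall l, spectrum A l -> xi <= l) ->
  forall t, T t -> normV G r (u t \- v t) <=
    expR (- (xi * t)) * expR (t / eps) * normV G r (u 0 \- v 0).
Proof.
move=> [[_ _ cu] [w uw aeu]] [[_ _ cv] [z vz aev]] xiP t Tt.
have [tle0|t0] := leP t 0.
  have -> : t = 0 by apply/eqP; rewrite eq_le tle0 (time_ge0 hT).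
  by rewrite mulr0 mul0r oppr0 expR0 !mul1r.
have [W [uW wW]] := ddt_primitive hT cu uw t0 Tt.
have [Z [vZ zZ]] := ddt_primitive hT cv vz t0 Tt.
pose p s j := u s j - v s j.
have pP j : primitive_on 0 t (p ^~ j) (fun s => W s j - Z s j) by exact: primitive_onB.
have FP := primitive_on_sum (fun j => primitive_onZ (d j) (primitive_on_sqr (pP j))).
pose F s := \sum_j d j * p s j ^+ 2.
have FE s : F s = inner G r (p s) (p s) by apply: eq_bigr => j _; ring.
have Fle : {ae mes, forall s, 0 <= s <= t ->
    \sum_j d j * (2 * p s j * (W s j - Z s j)) <= 2 * (eps^-1 - xi) * F s}.
  apply: lebesgue_aeS2 (lebesgue_aeI wW zZ) (lebesgue_aeI (ae_time_itv hT Tt aeu) (ae_time_itv hT Tt aev)).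
  move=> s [dW dZ] [Hu Hv] st; have [Eu su] := Hu st; have [Ev sv] := Hv st.
  have [l [sl lP]] := opA_rayleigh G hV r mu.
  have xiF : xi * F s <= \sum_j d j * (A (p s) j * p s j).
    have -> : \sum_j d j * (A (p s) j * p s j) = inner G r (A (p s)) (p s).
      by apply: eq_bigr => j _; rewrite mulrC.
    rewrite FE; apply: le_trans (lP _); apply: ler_wpM2r; last exact: xiP.
    by rewrite -FE sumr_ge0// => j _; rewrite mulr_ge0 ?sqr_ge0// ltW// degr_gt0.
  have step j : d j * (2 * p s j * (W s j - Z s j)) <=
      - 2 * (d j * (A (p s) j * p s j)) + 2 / eps * (d j * p s j ^+ 2).
    rewrite -dW// -dZ//.
    have Eu' : eps * (w s j - field (u s) j) = beta s j by rewrite -ace_field Eu.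
    have Ev' : eps * (z s j - field (v s) j) = gamma s j by rewrite -ace_field Ev.
    have mono : p s j * (beta s j - gamma s j) <= 0 by exact: subdiff_monotone.
    have fB : field (u s) j - field (v s) j = - A (p s) j + p s j / eps.
      have := opBB (u s) (v s) j; rewrite /field {1}/opB -/(p s) => E.
      have -> : source j - B (u s) j - (source j - B (v s) j) = - (B (u s) j - B (v s) j) by ring.
      by rewrite -E; rewrite /p /=; ring.
    have wz : w s j - z s j = - A (p s) j + p s j / eps + (beta s j - gamma s j) / eps.
      by rewrite -fB -Eu' -Ev'; field.
    have -> : - 2 * (d j * (A (p s) j * p s j)) + 2 / eps * (d j * p s j ^+ 2) =
       d j * (2 * p s j * (- A (p s) j + p s j / eps)) by ring.
    rewrite wz ler_pM2l ?degr_gt0// -mulrA -[X in _ <= X]mulrA ler_pM2l//.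
    rewrite mulrDr gerDl mulrA mulr_le0_ge0// invr_ge0 ltW//.
  apply: le_trans (ler_sum _ (fun j _ => step j)) _.
  by rewrite big_split/= -!mulr_sumr -/(F s); lra.
have := gronwall (ltW t0) FP Fle; rewrite subr0 -/(F t) -/(F 0) !FE => H.
rewrite /normV -expRD; apply: le_trans (ler_wsqrtr H) _.
have -> : expR (2 * (eps^-1 - xi) * t) = expR (- (xi * t) + t / eps) ^+ 2.
  by rewrite expr2 -expRD; congr expR; ring.
rewrite sqrtrM ?sqr_ge0// sqrtr_sqr ger0_norm ?expR_ge0//.
Qed.

Definition energy (u : V -> R) : R :=
  2^-1 * grad_sqnorm G u + eps^-1 * (\sum_i 2^-1 * u i * (1 - u i) * d i) +
  2^-1 * inner G r (u \- tf) (fidelity mu (u \- tf)).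

Lemma GL_energy u : in01 u -> GL G r eps mu tf u = (energy u)%:E.
Proof.
move=> u01; rewrite /GL /energy !EFinD; congr (_ + _ + _)%E.
rewrite EFinM; congr (_ * _)%E; rewrite -sumEFin; apply: eq_bigr => i _.
by rewrite /doubleobstacle u01 -EFinM.
Qed.

(** The vector [field] is minus the gradient of [energy] for the inner product [inner]; the energy
    is quadratic, so the rule for squares suffices. *)
Lemma energy_primitive b (u W : R -> V -> R) :
  (forall i, primitive_on 0 b (u ^~ i) (W ^~ i)) ->
  primitive_on 0 b (fun t => energy (u t))
    (fun t => - \sum_i d i * (field (u t) i * W t i)).
Proof.
move=> uW.
have P1 := primitive_onZ 2^-1 (primitive_onZ 2^-1 (primitive_on_sum (fun i =>
  primitive_on_sum (fun j => primitive_onZ (weight G i j)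
    (primitive_on_sqr (primitive_onB (uW j) (uW i))))))).
have P2 := primitive_onZ eps^-1 (primitive_on_sum (fun i => primitive_onZ (2^-1 * d i)
  (primitive_onB (uW i) (primitive_on_sqr (uW i))))).
have P3 := primitive_onZ 2^-1 (primitive_on_sum (fun i => primitive_onZ (d i * mu i)
  (primitive_on_sqr (primitive_onB (uW i) (primitive_on_cst 0 b (tf i)))))).
have := primitive_onD (primitive_onD P1 P2) P3.
congr primitive_on; apply/funext => t.
  rewrite /energy /grad_sqnorm /inner; congr (_ + _ * _ + _ * _).
    by apply: eq_bigr => i _; ring.
  by apply: eq_bigr => i _; rewrite /fidelity /=; ring.
have -> : 2^-1 * (2^-1 * \sum_i \sum_j weight G i j *
    (2 * (u t j - u t i) * (W t j - W t i))) =
    \sum_i d i * (laplacian G r (u t) i * W t i).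
  rewrite (laplacian_form G hV); congr (_ * _); rewrite mulr_sumr; apply: eq_bigr => i _.
  by rewrite mulr_sumr; apply: eq_bigr => j _; field.
rewrite !mulr_sumr -!big_split -sumrN/=; apply: eq_bigr => i _.
by rewrite /field /source /opB /opA /fidelity /=; field.
Qed.

Lemma gradient_flow (u beta : R -> V -> R) : sol u beta ->
  forall s t, T s -> T t -> s <= t ->
    (GL G r eps mu tf (u t) <= GL G r eps mu tf (u s))%E.
Proof.
move=> su s t Ts Tt st; have [w [uw aew]] := solution_structure su.
have [[u01 _ cu] _] := su.
have s0 := time_ge0 hT Ts.
rewrite !GL_energy; [|exact: u01|exact: u01]; rewrite lee_fin.
have [tle0|t0] := leP t 0.
  have t0 : t = 0 by apply/eqP; rewrite eq_le tle0 (le_trans s0).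
  by have -> : s = t by apply/eqP; rewrite eq_le st t0 s0.
have [W [uW wW]] := ddt_primitive hT cu uw t0 Tt.
apply: (primitive_on_le st (primitive_onS s0 (lexx t) (energy_primitive uW))).
apply: lebesgue_aeS2 wW (ae_time_itv hT Tt aew) => x xW H /andP[sx xt].
have x0t : 0 <= x <= t by rewrite (le_trans s0).
have [_ _ Hi] := H x0t; rewrite oppr_le0 sumr_ge0// => i _.
rewrite mulr_ge0 ?(ltW (degr_gt0 G hV r i))// -xW//.
have [[->|->] _] := Hi i; last by rewrite mulr0.
by rewrite -expr2 sqr_ge0.
Qed.

End allen_cahn.

(** * The explicit form *)

Section exp_op_calculus.
Context (R : realType) (V : finType).
Notation mes := (@lebesgue_measure R).
Variables (F : (V -> R) -> V -> R) (m : V -> V -> R).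
Hypothesis FE : forall u i, F u i = \sum_j m i j * u j.

Lemma primitive_exp_op a b k d (y z : R -> V -> R) i :
  (forall j, primitive_on a b (y ^~ j) (z ^~ j)) ->
  primitive_on a b (fun s => exp_op F (k * s + d) (y s) i)
    (fun s => exp_op F (k * s + d) (z s) i + k * exp_op F (k * s + d) (F (y s)) i).
Proof.
move=> yz.
have C j : primitive_on a b (fun s => exp_op F (k * s + d) (unit_vec R j) i)
    (fun s => k * exp_op F (k * s + d) (F (unit_vec R j)) i).
  apply: primitive_on_C1 => [s|s]; first exact: is_derive_exp_op_affine FE _ _ _ _ _.
  apply: cvgM; first exact: cvg_cst.
  exact: is_derive1_continuous (is_derive_exp_op_affine FE _ _ _ _ _).
have := primitive_on_sum (fun j => primitive_onM (yz j) (C j)).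
congr primitive_on; apply/funext => s; first by rewrite (exp_op_unit FE).
rewrite (exp_op_unit FE _ (z s)) (exp_op_unitF FE) mulr_sumr -big_split/=.
by apply: eq_bigr => j _; ring.
Qed.

Lemma integrable_exp_op a b k d (h : R -> V -> R) i :
  (forall j, integrable_on a b (h ^~ j)) ->
  integrable_on a b (fun s => exp_op F (k * s + d) (h s) i).
Proof.
move=> hi; rewrite (_ : (fun s => _) =
    fun s => \sum_j exp_op F (k * s + d) (unit_vec R j) i * h s j); last first.
  by apply/funext => s; rewrite (exp_op_unit FE); apply: eq_bigr => j _; rewrite mulrC.
apply: integrable_on_sum => j; apply: integrable_onM; last exact: hi.
apply: continuous_subspaceT => s.
exact: is_derive1_continuous (is_derive_exp_op_affine FE _ _ _ _ _).
Qed.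

Lemma exp_op_integral a b c (h : R -> V -> R) i :
  (forall j, integrable_on a b (h ^~ j)) ->
  exp_op F c (fun j => \int[mes]_(s in `[a, b]) h s j) i =
  \int[mes]_(s in `[a, b]) exp_op F c (h s) i.
Proof.
move=> hi; rewrite (exp_op_unit FE).
under [RHS]eq_Rintegral do rewrite (exp_op_unit FE).
have mulI j : \int[mes]_(s in `[a, b]) h s j * exp_op F c (unit_vec R j) i =
    \int[mes]_(s in `[a, b]) (exp_op F c (unit_vec R j) i * h s j).
  by rewrite integral_onZ// mulrC.
rewrite (eq_bigr _ (fun j _ => mulI j)) -integral_on_sum => [|j]; last exact: integrable_onZ.
by apply: eq_Rintegral => s _; apply: eq_bigr => j _; rewrite mulrC.
Qed.

Lemma lin_integral a b (h : R -> V -> R) i :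
  (forall j, integrable_on a b (h ^~ j)) ->
  F (fun j => \int[mes]_(s in `[a, b]) h s j) i = \int[mes]_(s in `[a, b]) F (h s) i.
Proof.
move=> hi; rewrite FE; under [RHS]eq_Rintegral do rewrite FE.
rewrite integral_on_sum => [|j]; last exact: integrable_onZ.
by apply: eq_bigr => j _; rewrite integral_onZ.
Qed.

(** Applied to the integral, [F] gives the integral of the derivative of [exp_op F (s - t) c] in
    [s], which is [c - exp_op F (- t) c]; injectivity then identifies the inverse image. The
    explicit formula is thereby freed of the inverse. *)
Lemma inv_op_integral t c i : (forall u, F u = (fun=> 0) -> u = (fun=> 0)) -> 0 <= t ->
  inv_op F (c \- exp_op F (- t) c) i = \int[mes]_(s in `[0, t]) exp_op F (s - t) c i.
Proof.
move=> inj t0.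
pose I j := \int[mes]_(s in `[0, t]) exp_op F (s - t) c j.
have Ei j : integrable_on 0 t (fun s => exp_op F (s - t) c j).
  have := @integrable_exp_op 0 t 1 (- t) (fun=> c) j (fun k => integrable_on_cst 0 t (c k)).
  by under eq_fun do rewrite mul1r.
have -> : c \- exp_op F (- t) c = F I.
  apply/funext => j; rewrite lin_integral//.
  have [_ /(_ 0 t (lexx 0) t0 (lexx t))] := @primitive_exp_op 0 t 1 (- t) (fun=> c) (fun=> (fun=> 0)) j
    (fun k => primitive_on_cst 0 t (c k)).
  rewrite mulr0 add0r mul1r subrr exp_op0 => E; rewrite /= E.
  apply: eq_Rintegral => s _; rewrite !mul1r (exp_op_comm FE).
  by rewrite [X in X + _](exp_op_unit FE) big1 ?add0r// => k _; rewrite mul0r.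
rewrite /inv_op pinvKV ?in_setT// => u v _ _ uv.
have FB : F (u \- v) = (fun=> 0).
  apply/funext => j; rewrite FE; have := congr1 (fun f => f j) uv; rewrite !FE => /eqP.
  by rewrite -subr_eq0 -sumrB => /eqP E; rewrite -[RHS]E; apply: eq_bigr => k _; rewrite /= mulrBr.
apply/funext => j; apply/eqP; rewrite -subr_eq0; apply/eqP.
exact: (congr1 (fun f => f j) (inj _ FB)).
Qed.

End exp_op_calculus.

Section explicit_form.
Context (R : realType) (V : finType) (G : weighted_graph R V).
Notation mes := (@lebesgue_measure R).
Hypothesis hV : (1 < #|V|)%N.
Variables (r : R) (mu tf : V -> R) (eps : R) (T : set R).
Hypothesis hmu : forall i, 0 <= mu i.
Hypothesis htf : in01 tf.
Hypothesis heps : 0 < eps.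
Hypothesis hT : (exists2 T0 : R, 0 < T0 & T = `[0, T0]%classic) \/ T = `[0, +oo[%classic.
Hypothesis hsp : ~ spectrum (opA G r mu) eps^-1.
Local Notation sol := (solution G r eps mu tf T).
Local Notation ACE := (ace G r eps mu tf).
Local Notation B := (opB G r eps mu).
Local Notation src := (source mu tf eps).
Local Notation fld := (field G r mu tf eps).
Local Notation E c := (exp_op B c).

Lemma opB_ker u : B u = (fun=> 0) -> u = (fun=> 0).
Proof.
move=> Bu; apply: contrapT => u0; apply: hsp; exists u; split=> //.
apply/funext => i; apply/eqP; rewrite -subr_eq0; apply/eqP.
exact: (congr1 (fun f => f i) Bu).
Qed.

(** Once the inverse is an integral, the constant source and [beta] share one exponential; [g]
    supplies the integrability needed to add the two integrals. *)
Lemma duhamelE u0 (beta g : R -> V -> R) t i : 0 <= t ->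
  integrable_on 0 t (g ^~ i) ->
  {ae mes, forall s, 0 <= s <= t -> duhamel_integrand B beta t s i = g s i} ->
  duhamel G r eps mu tf u0 beta t i = E (- t) u0 i +
    \int[mes]_(s in `[0, t]) E (s - t) (fun j => eps^-1 * beta s j + 1 * src j) i.
Proof.
move=> t0 gi dg; have [b bE] := opB_linear G r mu eps.
rewrite /duhamel -/src (inv_op_integral bE _ _ opB_ker t0) -addrA; congr (_ + _).
have Ei : integrable_on 0 t (fun s => E (s - t) src i).
  have := integrable_exp_op bE 1 (- t) i (fun k => integrable_on_cst 0 t (src k)).
  by under eq_fun do rewrite mul1r.
rewrite (eq_integral_on dg) -integral_onZ// -integral_onD//; last exact: integrable_onZ.
apply: eq_integral_on; apply: lebesgue_aeS dg => s dg st.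
by rewrite (exp_op_lin bE) mul1r -dg// /duhamel_integrand opprB addrC.
Qed.

Lemma explicit_of_solution (u beta : R -> V -> R) : sol u beta ->
  {ae mes, forall t, T t -> subdiff (u t) (beta t) /\
     (forall i, - 2^-1 <= beta t i <= 2^-1)} /\
  (forall t, T t -> (forall i, L1 `[0, t] (fun s => duhamel_integrand B beta t s i)) /\
     u t = duhamel G r eps mu tf (u 0) beta t).
Proof.
move=> su; have [b bE] := opB_linear G r mu eps.
have [w [uw aew]] := solution_structure hV hmu htf heps hT su.
have [[u01 _ cu] _] := su; split.
  by apply: lebesgue_aeS aew => t H /H[_ sb bi]; split=> // i; case: (bi i).
move=> t Tt; have t0 := time_ge0 hT Tt.
suff [g gi [dg uE]] : exists2 g : R -> V -> R, (forall i, integrable_on 0 t (g ^~ i)) &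
    (forall i, {ae mes, forall s, 0 <= s <= t -> duhamel_integrand B beta t s i = g s i}) /\
    forall i, u t i = E (- t) (u 0) i +
    \int[mes]_(s in `[0, t]) E (s - t) (fun j => eps^-1 * beta s j + 1 * src j) i.
  split=> [i|]; last by apply/funext => i; rewrite uE (duhamelE _ t0 (gi i) (dg i)).
  exists (g ^~ i); first exact: gi.
  by apply: lebesgue_aeS (dg i) => s + /=; rewrite in_itv.
have [tle0|t_gt0] := leP t 0.
  have -> : t = 0 by apply/eqP; rewrite eq_le tle0.
  exists (fun _ _ => 0); first by move=> i; exact: integrable_on_cst.
  split=> i; last by rewrite oppr0 exp_op0 integral_on_set1 addr0.
  apply: lebesgue_aeS (lebesgue_ae_neq (0 : R)) => s s0 /andP[s1 s2].
  by move: s0; rewrite eq_le s1 s2.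
have [W [uW wW]] := ddt_primitive hT cu uw t_gt0 Tt.
have P i := primitive_exp_op bE 1 (- t) i uW.
(* The derivative in [s] of [E (s - t) (u s)], which the equation turns into the exponential of
   [eps^-1 * beta + src]. *)
pose D s i := E (1 * s - t) (W s) i + 1 * E (1 * s - t) (B (u s)) i.
have DE : {ae mes, forall s, 0 <= s <= t -> forall i,
    D s i = E (s - t) (fun j => eps^-1 * beta s j + 1 * src j) i}.
  apply: lebesgue_aeS2 wW (ae_time_itv hT Tt aew) => s wWs H st i.
  have [aE _ _] := H st; rewrite /D !mul1r -[LHS]mul1r mulrDr !mul1r.
  have -> : (fun j => eps^-1 * beta s j + 1 * src j) =
      (fun j => 1 * W s j + 1 * B (u s) j).
    apply/funext => j; rewrite -aE wWs// ace_field// /field.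
    by have := gt_eqF heps => /negbT e0; field.
  by rewrite (exp_op_lin bE) !mul1r.
have Ei i : integrable_on 0 t (fun s => E (s - t) src i).
  have := integrable_exp_op bE 1 (- t) i (fun k => integrable_on_cst 0 t (src k)).
  by under eq_fun do rewrite mul1r.
(* Solving the identity for the [beta] term gives an integrable representative without assuming that
   [beta] is Borel. *)
exists (fun s i => eps * (D s i - E (s - t) src i)) => [i|].
  by apply: integrable_onZ; apply: integrable_onB => //; case: (P i).
split=> i.
  apply: lebesgue_aeS DE => s /[apply] ->; rewrite (exp_op_lin bE) /duhamel_integrand opprB.
  by rewrite mul1r addrK mulrA mulfV ?mul1r// gt_eqF.
have [_ /(_ 0 t (lexx 0) t0 (lexx t))] := P i.
rewrite mul1r subrr exp_op0 mulr0 add0r => /eqP; rewrite subr_eq addrC => /eqP ->.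
congr (_ + _); apply: eq_integral_on; apply: lebesgue_aeS DE => s /[apply] <-.
by rewrite /D !mul1r.
Qed.

(* [beta] itself need not be Borel: a Borel representative on [[0, b]] is
   recovered by applying exp(b - s) to one of the integrand at time [b]. *)
Lemma explicit_primitive (u beta : R -> V -> R) b : 0 <= b ->
  (forall i, L1 `[0, b] (fun s => duhamel_integrand B beta b s i)) ->
  (forall t, 0 <= t <= b -> (forall i, L1 `[0, t] (fun s => duhamel_integrand B beta t s i)) /\
     u t = duhamel G r eps mu tf (u 0) beta t) ->
  exists W, (forall i, primitive_on 0 b (u ^~ i) (W ^~ i)) /\
  {ae mes, forall t, 0 <= t <= b -> forall i,
    W t i = eps^-1 * beta t i + fld (u t) i}.
Proof.
move=> b0 bL uE; have [m mE] := opB_linear G r mu eps.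
have /choice[g gP] : forall i, exists g, integrable_on 0 b g /\
    {ae mes, forall s, 0 <= s <= b -> E (- (b - s)) (beta s) i = g s}.
  move=> i; have [g gi gE] := bL i; by exists g.
pose bt s i := E (-1 * s + b) (g ^~ s) i.
have bti i : integrable_on 0 b (bt ^~ i).
  apply: (@integrable_exp_op R V B m mE 0 b (-1) b (fun s j => g j s)) => j.
  by case: (gP j).
have btE : {ae mes, forall s, 0 <= s <= b -> bt s = beta s}.
  apply: lebesgue_aeS (lebesgue_ae_fin (fun i => (gP i).2)) => s gs sb.
  rewrite /bt (_ : g ^~ s = E (- (b - s)) (beta s)); last first.
    by apply/funext => i; rewrite gs.
  apply/funext => i; rewrite (exp_opD mE) (_ : -1 * s + b + - (b - s) = 0) ?exp_op0//.
  by ring.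
pose z s j := eps^-1 * bt s j + 1 * src j.
have zi j : integrable_on 0 b (z ^~ j).
  apply: integrable_onD; first exact: integrable_onZ.
  exact: integrable_on_cst.
pose h s i := E (1 * s + 0) (z s) i.
have hi i : integrable_on 0 b (h ^~ i) by exact: (@integrable_exp_op R V B m mE 0 b 1 0 z i zi).
(* Factoring out [E (- t)] leaves an integrand in which [t] no longer appears, so [Y] is visibly
   absolutely continuous and [u t = E (- t) (Y t)]. *)
pose Y t i := u 0 i + \int[mes]_(s in `[0, t]) h s i.
have YP i : primitive_on 0 b (Y ^~ i) (h ^~ i).
  have := primitive_onD (primitive_on_cst 0 b (u 0 i)) (primitive_on_integral (hi i)).
  by congr primitive_on; apply/funext => s; rewrite add0r.
have ZP i := primitive_exp_op mE (-1) 0 i YP.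
have uZ t : 0 <= t <= b -> u t = E (-1 * t + 0) (Y t).
  move=> /[dup] tb /andP[t0 tb'].
  have [tL ->] := uE t tb; apply/funext => i; have [f fi fE] := tL i.
  rewrite (@duhamelE _ _ (fun s j => f s) _ _ t0 fi); last first.
    by apply: lebesgue_aeS fE => s + st; apply; rewrite /= in_itv.
  have -> : Y t = (fun j => 1 * u 0 j + 1 * \int[mes]_(s in `[0, t]) h s j).
    by apply/funext => j; rewrite !mul1r.
  rewrite (exp_op_lin mE) !mul1r addr0 mulN1r; congr (_ + _).
  rewrite (exp_op_integral mE); last by move=> j; exact: integrable_onS (hi j).
  apply: eq_integral_on; apply: lebesgue_aeS btE => s bts st.
  have sb : 0 <= s <= b by case/andP: st => -> /le_trans; apply.
  have -> : h s = E s (z s) by rewrite /h mul1r addr0.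
  by rewrite (exp_opD mE) (addrC (- t)) /z bts.
exists (fun t i => E (-1 * t + 0) (h t) i + -1 * E (-1 * t + 0) (B (Y t)) i); split=> [i|].
  by apply: eq_primitive_on (ZP i) => t tb; rewrite uZ.
apply: lebesgue_aeS btE => t btt tb i.
rewrite /field (uZ t tb) (exp_op_comm mE) /h (exp_opD mE).
rewrite (_ : -1 * t + 0 + (1 * t + 0) = 0); last by ring.
by rewrite exp_op0 /z btt//; ring.
Qed.

Lemma solution_of_explicit (u beta : R -> V -> R) :
  (forall t, T t -> in01 (u t)) ->
  {ae mes, forall t, T t -> subdiff (u t) (beta t) /\
     (forall i, - 2^-1 <= beta t i <= 2^-1)} ->
  (forall t, T t -> (forall i, L1 `[0, t] (fun s => duhamel_integrand B beta t s i)) /\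
     u t = duhamel G r eps mu tf (u 0) beta t) ->
  sol u beta.
Proof.
move=> u01 aeb uE.
have prim b : T b -> exists W, (forall i, primitive_on 0 b (u ^~ i) (W ^~ i)) /\
    {ae mes, forall t, 0 <= t <= b -> forall i,
      W t i = eps^-1 * beta t i + fld (u t) i}.
  move=> Tb; apply: explicit_primitive; first exact: (time_ge0 hT).
    by case: (uE b Tb).
  by move=> t /andP[t0 tb]; apply/uE/(time_le hT t0 tb).
have [L [C [_ C0 _ gC]]] := field_bounds G r mu tf eps.
pose w t i := eps^-1 * beta t i + fld (u t) i.
have ddt : is_ddt T u w.
  move=> a b Ta Tb; have [W [uW WE]] := prim b Tb.
  have a0 := time_ge0 hT Ta.
  (* The bound on [beta] makes the velocity bounded, hence square integrable; the integral formula
     alone gives only integrability. *)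
  apply: (@H1_with_primitive _ _ a b u w W (eps^-1 * 2^-1 + C)).
  - by move=> i; apply: primitive_onS (uW i).
  - move=> i; apply: lebesgue_aeS2 WE (ae_time_itv hT Tb aeb) => t Wt H /andP[at0 tb].
    have t0b : 0 <= t <= b by rewrite (le_trans a0).
    have [_ /(_ i) bi] := H t0b; rewrite Wt//.
    apply: le_trans (ler_normD _ _) _; apply: lerD; last first.
      by apply/gC/u01/(time_le hT _ tb Tb)/le_trans/at0.
    rewrite normrM gtr0_norm ?invr_gt0// ler_pM2l ?invr_gt0//.
    by rewrite ler_norml.
  - apply: lebesgue_aeS WE => t Wt /andP[at0 tb]; apply/funext => i.
    by rewrite Wt// (le_trans a0).
split.
  split=> //; first by move=> a b Ta Tb; exists w; exact: ddt.
  move=> i; apply/(within_time hT) => b Tb; have [W [uW _]] := prim b Tb.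
  exact: primitive_on_continuous (uW i).
exists w => //; apply: lebesgue_aeS aeb => t H Tt; have [sb _] := H Tt; split=> //.
apply/funext => i; rewrite ace_field// /w addrK mulrA mulfV ?mul1r// gt_eqF//.
Qed.

End explicit_form.

Unset Implicit Arguments.
Set Strict Implicit.
Set Printing Implicit Defensive.

Theorem theorem2p7 (R : realType) (V : finType) (G : weighted_graph R V)
  (hV : (1 < #|V|)%N)
  (r : R) (hr : 0 <= r <= 1)
  (mu : V -> R) (hmu : forall i, 0 <= mu i) (hmu0 : mu <> (fun=> 0))
  (tf : V -> R) (htf : in01 tf)
  (eps : R) (heps : 0 < eps)
  (T : set R)
  (hT : (exists2 T0 : R, 0 < T0 & T = `[0, T0]%classic) \/ T = `[0, +oo[%classic) :
  (* (a) existence *)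
  (forall u0 : V -> R, in01 u0 ->
     exists u beta, solution G r eps mu tf T u beta /\ u 0 = u0)
  /\
  (* (b) comparison *)
  (forall u beta v gamma du dv : R -> V -> R,
     regular01 T u -> regular01 T v ->
     is_ddt T u du -> is_ddt T v dv ->
     {ae @lebesgue_measure R, forall t, T t ->
        (forall i, beta t i <= ace G r eps mu tf (du t) (u t) i) /\
        subdiff (u t) (beta t)} ->
     {ae @lebesgue_measure R, forall t, T t ->
        (forall i, ace G r eps mu tf (dv t) (v t) i <= gamma t i) /\
        subdiff (v t) (gamma t)} ->
     (forall i, v 0 i <= u 0 i) ->
     forall t, T t -> forall i, v t i <= u t i)
  /\
  (* (c) uniqueness *)
  (forall u beta v gamma : R -> V -> R,
     solution G r eps mu tf T u beta -> solution G r eps mu tf T v gamma ->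
     u 0 = v 0 ->
     (forall t, T t -> u t = v t) /\
     {ae @lebesgue_measure R, forall t, T t -> beta t = gamma t})
  /\
  (* (d) gradient flow *)
  (forall u : R -> V -> R, solution_u G r eps mu tf T u ->
     forall s t, T s -> T t -> s <= t ->
       (GL G r eps mu tf (u t) <= GL G r eps mu tf (u s))%E)
  /\
  (* (e) weak form *)
  (forall u du beta : R -> V -> R,
     regular01 T u -> is_ddt T u du ->
     {ae @lebesgue_measure R, forall t, T t ->
        beta t = ace G r eps mu tf (du t) (u t)} ->
     (solution G r eps mu tf T u beta <->
      {ae @lebesgue_measure R, forall t, T t ->
         forall eta : V -> R, in01 eta ->
           0 <= inner G r (ace G r eps mu tf (du t) (u t)) (eta \- u t)}))
  /\
  (* (f) explicit form *)
  (~ spectrum (opA G r mu) eps^-1 ->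
   forall u beta : R -> V -> R, (forall t, T t -> in01 (u t)) ->
     (solution G r eps mu tf T u beta <->
      {ae @lebesgue_measure R, forall t, T t ->
         subdiff (u t) (beta t) /\
         (forall i, - 2^-1 <= beta t i <= 2^-1)} /\
      (forall t, T t ->
         (forall i, L1 `[0, t]
            (fun s => duhamel_integrand (opB G r eps mu) beta t s i)) /\
         u t = duhamel G r eps mu tf (u 0) beta t)))
  /\
  (* (g) Lipschitz regularity *)
  (~ spectrum (opA G r mu) eps^-1 ->
   forall u : R -> V -> R, solution_u G r eps mu tf T u ->
     exists L : R, forall s t, T s -> T t ->
       normV G r (u t \- u s) <= L * `|t - s|)
  /\
  (* (h) well-posedness *)
  (~ spectrum (opA G r mu) eps^-1 ->
   forall (u0 v0 : V -> R) (u v : R -> V -> R),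
     in01 u0 -> in01 v0 ->
     solution_u G r eps mu tf T u -> solution_u G r eps mu tf T v ->
     u 0 = u0 -> v 0 = v0 ->
     forall xi1 : R, spectrum (opA G r mu) xi1 ->
       (forall l, spectrum (opA G r mu) l -> xi1 <= l) ->
     forall t, T t ->
       normV G r (u t \- v t) <=
         expR (- (xi1 * t)) * expR (t / eps) * normV G r (u0 \- v0)).
Proof.
split; first by move=> u0 u01; exact: existence.
split; first by move=> u beta v gamma du dv; exact: comparison.
split; first by move=> u beta v gamma; exact: uniqueness.
split; first by move=> u [beta su]; exact: (gradient_flow hV hmu htf heps hT su).
split; first by move=> u du beta; exact: weak_form.
split.
  move=> hsp u beta u01; split; first exact: explicit_of_solution.
  by move=> [aeb uE]; exact: solution_of_explicit.
split; first by move=> _ u [beta su]; exact: (lipschitz_regularity hV hmu htf heps hT su).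
move=> _ u0 v0 u v _ _ [beta su] [gamma sv] <- <- xi _ xiP.
exact: (well_posedness hV heps hT su sv xiP).
Qed.
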